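(* Let $W:[0,1]\to\mathbb C$ be $(\sigma_*,2)$-Gevrey regular, $0<\sigma<\sigma_*$, and suppose $\mathcal L_s:\mathcal D^\sigma\to Y^\sigma$ is invertible at some $s_0\in\Omega_\sigma$. Fix $\delta>0$. Then there exist a neighbourhood $U\subset\Omega_\sigma$ of $s_0$ and a constant $C$ depending on $U,\delta,W$ such that for every $f\in Y^\sigma$ with support in $[\delta,1]$ and every $s\in U$, $\|\mathcal L_s^{-1}f\|_{H^2(I)}\le C\|f\|_{L^2(I)}$.
   Context: Let $I=(0,1)$. A function $u\in C^\infty(\overline I)$ is $(\sigma,k)$-Gevrey regular ($\sigma,k>0$) if there is $C>0$ with $\sup_{x\in I}|u^{(n)}(x)|\le C\sigma^{-n}(n!)^k$ for all $n\ge0$. For $\sigma>0$, $u\in C^\infty(\overline I)$, $k\in\{0,1,2\}$: $|u|^{0}_{\sigma,k,0}=\big(\sum_{n=0}^\infty\frac{\sigma^{2n}}{n!^2(n+1)!^2}n^{k}\int_0^1(x/\sigma)^k|\partial_x^nu|^2dx\big)^{1/2}$ (with $0^0:=1$), $\|u\|_{\sigma,0,0}=|u|^0_{\sigma,0,0}$, $[u]^0_\sigma=(\sum_{n=0}^\infty\frac{\sigma^{2n+1}}{n!^2(n+1)!^2}|u^{(n)}(0)|^2)^{1/2}$. $X^\sigma=\{u\in C^\infty(\overline I):u(1)=0,\ \|\partial_xu\|_{\sigma,0,0}+|\partial_xu|^0_{\sigma,1,0}+|\partial_xu|^0_{\sigma,2,0}+[\partial_xu]^0_\sigma<\infty\}$,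 $Y^\sigma=\{u\in C^\infty(\overline I):\|u\|_{\sigma,0,0}+|u|^0_{\sigma,1,0}+[u]^0_\sigma<\infty\}$. $\Omega^1_\sigma=\{s:\Re s\le0,\ \sigma<|\Im s|\}\cup\{s:\Re s>0,\ \sigma<|s|\}$; $\Omega^2_\sigma=\{s:\ \sigma<|s|+\Re s,\ \sigma>\frac{-\Re(s)|s|}{2(|s|+\Re s)}\}$; $\Omega^3_\sigma=\{s\neq0:\ \sigma(|s|-\sigma+\Re s)-(\sigma(1+\frac{\Re s}{|s|})+\frac12\Re s)^2>0\}$; $\Omega_\sigma=\Omega^1_\sigma\cap(\Omega^2_\sigma\cup\Omega^3_\sigma)$. $\mathcal L_su=\frac{d}{dx}(x^2\frac{du}{dx})+s\frac{du}{dx}-Wu$ and $\mathcal D^\sigma=\{u\in X^\sigma:\mathcal L_su\in Y^\sigma\}$. *)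

(* Defs.v *)
From Stdlib Require Import Reals Lra Arith Classical ClassicalEpsilon.
Open Scope R_scope.

Record Cx : Type := mkC { Re : R; Im : R }.
Definition C0 : Cx := mkC 0 0.
Definition Cadd (a b : Cx) : Cx := mkC (Re a + Re b) (Im a + Im b).
Definition Cmul (a b : Cx) : Cx :=
  mkC (Re a * Re b - Im a * Im b) (Re a * Im b + Im a * Re b).
Definition Copp (a : Cx) : Cx := mkC (- Re a) (- Im a).
Definition Csub (a b : Cx) : Cx := Cadd a (Copp b).
Definition RtoC (r : R) : Cx := mkC r 0.
Definition Cmod (a : Cx) : R := sqrt (Re a ^ 2 + Im a ^ 2).

Definition has_deriv01 (g g' : R -> R) : Prop :=
  forall x, 0 <= x <= 1 ->
    limit1_in (fun h => (g (x + h) - g x) / h)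
              (fun h => h <> 0 /\ 0 <= x + h <= 1) (g' x) 0.

Definition is_dseq (u : R -> Cx) (D : nat -> R -> Cx) : Prop :=
  (forall x, 0 <= x <= 1 -> D 0%nat x = u x) /\
  (forall n, has_deriv01 (fun x => Re (D n x)) (fun x => Re (D (S n) x)) /\
             has_deriv01 (fun x => Im (D n x)) (fun x => Im (D (S n) x))).

Definition smooth01 (u : R -> Cx) : Prop := exists D, is_dseq u D.

(** the derivatives of u (meaningful on [0,1] when u is smooth; derivatives
    on a nondegenerate interval are unique there) *)
Definition dseq (u : R -> Cx) : nat -> R -> Cx :=
  epsilon (inhabits (fun _ _ => C0)) (fun D => is_dseq u D).

(** Riemann integral over [0,1] (unspecified if not integrable; never used in that case) *)
Definition RInt01 (g : R -> R) : R :=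
  epsilon (inhabits 0) (fun I => exists pr : Riemann_integrable g 0 1, RiemannInt pr = I).

Definition series_finite (a : nat -> R) : Prop := exists l, infinite_sum a l.

(** Gevrey-type norms, expressed on a derivative sequence d (d n = ∂^n v) *)
Definition wgt (sigma : R) (n : nat) : R :=
  sigma ^ (2 * n) / (INR (Factorial.fact n) ^ 2 * INR (Factorial.fact (S n)) ^ 2).

Definition term_k (sigma : R) (k : nat) (d : nat -> R -> Cx) (n : nat) : R :=
  wgt sigma n * INR n ^ k * RInt01 (fun x => (x / sigma) ^ k * Cmod (d n x) ^ 2).

Definition term_b (sigma : R) (d : nat -> R -> Cx) (n : nat) : R :=
  sigma ^ (2 * n + 1) / (INR (Factorial.fact n) ^ 2 * INR (Factorial.fact (S n)) ^ 2) * Cmod (d n 0) ^ 2.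

Definition inX (sigma : R) (u : R -> Cx) : Prop :=
  smooth01 u /\ u 1 = C0 /\
  let d := fun n => dseq u (S n) in
  series_finite (term_k sigma 0 d) /\ series_finite (term_k sigma 1 d) /\
  series_finite (term_k sigma 2 d) /\ series_finite (term_b sigma d).

Definition inY (sigma : R) (u : R -> Cx) : Prop :=
  smooth01 u /\
  let d := dseq u in
  series_finite (term_k sigma 0 d) /\ series_finite (term_k sigma 1 d) /\
  series_finite (term_b sigma d).

(** L_s u = d/dx (x^2 du/dx) + s du/dx - W u  (product rule expanded) *)
Definition Lop (W : R -> Cx) (s : Cx) (u : R -> Cx) (x : R) : Cx :=
  Csub (Cadd (Cadd (Cmul (RtoC (x ^ 2)) (dseq u 2 x)) (Cmul (RtoC (2 * x)) (dseq u 1 x)))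
             (Cmul s (dseq u 1 x)))
       (Cmul (W x) (u x)).

Definition inD (sigma : R) (W : R -> Cx) (s : Cx) (u : R -> Cx) : Prop :=
  inX sigma u /\ inY sigma (Lop W s u).

Definition eq01 (f g : R -> Cx) : Prop := forall x, 0 <= x <= 1 -> f x = g x.

Definition L_invertible (sigma : R) (W : R -> Cx) (s : Cx) : Prop :=
  (forall f, inY sigma f -> exists u, inD sigma W s u /\ eq01 (Lop W s u) f) /\
  (forall u1 u2, inD sigma W s u1 -> inD sigma W s u2 ->
     eq01 (Lop W s u1) (Lop W s u2) -> eq01 u1 u2).

Definition gevrey (sigma : R) (k : nat) (u : R -> Cx) : Prop :=
  smooth01 u /\
  exists C, C > 0 /\ forall n x, 0 < x < 1 ->
    Cmod (dseq u n x) <= C * (/ sigma) ^ n * INR (Factorial.fact n) ^ k.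

Definition Omega1 (sigma : R) (s : Cx) : Prop :=
  (Re s <= 0 /\ sigma < Rabs (Im s)) \/ (Re s > 0 /\ sigma < Cmod s).
Definition Omega2 (sigma : R) (s : Cx) : Prop :=
  sigma < Cmod s + Re s /\ sigma > - Re s * Cmod s / (2 * (Cmod s + Re s)).
Definition Omega3 (sigma : R) (s : Cx) : Prop :=
  s <> C0 /\
  sigma * (Cmod s - sigma + Re s) - (sigma * (1 + Re s / Cmod s) + / 2 * Re s) ^ 2 > 0.
Definition Omega (sigma : R) (s : Cx) : Prop :=
  Omega1 sigma s /\ (Omega2 sigma s \/ Omega3 sigma s).

Definition L2norm (f : R -> Cx) : R := sqrt (RInt01 (fun x => Cmod (f x) ^ 2)).
Definition H2norm (v : R -> Cx) : R :=
  sqrt (RInt01 (fun x => Cmod (v x) ^ 2 + Cmod (dseq v 1 x) ^ 2 + Cmod (dseq v 2 x) ^ 2)).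

(* Main.v *)
Require Import Defs.
From Stdlib Require Import Reals Lra Lia Arith ClassicalEpsilon FunctionalExtensionality.
From Coquelicot Require Import Rcomplements Hierarchy Continuity Derive RInt RInt_analysis Lim_seq.
From Coquelicot Require Complex.
Open Scope R_scope.

(** Since [L_s - L_{s0} = (s - s0) d/dx] and [d/dx] maps [X] to [Y] with norm at most [1], the open
mapping theorem at [s0] and a Neumann series give invertibility near [s0] with a uniform bound for
[L_s^{-1} : Y -> X].  For the estimate in [H^2], let [f] vanish on [[0, d)].  Away from [0] the
equation is regular, so there is a solution [v] of [L_s v = f] vanishing on [[0, d]], and Gronwall's
inequality bounds [v] in [H^2] by the L2 norm of [f].  Differentiating the equation [n] times yields
[|v^(n)| <= K sigma^-n (n-1)! (n-2)!] in L2, so [v - v(1)] lies in [X].  Then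
[psi = u - v + v(1)] lies in [X] and satisfies [L_s psi = - v(1) W], whence
[psi = - v(1) L_s^{-1} W], which is bounded by a constant times [|v(1)|]. *)

(** The membership of [v - v(1)] in X serves only to apply the injectivity of [L_s], which is known
    in X alone, so it may be qualitative: its bound depends on the Y-norm of [f] and does not reach
    the final constant. That constant has two sources, the energy estimate for [v] and the fixed
    element [L_s^{-1} W], which only the number [v(1)] multiplies. The obstacle is to get [v] into X
    with the same sigma as [f], although dividing by [x^2] costs the possibly huge factor [4 / d^2]
    at every order. Up to a constant, the growth [sigma^-n n! (n+1)!] that Y allows to [f^(n)] is
    exactly the one claimed for [v^(n+2)]; relative to it every other term of the differentiated
    equation carries a factor of size [1/n], which beats any constant from some order on. For the
    Leibniz sum of [W v] this uses that sigma is strictly below the Gevrey radius of [W]. Norms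
    appear only as upper bounds ([gauge D M]), with bounds on partial sums in place of infinite
    series. *)

Definition clamp (x : R) : R := Rmax 0 (Rmin x 1).

Lemma clamp_range x : 0 <= clamp x <= 1.
Proof. unfold clamp, Rmax, Rmin; repeat destruct Rle_dec; lra. Qed.

Lemma clamp_id x : 0 <= x <= 1 -> clamp x = x.
Proof. unfold clamp, Rmax, Rmin; repeat destruct Rle_dec; lra. Qed.

Lemma clamp_lipschitz x y : Rabs (clamp y - clamp x) <= Rabs (y - x).
Proof.
unfold clamp, Rmax, Rmin; repeat destruct Rle_dec;
  unfold Rabs; repeat destruct Rcase_abs; lra.
Qed.

Lemma continuous_eps (f : R -> R) x :
  continuous f x <->
  forall e, 0 < e -> exists d, 0 < d /\ forall y, Rabs (y - x) < d -> Rabs (f y - f x) < e.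
Proof.
split.
- intros H e He.
  apply continuity_pt_filterlim in H.
  destruct (H e He) as [d [Hd H']].
  exists d; split; [exact Hd|]; intros y Hy.
  destruct (Req_dec x y) as [->|Hn].
  + rewrite Rminus_diag_eq, Rabs_R0 by easy; lra.
  + apply H'; split; [split; [exact I|exact Hn]|exact Hy].
- intros H; apply continuity_pt_filterlim; intros e He.
  destruct (H e He) as [d [Hd H']].
  exists d; split; [exact Hd|]; intros y [_ Hy]; apply H'; exact Hy.
Qed.

Lemma clamp_continuous x : continuous clamp x.
Proof.
apply continuous_eps; intros e He; exists e; split; [lra|]; intros y Hy.
eapply Rle_lt_trans; [apply clamp_lipschitz|exact Hy].
Qed.

(* A function on [0,1] is represented by its extension that is constant outside [0,1]. *)
Definition cfun (g : R -> R) : Prop :=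
  (forall x, g x = g (clamp x)) /\ (forall x, continuous g x).

(** Only interior points count: the constant extension usually has a corner at 0 and 1, and the
    one-sided derivatives there are recovered from the continuity of [g'] in [der_has_deriv01]. *)
Definition der (g g' : R -> R) : Prop := forall x, 0 < x < 1 -> is_derive g x (g' x).

Lemma cfun_const c : cfun (fun _ => c).
Proof. split; [easy|]; intros; apply continuous_const. Qed.

Lemma cfun_plus f g : cfun f -> cfun g -> cfun (fun x => f x + g x).
Proof.
intros [Hf Cf] [Hg Cg]; split; intros x.
- now rewrite (Hf x), (Hg x).
- apply (continuous_plus f g x); auto.
Qed.

Lemma cfun_mult f g : cfun f -> cfun g -> cfun (fun x => f x * g x).
Proof.
intros [Hf Cf] [Hg Cg]; split; intros x.
- now rewrite (Hf x), (Hg x).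
- apply (continuous_mult f g x); auto.
Qed.

Lemma cfun_opp f : cfun f -> cfun (fun x => - f x).
Proof.
intros [Hf Cf]; split; intros x; [now rewrite Hf|].
apply (continuous_opp f x); auto.
Qed.

Lemma cfun_minus f g : cfun f -> cfun g -> cfun (fun x => f x - g x).
Proof. intros; apply (cfun_plus f (fun x => - g x)); auto using cfun_opp. Qed.

Lemma cfun_clamp : cfun clamp.
Proof.
split; [|apply clamp_continuous].
intros x; rewrite (clamp_id (clamp x)); auto using clamp_range.
Qed.

Lemma cfun_comp_clamp (f : R -> R) : (forall x, continuous f x) -> cfun (fun x => f (clamp x)).
Proof.
intros Cf; split; intros x.
- now rewrite (clamp_id (clamp x)) by apply clamp_range.
- apply (continuous_comp clamp f); auto using clamp_continuous.
Qed.

(** * Integrals of continuous functions *)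

Lemma cts_ex_RInt (f : R -> R) a b : (forall x, continuous f x) -> ex_RInt f a b.
Proof. intros H; apply (ex_RInt_continuous (V := R_CompleteNormedModule)); intros; apply H. Qed.

Definition RI (g : R -> R) (a b : R) : R := RInt g a b.

Definition cts (g : R -> R) : Prop := forall x, continuous g x.

Lemma cfun_cts g : cfun g -> cts g.
Proof. intros H; exact (proj2 H). Qed.

Lemma is_derive_RI g a x : cts g -> is_derive (RI g a) x (g x).
Proof.
intros C; apply (is_derive_RInt g _ a x); [|apply C].
exists (mkposreal 1 Rlt_0_1); intros y _.
apply (RInt_correct (V := R_CompleteNormedModule)), cts_ex_RInt, C.
Qed.

Lemma RI_continuous g a x : cts g -> continuous (RI g a) x.
Proof.
intros C; apply (ex_derive_continuous (RI g a) x).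
exists (g x); now apply is_derive_RI.
Qed.

Lemma RI_point g a : RI g a a = 0.
Proof. apply (RInt_point (V := R_CompleteNormedModule)). Qed.

Lemma RI_chasles g a b c : cts g -> RI g a b + RI g b c = RI g a c.
Proof. intros C; apply (RInt_Chasles (V := R_CompleteNormedModule)); now apply cts_ex_RInt. Qed.

Lemma RI_plus f g a b : cts f -> cts g -> RI (fun x => f x + g x) a b = RI f a b + RI g a b.
Proof. intros Cf Cg; apply (RInt_plus (V := R_CompleteNormedModule)); now apply cts_ex_RInt. Qed.

Lemma RI_scal c g a b : cts g -> RI (fun x => c * g x) a b = c * RI g a b.
Proof. intros C; apply (RInt_scal (V := R_CompleteNormedModule)); now apply cts_ex_RInt. Qed.

Lemma RI_const c a b : RI (fun _ => c) a b = (b - a) * c.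
Proof. apply (RInt_const (V := R_CompleteNormedModule)). Qed.

Lemma RI_ext f g : (forall x, 0 <= x <= 1 -> f x = g x) ->
  forall a b, 0 <= a <= 1 -> 0 <= b <= 1 -> RI f a b = RI g a b.
Proof.
intros H a b Ha Hb; apply (RInt_ext (V := R_CompleteNormedModule)); intros x Hx; apply H.
revert Hx; unfold Rmin, Rmax; destruct Rle_dec; lra.
Qed.

Lemma RI_le f g a b : cts f -> cts g -> a <= b -> (forall x, a <= x <= b -> f x <= g x) ->
  RI f a b <= RI g a b.
Proof.
intros Cf Cg Hab H; apply RInt_le; auto; try now apply cts_ex_RInt.
intros x Hx; apply H; lra.
Qed.

Lemma RI_nonneg f a b : cts f -> a <= b -> (forall x, a <= x <= b -> 0 <= f x) -> 0 <= RI f a b.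
Proof.
intros C Hab H.
assert (H0 : RI (fun _ => 0) a b = 0) by (rewrite RI_const; ring).
rewrite <- H0; apply RI_le; auto.
intros x; apply continuous_const.
Qed.

Lemma cts_plus f g : cts f -> cts g -> cts (fun x => f x + g x).
Proof. intros Hf Hg x; apply (continuous_plus f g x); auto. Qed.

Lemma cts_mult f g : cts f -> cts g -> cts (fun x => f x * g x).
Proof. intros Hf Hg x; apply (continuous_mult f g x); auto. Qed.

Lemma cts_const c : cts (fun _ => c).
Proof. intros x; apply continuous_const. Qed.

(** The derivative is known only inside (0,1). The mean value theorem still applies to
    [g - RI g' a], which is continuous up to the end points and has derivative 0 inside. *)
Lemma ftc01 g g' a b : cfun g -> cfun g' -> der g g' ->
  0 <= a <= 1 -> 0 <= b <= 1 -> RI g' a b = g b - g a.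
Proof.
intros [_ Cg] [_ Cg'] Hd Ha Hb.
destruct (MVT_gen (fun x => g x - RI g' a x) a b (fun _ => 0)) as [c [_ Hc]].
- intros x Hx.
  replace 0 with (g' x - g' x) by ring.
  apply (is_derive_minus g (RI g' a) x).
  + apply Hd; revert Hx; unfold Rmin, Rmax; destruct Rle_dec; lra.
  + now apply is_derive_RI.
- intros x _; apply continuity_pt_filterlim.
  apply (continuous_minus g (RI g' a) x); [apply Cg|].
  now apply RI_continuous.
- rewrite RI_point in Hc; lra.
Qed.

(** Converse of [ftc01]. An integral identity survives uniform limits while a derivative does not,
    so limits of derivative sequences are differentiated through this lemma. *)
Lemma der_of_integral g g' : cts g' ->
  (forall x, 0 <= x <= 1 -> g x = g 0 + RI g' 0 x) -> der g g'.
Proof.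
intros C H x Hx.
apply (is_derive_ext_loc (fun y => g 0 + RI g' 0 y)).
- assert (Hp : 0 < Rmin x (1 - x)) by (apply Rmin_pos; lra).
  exists (mkposreal _ Hp); intros y Hy.
  symmetry; apply H.
  unfold ball in Hy; simpl in Hy; unfold AbsRing_ball, abs, minus, plus, opp in Hy; simpl in Hy.
  pose proof (Rmin_l x (1 - x)); pose proof (Rmin_r x (1 - x)).
  apply Rabs_def2 in Hy; lra.
- replace (g' x) with (0 + g' x) by ring.
  apply (is_derive_plus (fun _ => g 0) (RI g' 0) x).
  + apply is_derive_Reals, derivable_pt_lim_const.
  + now apply is_derive_RI.
Qed.

Definition prim (a : R) (g : R -> R) (x : R) : R := RI g a (clamp x).

Lemma cfun_prim a g : cfun g -> cfun (prim a g).
Proof.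
intros [_ C]; apply (cfun_comp_clamp (RI g a)).
intros; now apply RI_continuous.
Qed.

Lemma der_prim a g : cfun g -> der (prim a g) g.
Proof.
intros [_ C]; apply der_of_integral; [exact C|].
intros x Hx; unfold prim; rewrite !clamp_id by lra.
now rewrite RI_chasles.
Qed.

(** Density of (0,1) in [0,1] handles the end points, [clamp] everything outside. *)
Lemma cfun_le_closed g c : cfun g -> (forall x, 0 < x < 1 -> g x <= c) -> forall x, g x <= c.
Proof.
intros [Hg Cg] H x; rewrite Hg; pose proof (clamp_range x) as Hx.
set (y := clamp x) in *; clearbody y.
apply Rnot_lt_le; intros Hlt.
destruct (proj1 (continuous_eps g y) (Cg y) (g y - c)) as [d [Hd H']]; [lra|].
(* The point [z] is [y] moved by at most 1/4 away from the nearer end point. *)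
assert (exists z, 0 < z < 1 /\ Rabs (z - y) < d) as [z [Hz Hzy]].
{ destruct (Rle_dec y (1/2)).
  - exists (y + Rmin (d/2) (1/4)).
    pose proof (Rmin_l (d/2) (1/4)); pose proof (Rmin_r (d/2) (1/4)).
    assert (0 < Rmin (d/2) (1/4)) by (apply Rmin_pos; lra).
    split; [lra|]; rewrite Rabs_right; lra.
  - exists (y - Rmin (d/2) (1/4)).
    pose proof (Rmin_l (d/2) (1/4)); pose proof (Rmin_r (d/2) (1/4)).
    assert (0 < Rmin (d/2) (1/4)) by (apply Rmin_pos; lra).
    split; [lra|]; rewrite Rabs_left; lra. }
specialize (H' z Hzy); specialize (H z Hz).
apply Rabs_def2 in H'; lra.
Qed.

Lemma cfun_eq_closed g h : cfun g -> cfun h -> (forall x, 0 < x < 1 -> g x = h x) ->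
  forall x, g x = h x.
Proof.
intros Hg Hh H x.
assert (g x - h x <= 0).
{ apply (cfun_le_closed (fun x => g x - h x)); [now apply cfun_minus|].
  intros y Hy; rewrite H by easy; lra. }
assert (h x - g x <= 0).
{ apply (cfun_le_closed (fun x => h x - g x)); [now apply cfun_minus|].
  intros y Hy; rewrite H by easy; lra. }
lra.
Qed.

Definition chainR (g : nat -> R -> R) : Prop :=
  forall n, cfun (g n) /\ der (g n) (g (S n)).

Lemma der_unique g g1 g2 : cfun g1 -> cfun g2 -> der g g1 -> der g g2 -> forall x, g1 x = g2 x.
Proof.
intros C1 C2 D1 D2; apply cfun_eq_closed; auto.
intros x Hx; rewrite <- (is_derive_unique _ _ _ (D1 x Hx)).
now apply is_derive_unique, D2.
Qed.

Lemma der_ext g h g' : (forall x, g x = h x) -> der g g' -> der h g'.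
Proof. intros H D x Hx; apply (is_derive_ext g); auto. Qed.

(** Continuity turns agreement on (0,1) into agreement everywhere, and the next order follows
    because derivatives inside are unique. *)
Lemma chainR_unique g h : chainR g -> chainR h ->
  (forall x, 0 < x < 1 -> g 0%nat x = h 0%nat x) -> forall n x, g n x = h n x.
Proof.
intros Hg Hh H0; induction n as [|n IH].
- apply cfun_eq_closed; [apply Hg|apply Hh|auto].
- apply (der_unique (h n)); [apply Hg|apply Hh| |apply Hh].
  apply (der_ext (g n)); [exact IH|apply Hg].
Qed.

Lemma cfun_comp_clamp_deriv g g' : has_deriv01 g g' -> cfun (fun x => g (clamp x)).
Proof.
intros H; split.
{ intros x; now rewrite (clamp_id (clamp x)) by apply clamp_range. }
intros x; apply continuous_eps; intros e He.
pose proof (clamp_range x) as Hx; set (c := clamp x) in *.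
destruct (H c Hx 1 Rlt_0_1) as [d [Hd Hlim]].
(* The difference quotient at [c] stays within 1 of [g' c], so a small increment [h] changes [g] by
   at most [K * |h|]. *)
set (K := Rabs (g' c) + 1).
assert (HK : 0 < K) by (unfold K; pose proof (Rabs_pos (g' c)); lra).
exists (Rmin d (e / K)); split.
{ apply Rmin_pos; [lra|]; now apply Rdiv_lt_0_compat. }
intros y Hy.
assert (Hyc : Rabs (clamp y - c) < Rmin d (e / K))
  by (eapply Rle_lt_trans; [apply clamp_lipschitz|exact Hy]).
pose proof (Rmin_l d (e / K)); pose proof (Rmin_r d (e / K)).
pose proof (clamp_range y).
destruct (Req_dec (clamp y) c) as [->|Hn].
{ rewrite Rminus_diag_eq, Rabs_R0 by easy; lra. }
set (h := clamp y - c) in *.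
assert (Hh : h <> 0) by (unfold h; lra).
specialize (Hlim h); simpl in Hlim; unfold Rdist in Hlim.
replace (h - 0) with h in Hlim by ring.
assert (Hq : Rabs ((g (c + h) - g c) / h - g' c) < 1).
{ apply Hlim; repeat split; try lra; unfold h; lra. }
replace (c + h) with (clamp y) in Hq by (unfold h; ring).
assert (Hq2 : Rabs ((g (clamp y) - g c) / h) < K).
{ replace ((g (clamp y) - g c) / h) with (((g (clamp y) - g c) / h - g' c) + g' c) by ring.
  eapply Rle_lt_trans; [apply Rabs_triang|]; unfold K; lra. }
replace (g (clamp y) - g c) with ((g (clamp y) - g c) / h * h) by (field; easy).
rewrite Rabs_mult.
assert (Hhp : 0 < Rabs h) by now apply Rabs_pos_lt.
apply Rlt_trans with (K * Rabs h).
- now apply Rmult_lt_compat_r.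
- apply Rlt_le_trans with (K * (e / K)); [apply Rmult_lt_compat_l; lra|].
  right; field; lra.
Qed.

Lemma has_deriv01_der g g' : has_deriv01 g g' ->
  der (fun x => g (clamp x)) (fun x => g' (clamp x)).
Proof.
intros H x Hx.
apply is_derive_Reals; intros e He.
rewrite (clamp_id x) by lra.
destruct (H x ltac:(lra) e He) as [d [Hd Hlim]].
assert (Hp : 0 < Rmin d (Rmin x (1 - x))) by (repeat apply Rmin_pos; lra).
exists (mkposreal _ Hp); simpl; intros h Hh Hhd.
pose proof (Rmin_l d (Rmin x (1 - x))); pose proof (Rmin_r d (Rmin x (1 - x))).
pose proof (Rmin_l x (1 - x)); pose proof (Rmin_r x (1 - x)).
assert (0 <= x + h <= 1) by (apply Rabs_def2 in Hhd; lra).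
rewrite clamp_id by easy.
apply Hlim; simpl; unfold Rdist; repeat split; try lra.
replace (h - 0) with h by ring; lra.
Qed.

(** At an end point the mean value theorem writes the one-sided quotient as [g'] at an intermediate
    point, and continuity of [g'] gives the limit. *)
Lemma der_has_deriv01 g g' : cfun g -> cfun g' -> der g g' -> has_deriv01 g g'.
Proof.
intros Hg Hg' Hd x Hx e He.
destruct (proj1 (continuous_eps g' x) (proj2 Hg' x) e He) as [d [Hdp Hc]].
exists d; split; [exact Hdp|]; simpl; unfold Rdist; intros h [[Hh Hxh] Hhd].
replace (h - 0) with h in Hhd by ring.
destruct (MVT_gen g x (x + h) g') as [c [Hcr Hmv]].
- intros y Hy; apply Hd; revert Hy; unfold Rmin, Rmax; destruct Rle_dec; lra.
- intros y _; apply continuity_pt_filterlim, Hg.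
- rewrite Hmv; replace (g' c * (x + h - x) / h) with (g' c) by (field; easy).
  apply Hc; eapply Rle_lt_trans; [|exact Hhd].
  revert Hcr; unfold Rmin, Rmax, Rabs; repeat destruct Rle_dec; repeat destruct Rcase_abs; lra.
Qed.

(** * Complex values, and smooth functions as derivative sequences *)

Lemma Ceq a b : Re a = Re b -> Im a = Im b -> a = b.
Proof. destruct a, b; simpl; intros -> ->; reflexivity. Qed.

(** The squared modulus is kept apart from [Cmod] because it is polynomial in the components:
    continuity, differentiation and Young's inequality then involve no square root. *)
Definition N2 (z : Cx) : R := Re z ^ 2 + Im z ^ 2.

Lemma N2_nonneg z : 0 <= N2 z.
Proof. unfold N2; nra. Qed.

Lemma Cmod_sq z : Cmod z ^ 2 = N2 z.
Proof. unfold Cmod; apply pow2_sqrt, N2_nonneg. Qed.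

Lemma Cmod_nonneg z : 0 <= Cmod z.
Proof. apply sqrt_pos. Qed.

Lemma Cmod_triangle a b : Cmod (Cadd a b) <= Cmod a + Cmod b.
Proof. exact (Complex.Cmod_triangle (Re a, Im a) (Re b, Im b)). Qed.

Lemma Cmod_mul a b : Cmod (Cmul a b) = Cmod a * Cmod b.
Proof. exact (Complex.Cmod_mult (Re a, Im a) (Re b, Im b)). Qed.

Lemma Cmod_opp a : Cmod (Copp a) = Cmod a.
Proof. exact (Complex.Cmod_opp (Re a, Im a)). Qed.

Lemma Cmod_RtoC r : Cmod (RtoC r) = Rabs r.
Proof. exact (Complex.Cmod_R r). Qed.

Lemma Cmod_sub a b : Cmod (Csub a b) <= Cmod a + Cmod b.
Proof. unfold Csub; rewrite <- (Cmod_opp b); apply Cmod_triangle. Qed.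

Lemma Cmod_N2_le z m : 0 <= m -> N2 z <= m ^ 2 -> Cmod z <= m.
Proof.
intros Hm H; pose proof (Cmod_sq z); pose proof (Cmod_nonneg z).
apply Rnot_lt_le; intros Hlt; nra.
Qed.

Lemma Re_le_Cmod z : Rabs (Re z) <= Cmod z.
Proof. exact (Complex.re_le_Cmod (Re z, Im z)). Qed.

Lemma Im_le_Cmod z : Rabs (Im z) <= Cmod z.
Proof.
apply Rabs_le_between; pose proof (Cmod_sq z) as H; pose proof (Cmod_nonneg z).
unfold N2 in H; pose proof (pow2_ge_0 (Re z)); split; apply Rnot_lt_le; intros Hl; nra.
Qed.

Lemma Cmod_le_comp z m : Rabs (Re z) <= m -> Rabs (Im z) <= m -> Cmod z <= 2 * m.
Proof.
intros H1 H2; pose proof (Rabs_pos (Re z)); apply Cmod_N2_le; [lra|].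
unfold N2; rewrite <- (pow2_abs (Re z)), <- (pow2_abs (Im z)).
pose proof (Rabs_pos (Im z)); nra.
Qed.

Lemma Cmod_eq0 z : Cmod z <= 0 -> z = C0.
Proof.
intros H; pose proof (Re_le_Cmod z); pose proof (Im_le_Cmod z).
apply Rabs_le_between in H0, H1; apply Ceq; simpl; lra.
Qed.

Lemma N2_mul a b : N2 (Cmul a b) = N2 a * N2 b.
Proof. unfold N2; simpl; ring. Qed.

(* Young's inequality: with [t] the quotient of the two bounds it gives Minkowski for any sum of integrals of [N2]. *)
Lemma N2_add t a b : 0 < t -> N2 (Cadd a b) <= (1 + t) * N2 a + (1 + / t) * N2 b.
Proof.
intros Ht.
assert (K : forall x y, (x + y) ^ 2 <= (1 + t) * x ^ 2 + (1 + / t) * y ^ 2).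
{ intros x y.
  replace ((1 + t) * x ^ 2 + (1 + / t) * y ^ 2) with
    ((x + y) ^ 2 + / t * (t * x - y) ^ 2) by (field; lra).
  assert (0 < / t) by now apply Rinv_0_lt_compat.
  pose proof (pow2_ge_0 (t * x - y)); nra. }
pose proof (K (Re a) (Re b)); pose proof (K (Im a) (Im b)).
unfold N2; simpl Re; simpl Im; lra.
Qed.

Definition cfun2 (h : R -> Cx) : Prop := cfun (fun x => Re (h x)) /\ cfun (fun x => Im (h x)).

Definition der2 (h h' : R -> Cx) : Prop :=
  der (fun x => Re (h x)) (fun x => Re (h' x)) /\ der (fun x => Im (h x)) (fun x => Im (h' x)).

Lemma cfun2_clamp h x : cfun2 h -> h x = h (clamp x).
Proof. intros [[H1 _] [H2 _]]; apply Ceq; [apply H1|apply H2]. Qed.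

Lemma cfun2_add f g : cfun2 f -> cfun2 g -> cfun2 (fun x => Cadd (f x) (g x)).
Proof. intros [? ?] [? ?]; split; simpl; now apply cfun_plus. Qed.

Lemma cfun2_mul f g : cfun2 f -> cfun2 g -> cfun2 (fun x => Cmul (f x) (g x)).
Proof.
intros [? ?] [? ?]; split; simpl.
- now apply cfun_minus; apply cfun_mult.
- now apply cfun_plus; apply cfun_mult.
Qed.

Lemma cfun2_const c : cfun2 (fun _ => c).
Proof. split; apply cfun_const. Qed.

Lemma cfun2_ext f g : (forall x, f x = g x) -> cfun2 f -> cfun2 g.
Proof. intros H; replace g with f; [easy|]; now apply functional_extensionality. Qed.

Lemma cts_N2 h : cfun2 h -> cts (fun x => N2 (h x)).
Proof.
intros [[_ H1] [_ H2]]; unfold N2; simpl.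
apply cts_plus; apply cts_mult; auto; apply cts_mult; auto; apply cts_const.
Qed.

Lemma cfun2_eq_closed g h : cfun2 g -> cfun2 h -> (forall x, 0 < x < 1 -> g x = h x) ->
  forall x, g x = h x.
Proof.
intros [G1 G2] [H1 H2] H x; apply Ceq.
- apply (cfun_eq_closed (fun x => Re (g x)) (fun x => Re (h x))); auto; intros; now rewrite H.
- apply (cfun_eq_closed (fun x => Im (g x)) (fun x => Im (h x))); auto; intros; now rewrite H.
Qed.

Definition fseq : Type := nat -> R -> Cx.

(** A smooth function on [0,1] is carried together with all its derivatives, each extended
    constantly. Chains that agree on (0,1) are Leibniz equal ([chain_unique]), so linear
    combinations can be rewritten directly. *)
Definition chain (D : fseq) : Prop := forall n, cfun2 (D n) /\ der2 (D n) (D (S n)).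

Definition Tadd (D E : fseq) : fseq := fun n x => Cadd (D n x) (E n x).
Definition Tscal (c : Cx) (D : fseq) : fseq := fun n x => Cmul c (D n x).
Definition Tsub (D E : fseq) : fseq := Tadd D (Tscal (RtoC (-1)) E).
Definition Tzero : fseq := fun _ _ => C0.
Definition shift (D : fseq) : fseq := fun n => D (S n).

Ltac teq := apply functional_extensionality; intro; apply functional_extensionality; intro;
  unfold Tsub, Tadd, Tscal, Tzero, RtoC; apply Ceq; simpl; try field; try lra.

Lemma chain_add D E : chain D -> chain E -> chain (Tadd D E).
Proof.
intros HD HE n; destruct (HD n) as [C1 [D1 D2]], (HE n) as [C2 [E1 E2]]; split.
- now apply cfun2_add.
- split; intros x Hx.
  + apply (is_derive_plus (fun x => Re (D n x)) (fun x => Re (E n x))); auto.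
  + apply (is_derive_plus (fun x => Im (D n x)) (fun x => Im (E n x))); auto.
Qed.

Lemma chain_scal c D : chain D -> chain (Tscal c D).
Proof.
intros HD n; destruct (HD n) as [C1 [D1 D2]]; split.
- apply cfun2_mul; auto using cfun2_const.
- split; intros x Hx; simpl.
  + apply (is_derive_minus (fun x => Re c * Re (D n x)) (fun x => Im c * Im (D n x)));
      apply is_derive_scal; auto.
  + apply (is_derive_plus (fun x => Re c * Im (D n x)) (fun x => Im c * Re (D n x)));
      apply is_derive_scal; auto.
Qed.

Lemma chain_sub D E : chain D -> chain E -> chain (Tsub D E).
Proof. intros; apply chain_add; auto using chain_scal. Qed.

Lemma chain_shift D : chain D -> chain (shift D).
Proof. intros H n; apply (H (S n)). Qed.

Definition Tconst (c : Cx) : fseq := fun n _ => match n with O => c | S _ => C0 end.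

Lemma chain_const c : chain (Tconst c).
Proof.
intros n; split; [apply cfun2_const|].
destruct n; split; intros x _; simpl; apply is_derive_Reals, derivable_pt_lim_const.
Qed.

Lemma chain_zero : chain Tzero.
Proof.
intros n; split; [apply cfun2_const|].
split; intros x _; simpl; apply is_derive_Reals, derivable_pt_lim_const.
Qed.

Lemma chain_unique D E : chain D -> chain E ->
  (forall x, 0 < x < 1 -> D 0%nat x = E 0%nat x) -> D = E.
Proof.
intros HD HE H.
apply functional_extensionality; intro n; apply functional_extensionality; intro x; apply Ceq.
- apply (chainR_unique (fun n x => Re (D n x)) (fun n x => Re (E n x))).
  + intros k; split; apply (HD k).
  + intros k; split; apply (HE k).
  + intros y Hy; now rewrite H.
- apply (chainR_unique (fun n x => Im (D n x)) (fun n x => Im (E n x))).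
  + intros k; split; apply (HD k).
  + intros k; split; apply (HE k).
  + intros y Hy; now rewrite H.
Qed.

Lemma smooth_chain u : smooth01 u -> chain (fun n x => dseq u n (clamp x)).
Proof.
intros H.
assert (Hs : is_dseq u (dseq u)) by (unfold dseq; apply epsilon_spec; exact H).
destruct Hs as [_ Hs]; intros n; destruct (Hs n) as [H1 H2]; split; split.
- apply (cfun_comp_clamp_deriv _ _ H1).
- apply (cfun_comp_clamp_deriv _ _ H2).
- exact (has_deriv01_der _ _ H1).
- exact (has_deriv01_der _ _ H2).
Qed.

Lemma smooth_dseq0 u x : smooth01 u -> 0 <= x <= 1 -> dseq u 0 x = u x.
Proof.
intros H Hx.
assert (Hs : is_dseq u (dseq u)) by (unfold dseq; apply epsilon_spec; exact H).
now apply Hs.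
Qed.

Lemma chain_smooth D u : chain D -> (forall x, 0 <= x <= 1 -> D 0%nat x = u x) -> smooth01 u.
Proof.
intros HD H0; exists D; split; [exact H0|].
intros n; destruct (HD n) as [[C1 C2] [D1 D2]]; destruct (HD (S n)) as [[C3 C4] _].
split; now apply der_has_deriv01.
Qed.

(** The sequence [dseq u] is only some choice; uniqueness of chains pins it down on [0,1], so an
    explicitly built chain computes the derivatives that occur in the statement. *)
Lemma chain_dseq D u : chain D -> (forall x, 0 <= x <= 1 -> D 0%nat x = u x) ->
  forall n x, 0 <= x <= 1 -> dseq u n x = D n x.
Proof.
intros HD H0 n x Hx.
assert (Hs := chain_smooth D u HD H0).
assert (E : (fun n x => dseq u n (clamp x)) = D).
{ apply chain_unique; [now apply smooth_chain|exact HD|].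
  intros y Hy; rewrite clamp_id, H0, smooth_dseq0 by (auto; lra); reflexivity. }
rewrite <- E; now rewrite clamp_id.
Qed.

Lemma RInt01_RI g h : cts h -> (forall x, 0 <= x <= 1 -> g x = h x) -> RInt01 g = RI h 0 1.
Proof.
intros C H.
assert (E : ex_RInt g 0 1).
{ apply (ex_RInt_ext h); [|now apply cts_ex_RInt].
  intros x Hx; rewrite Rmin_left, Rmax_right in Hx by lra; symmetry; apply H; lra. }
assert (S : exists pr : Riemann_integrable g 0 1, RiemannInt pr = RInt01 g).
{ apply (epsilon_spec (inhabits 0) (fun I => exists pr : Riemann_integrable g 0 1, RiemannInt pr = I)).
  exists (RiemannInt (ex_RInt_Reals_0 _ _ _ E)); now eexists. }
destruct S as [pr <-].
rewrite <- RInt_Reals; apply RI_ext; auto; lra.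
Qed.

(** * Uniform limits controlled by halving sequences *)

Lemma halving_small (r : nat -> R) : (forall k, 0 <= r k) -> (forall k, r (S k) <= r k / 2) ->
  forall e, 0 < e -> exists N, r N < e.
Proof.
intros Hp Hr e He.
(* The product [r k * (k + 1)] does not increase, because [(k + 2) / 2 <= k + 1]. *)
assert (K : forall k, r k * (INR k + 1) <= r 0%nat).
{ induction k as [|k IH]; [simpl; lra|].
  rewrite S_INR; specialize (Hr k); specialize (Hp k); pose proof (pos_INR k); nra. }
destruct (INR_unbounded (r 0%nat / e)) as [N HN].
exists N; apply Rnot_le_lt; intros Hle.
specialize (K N); pose proof (pos_INR N).
assert (r 0%nat < e * INR N).
{ apply (Rmult_lt_compat_l e) in HN; [|lra].
  replace (e * (r 0%nat / e)) with (r 0%nat) in HN by (field; lra); lra. }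
nra.
Qed.

Lemma halving_anti (r : nat -> R) : (forall k, 0 <= r k) -> (forall k, r (S k) <= r k / 2) ->
  forall j k, r (k + j)%nat <= r k.
Proof.
intros Hp Hr; induction j as [|j IH]; intros k.
- rewrite Nat.add_0_r; lra.
- rewrite Nat.add_succ_r; specialize (Hr (k + j)%nat); specialize (Hp (k + j)%nat).
  specialize (IH k); lra.
Qed.

(** Completeness for uniform convergence, with increments measured by a halving sequence, whose tail
    sum from [k] is at most [2 * r k]. *)
Lemma uniform_limit (g : nat -> R -> R) c (r : nat -> R) :
  (forall k, cfun (g k)) -> 0 <= c -> (forall k, 0 <= r k) -> (forall k, r (S k) <= r k / 2) ->
  (forall k x, Rabs (g (S k) x - g k x) <= c * r k) ->
  exists G, cfun G /\ forall k x, Rabs (G x - g k x) <= c * (2 * r k).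
Proof.
intros Hg Hc Hp Hr H.
(* Since [r] halves, [r k <= 2 * r k - 2 * r (S k)], so the bounds on the increments telescope. *)
assert (K : forall j k x, Rabs (g (k + j)%nat x - g k x) <= c * (2 * r k - 2 * r (k + j)%nat)).
{ induction j as [|j IH]; intros k x.
  - rewrite Nat.add_0_r, Rminus_diag_eq, Rabs_R0 by easy; lra.
  - rewrite Nat.add_succ_r.
    replace (g (S (k + j)) x - g k x) with
      ((g (S (k + j)) x - g (k + j)%nat x) + (g (k + j)%nat x - g k x)) by ring.
    eapply Rle_trans; [apply Rabs_triang|].
    specialize (H (k + j)%nat x); specialize (IH k x); specialize (Hr (k + j)%nat).
    assert (c * (2 * r (S (k + j))) <= c * r (k + j)%nat) by (apply Rmult_le_compat_l; lra).
    nra. }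
assert (K' : forall j k x, Rabs (g (k + j)%nat x - g k x) <= c * (2 * r k)).
{ intros j k x; eapply Rle_trans; [apply K|]; apply Rmult_le_compat_l; auto.
  specialize (Hp (k + j)%nat); lra. }
assert (Hsm : forall e, 0 < e -> exists N, c * (2 * r N) < e).
{ intros e He; destruct (halving_small r Hp Hr (e / (2 * c + 1))) as [N HN].
  - apply Rdiv_lt_0_compat; lra.
  - exists N; specialize (Hp N).
    apply (Rmult_lt_compat_l (2 * c + 1)) in HN; [|lra].
    replace ((2 * c + 1) * (e / (2 * c + 1))) with e in HN by (field; lra).
    lra. }
assert (Hcv : forall x, exists l, Un_cv (fun k => g k x) l).
{ intros x; destruct (Rcomplete.R_complete (fun k => g k x)) as [l Hl]; [|now exists l].
  intros e He; destruct (Hsm (e / 2) ltac:(lra)) as [N HN].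
  exists N; intros n m Hn Hm; unfold Rdist.
  replace n with (N + (n - N))%nat by lia; replace m with (N + (m - N))%nat by lia.
  pose proof (K' (n - N)%nat N x); pose proof (K' (m - N)%nat N x).
  replace (g (N + (n - N))%nat x - g (N + (m - N))%nat x) with
    ((g (N + (n - N))%nat x - g N x) + - (g (N + (m - N))%nat x - g N x)) by ring.
  eapply Rle_lt_trans; [apply Rabs_triang|]; rewrite Rabs_Ropp; lra. }
destruct (choice _ Hcv) as [l Hl].
assert (B : forall k x, Rabs (l x - g k x) <= c * (2 * r k)).
{ intros k x; apply le_epsilon; intros e He.
  destruct (Hl x e He) as [N HN].
  specialize (HN (k + N)%nat ltac:(lia)); unfold Rdist in HN.
  replace (l x - g k x) with (- (g (k + N)%nat x - l x) + (g (k + N)%nat x - g k x)) by ring.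
  eapply Rle_trans; [apply Rabs_triang|]; rewrite Rabs_Ropp.
  specialize (K' N k x); lra. }
exists l; split; [|exact B].
split.
- intros x; apply (UL_sequence (fun k => g k x)); [apply Hl|].
  replace (fun k => g k x) with (fun k => g k (clamp x)); [apply Hl|].
  apply functional_extensionality; intros k; symmetry; apply Hg.
- intros x; apply continuous_eps; intros e He.
  destruct (Hsm (e / 3) ltac:(lra)) as [N HN].
  destruct (proj1 (continuous_eps (g N) x) (proj2 (Hg N) x) (e / 3) ltac:(lra)) as [d [Hd Hc']].
  exists d; split; [exact Hd|]; intros y Hy; specialize (Hc' y Hy).
  pose proof (B N x) as B1; pose proof (B N y) as B2.
  replace (l y - l x) with ((l y - g N y) + (g N y - g N x) + - (l x - g N x)) by ring.
  eapply Rle_lt_trans; [apply Rabs_triang|].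
  pose proof (Rabs_triang (l y - g N y) (g N y - g N x)); rewrite Rabs_Ropp; lra.
Qed.

(** * Sobolev's inequality on the unit interval *)

Lemma RI_sub_le f a b : cts f -> (forall x, 0 <= x <= 1 -> 0 <= f x) ->
  0 <= a -> a <= b -> b <= 1 -> RI f a b <= RI f 0 1.
Proof.
intros C Hp Ha Hab Hb.
rewrite <- (RI_chasles f 0 a 1), <- (RI_chasles f a b 1) by easy.
pose proof (RI_nonneg f 0 a C ltac:(lra)) as H1; pose proof (RI_nonneg f b 1 C ltac:(lra)) as H2.
assert (0 <= RI f 0 a) by (apply H1; intros; apply Hp; lra).
assert (0 <= RI f b 1) by (apply H2; intros; apply Hp; lra).
lra.
Qed.

(** The difference [g z ^ 2 - g y ^ 2] is an integral of [2 g g'], at most the integral of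
    [g ^ 2 + g' ^ 2]; averaging over [y] in [0,1] adds one more integral of [g ^ 2], whence the
    factor 2. *)
Lemma sobolev1 g g' : cfun g -> cfun g' -> der g g' ->
  forall x, g x ^ 2 <= 2 * RI (fun y => g y ^ 2) 0 1 + RI (fun y => g' y ^ 2) 0 1.
Proof.
intros Hg Hg' Hd.
assert (Csq : forall f, cfun f -> cfun (fun y => f y ^ 2)).
{ intros f Hf; simpl; apply cfun_mult; auto; apply cfun_mult; auto using cfun_const. }
set (P := fun y => g y ^ 2 + g' y ^ 2).
assert (CP : cts P) by (apply cts_plus; apply cfun_cts; auto).
assert (Hc2 : cfun (fun y => 2 * (g y * g' y)))
  by (apply cfun_mult; [apply cfun_const|now apply cfun_mult]).
assert (Hd2 : der (fun y => g y ^ 2) (fun y => 2 * (g y * g' y))).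
{ intros x Hx; replace (2 * (g x * g' x)) with (INR 2 * g' x * g x ^ 1) by (simpl; ring).
  apply (is_derive_pow g 2 x (g' x)); now apply Hd. }
assert (HP : forall z, 0 <= P z) by (intros z; unfold P; nra).
assert (K : forall a b, 0 <= a -> a <= b -> b <= 1 ->
  Rabs (g b ^ 2 - g a ^ 2) <= RI P 0 1).
{ intros a b Ha Hab Hb.
  rewrite <- (ftc01 _ _ a b (Csq g Hg) Hc2 Hd2) by lra.
  apply Rle_trans with (RI P a b); [|apply RI_sub_le; auto].
  apply Rabs_le_between; split.
  - assert (N : RI (fun y => -1 * (2 * (g y * g' y))) a b <= RI P a b).
    { apply RI_le; auto.
      - apply cts_mult; [apply cts_const|now apply cfun_cts].
      - intros z _; unfold P; pose proof (pow2_ge_0 (g z + g' z)); nra. }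
    rewrite RI_scal in N by now apply cfun_cts.
    lra.
  - apply RI_le; auto; [now apply cfun_cts|]; intros z _; unfold P; pose proof (pow2_ge_0 (g z - g' z)); nra. }
assert (KI : RI P 0 1 = RI (fun y => g y ^ 2) 0 1 + RI (fun y => g' y ^ 2) 0 1)
  by (apply RI_plus; apply cfun_cts; auto).
intros x; rewrite (proj1 Hg x); pose proof (clamp_range x) as Hx; set (z := clamp x) in *.
assert (M : g z ^ 2 <= RI (fun y => g y ^ 2 + RI P 0 1) 0 1).
{ replace (g z ^ 2) with (RI (fun _ => g z ^ 2) 0 1) by (rewrite RI_const; ring).
  apply RI_le; try lra.
  - apply cts_const.
  - apply cts_plus; [now apply cfun_cts, Csq|apply cts_const].
  - intros y Hy; destruct (Rle_dec y z) as [Hl|Hl].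
    + pose proof (K y z ltac:(lra) Hl ltac:(lra)) as B; apply Rabs_le_between in B; lra.
    + pose proof (K z y ltac:(lra) ltac:(lra) ltac:(lra)) as B; apply Rabs_le_between in B; lra. }
rewrite RI_plus, RI_const in M; [lra|now apply cfun_cts, Csq|apply cts_const].
Qed.

Lemma RI_N2 h : cfun2 h -> RI (fun x => N2 (h x)) 0 1 =
  RI (fun x => Re (h x) ^ 2) 0 1 + RI (fun x => Im (h x) ^ 2) 0 1.
Proof.
intros [[_ H1] [_ H2]]; apply RI_plus; simpl;
  apply cts_mult; auto; apply cts_mult; auto; apply cts_const.
Qed.

Lemma sobolev2 h h' : cfun2 h -> cfun2 h' -> der2 h h' ->
  forall x, N2 (h x) <= 2 * RI (fun y => N2 (h y)) 0 1 + RI (fun y => N2 (h' y)) 0 1.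
Proof.
intros Hh Hh' [D1 D2] x; rewrite !RI_N2 by easy.
pose proof (sobolev1 _ _ (proj1 Hh) (proj1 Hh') D1 x).
pose proof (sobolev1 _ _ (proj2 Hh) (proj2 Hh') D2 x).
unfold N2; simpl in *; lra.
Qed.

Definition bwgt (sigma : R) (n : nat) : R :=
  sigma ^ (2 * n + 1) / (INR (Factorial.fact n) ^ 2 * INR (Factorial.fact (S n)) ^ 2).

Lemma fact_pos n : 0 < INR (Factorial.fact n).
Proof. apply INR_fact_lt_0. Qed.

Lemma wgt_pos sigma n : 0 < sigma -> 0 < wgt sigma n.
Proof.
intros Hs; unfold wgt; pose proof (fact_pos n); pose proof (fact_pos (S n)).
apply Rdiv_lt_0_compat; [now apply pow_lt|].
apply Rmult_lt_0_compat; now apply pow_lt.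
Qed.

Lemma bwgt_pos sigma n : 0 < sigma -> 0 < bwgt sigma n.
Proof.
intros Hs; unfold bwgt; pose proof (fact_pos n); pose proof (fact_pos (S n)).
apply Rdiv_lt_0_compat; [now apply pow_lt|].
apply Rmult_lt_0_compat; now apply pow_lt.
Qed.

(** Minkowski's inequality extracted from the family of Young inequalities, whose best parameter is
    [t = M' / M]. *)
Lemma young_square x y z M M' : 0 <= M -> 0 <= M' -> x <= M ^ 2 -> y <= M' ^ 2 ->
  (forall t, 0 < t -> z <= (1 + t) * x + (1 + / t) * y) -> z <= (M + M') ^ 2.
Proof.
intros HM HM' Hx Hy H.
apply le_epsilon; intros e He.
(* Both bounds are shifted by [d] so that [t] makes sense when [M] or [M'] is 0. The result is
   [(M + M' + 2 d)^2], which exceeds [(M + M')^2] by at most [2 * d * K <= e]. *)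
set (K := 2 * (M + M') + 2).
set (d := Rmin 1 (e / (2 * K))).
assert (HK : 0 < K) by (unfold K; lra).
assert (Hd : 0 < d).
{ apply Rmin_pos; [lra|]; apply Rdiv_lt_0_compat; lra. }
assert (Hd1 : d <= 1) by apply Rmin_l.
assert (Hd2 : 2 * d * K <= e).
{ apply Rle_trans with (2 * (e / (2 * K)) * K).
  - apply Rmult_le_compat_r; [lra|]; apply Rmult_le_compat_l; [lra|apply Rmin_r].
  - right; field; lra. }
assert (Ht : 0 < (M' + d) / (M + d)) by (apply Rdiv_lt_0_compat; lra).
pose proof (H _ Ht) as A.
assert (Md : 0 <= M * d) by nra.
assert (Md' : 0 <= M' * d) by nra.
pose proof (pow2_ge_0 d) as Md2.
assert (B : (1 + (M' + d) / (M + d)) * x <= (1 + (M' + d) / (M + d)) * (M + d) ^ 2)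
  by (apply Rmult_le_compat_l; lra).
assert (B' : (1 + / ((M' + d) / (M + d))) * y <= (1 + / ((M' + d) / (M + d))) * (M' + d) ^ 2).
{ assert (0 < / ((M' + d) / (M + d))) by now apply Rinv_0_lt_compat.
  apply Rmult_le_compat_l; lra. }
replace ((1 + (M' + d) / (M + d)) * (M + d) ^ 2) with ((M + M' + 2 * d) * (M + d)) in B by (field; lra).
replace ((1 + / ((M' + d) / (M + d))) * (M' + d) ^ 2) with ((M + M' + 2 * d) * (M' + d)) in B'
  by (field; lra).
unfold K in Hd2; nra.
Qed.

(** * Weighted norms and completeness *)

Section Gauge.

Context (sigma : R) (Hsigma : 0 < sigma) (om : nat -> R -> R).
Context (Hom : forall n, cts (om n)) (Hom1 : forall n x, 0 <= x <= 1 -> 1 <= om n x).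

(** With [omY] or [omX] as weight, the [n]-th term of the sum of all squared seminorms of Y, or of X
    when [D] is the sequence of the derivative; the boundary term is included. Leaving [om] abstract
    lets one argument serve both spaces. *)
Definition qterm (D : fseq) (n : nat) : R :=
  wgt sigma n * RI (fun x => om n x * N2 (D n x)) 0 1 + bwgt sigma n * N2 (D n 0).

Definition qsum (D : fseq) (N : nat) : R := sum_f_R0 (qterm D) N.

(** Expresses that [D] has norm at most [M]. A bound on all partial sums avoids the value of an
    infinite series; finiteness of the norm is the existence of some [M]. *)
Definition gauge (D : fseq) (M : R) : Prop :=
  chain D /\ 0 <= M /\ forall N, qsum D N <= M ^ 2.

Lemma cts_om_N2 D n : chain D -> cts (fun x => om n x * N2 (D n x)).
Proof. intros H; apply cts_mult; auto; apply cts_N2, H. Qed.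

Lemma qterm_add t D E n : 0 < t -> chain D -> chain E ->
  qterm (Tadd D E) n <= (1 + t) * qterm D n + (1 + / t) * qterm E n.
Proof.
intros Ht HD HE; unfold qterm.
pose proof (wgt_pos sigma n Hsigma); pose proof (bwgt_pos sigma n Hsigma).
pose proof (N2_add t (D n 0) (E n 0) Ht) as H1.
assert (H2 : RI (fun x => om n x * N2 (Tadd D E n x)) 0 1 <=
  (1 + t) * RI (fun x => om n x * N2 (D n x)) 0 1 +
  (1 + / t) * RI (fun x => om n x * N2 (E n x)) 0 1).
{ rewrite <- !RI_scal, <- RI_plus;
    try (apply cts_mult; [apply cts_const|]); try now apply cts_om_N2.
  apply RI_le; try lra.
  - apply cts_om_N2; now apply chain_add.
  - apply cts_plus; apply cts_mult; try apply cts_const; now apply cts_om_N2.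
  - intros x Hx; pose proof (N2_add t (D n x) (E n x) Ht); pose proof (Hom1 n x Hx).
    unfold Tadd; nra. }
apply (Rmult_le_compat_l (wgt sigma n)) in H2; [|lra].
apply (Rmult_le_compat_l (bwgt sigma n)) in H1; [|lra].
unfold Tadd in *; lra.
Qed.

Lemma qterm_nonneg D n : chain D -> 0 <= qterm D n.
Proof.
intros HD; unfold qterm.
pose proof (wgt_pos sigma n Hsigma); pose proof (bwgt_pos sigma n Hsigma).
pose proof (N2_nonneg (D n 0)).
assert (0 <= RI (fun x => om n x * N2 (D n x)) 0 1).
{ apply RI_nonneg; [now apply cts_om_N2|lra|].
  intros x Hx; pose proof (Hom1 n x Hx); pose proof (N2_nonneg (D n x)); nra. }
nra.
Qed.

Lemma qterm_le_qsum D n N : chain D -> (n <= N)%nat -> qterm D n <= qsum D N.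
Proof.
intros HD; induction N as [|N IH]; intros Hn.
- replace n with 0%nat by lia; unfold qsum; simpl; lra.
- unfold qsum in *; rewrite tech5; destruct (Nat.eq_dec n (S N)) as [->|].
  + assert (0 <= sum_f_R0 (qterm D) N) by (apply cond_pos_sum; intros; now apply qterm_nonneg).
    lra.
  + pose proof (qterm_nonneg D (S N) HD); specialize (IH ltac:(lia)); lra.
Qed.

Lemma qsum_add t D E N : 0 < t -> chain D -> chain E ->
  qsum (Tadd D E) N <= (1 + t) * qsum D N + (1 + / t) * qsum E N.
Proof.
intros Ht HD HE; unfold qsum; rewrite !scal_sum, <- plus_sum.
apply sum_Rle; intros n _.
pose proof (qterm_add t D E n Ht HD HE); lra.
Qed.

Lemma qsum_scal c D N : chain D -> qsum (Tscal c D) N = Cmod c ^ 2 * qsum D N.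
Proof.
intros HD; unfold qsum; rewrite scal_sum; apply sum_eq; intros n _; unfold qterm.
rewrite Cmod_sq, <- (RI_ext (fun x => N2 c * (om n x * N2 (D n x)))); try lra.
- rewrite RI_scal by now apply cts_om_N2.
  unfold Tscal; rewrite N2_mul; ring.
- intros x _; unfold Tscal; rewrite N2_mul; ring.
Qed.

Lemma qsum_add_le D E N M M' : chain D -> chain E -> 0 <= M -> 0 <= M' ->
  qsum D N <= M ^ 2 -> qsum E N <= M' ^ 2 -> qsum (Tadd D E) N <= (M + M') ^ 2.
Proof.
intros HD HE HM HM' H H'; apply (young_square (qsum D N) (qsum E N)); auto.
intros t Ht; now apply qsum_add.
Qed.

Lemma gauge_chain D M : gauge D M -> chain D.
Proof. now intros []. Qed.

Lemma gauge_add D E M M' : gauge D M -> gauge E M' -> gauge (Tadd D E) (M + M').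
Proof.
intros [HD [HM H]] [HE [HM' H']]; split; [|split]; [now apply chain_add|lra|].
intros N; now apply qsum_add_le.
Qed.

Lemma gauge_scal c D M : gauge D M -> gauge (Tscal c D) (Cmod c * M).
Proof.
intros [HD [HM H]]; pose proof (Cmod_nonneg c); split; [|split].
- now apply chain_scal.
- now apply Rmult_le_pos.
- intros N; rewrite qsum_scal by easy; rewrite Rpow_mult_distr.
  apply Rmult_le_compat_l; [nra|apply H].
Qed.

Lemma gauge_mono D M M' : gauge D M -> M <= M' -> gauge D M'.
Proof.
intros [HD [HM H]] HMM; split; [|split]; [easy|lra|].
intros N; specialize (H N); nra.
Qed.

Lemma gauge_sub D E M M' : gauge D M -> gauge E M' -> gauge (Tsub D E) (M + M').
Proof.
intros HD HE; apply gauge_add; [easy|].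
replace M' with (Cmod (RtoC (-1)) * M'); [now apply gauge_scal|].
rewrite Cmod_RtoC, Rabs_left by lra; ring.
Qed.

Lemma gauge_sub_sym D E M : gauge (Tsub D E) M -> gauge (Tsub E D) M.
Proof.
intros H; apply (gauge_scal (RtoC (-1))) in H.
rewrite Cmod_RtoC, Rabs_left in H by lra.
replace (Tsub E D) with (Tscal (RtoC (-1)) (Tsub D E)) by teq.
replace M with (- (-1) * M) by ring; exact H.
Qed.

Lemma gauge_zero M : 0 <= M -> gauge Tzero M.
Proof.
intros HM; split; [|split]; [apply chain_zero|easy|].
intros N; replace Tzero with (Tscal C0 Tzero) by (unfold C0; teq).
rewrite qsum_scal by apply chain_zero.
rewrite Cmod_sq; unfold N2; simpl; nra.
Qed.

Lemma gauge_L2 D M n : gauge D M -> wgt sigma n * RI (fun x => N2 (D n x)) 0 1 <= M ^ 2.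
Proof.
intros [HD [HM H]]; specialize (H n).
pose proof (qterm_le_qsum D n n HD (le_n n)) as H1; unfold qterm in H1.
pose proof (wgt_pos sigma n Hsigma); pose proof (bwgt_pos sigma n Hsigma).
pose proof (N2_nonneg (D n 0)).
assert (RI (fun x => N2 (D n x)) 0 1 <= RI (fun x => om n x * N2 (D n x)) 0 1).
{ apply RI_le; try lra.
  - apply cts_N2, HD.
  - now apply cts_om_N2.
  - intros x Hx; pose proof (Hom1 n x Hx); pose proof (N2_nonneg (D n x)); nra. }
nra.
Qed.

(** Constant of the embedding into bounded functions at order [n]: [sobolev2] involves orders [n]
    and [n + 1], each controlled through its own weight. *)
Definition sob (n : nat) : R := sqrt (2 / wgt sigma n + / wgt sigma (S n)).

Lemma sob_arg n : 0 < 2 / wgt sigma n + / wgt sigma (S n).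
Proof.
pose proof (wgt_pos sigma n Hsigma); pose proof (wgt_pos sigma (S n) Hsigma).
apply Rplus_lt_0_compat; [apply Rdiv_lt_0_compat; lra|now apply Rinv_0_lt_compat].
Qed.

Lemma sob_nonneg n : 0 <= sob n.
Proof. apply sqrt_pos. Qed.

Lemma gauge_sup D M : gauge D M -> forall n x, Cmod (D n x) <= sob n * M.
Proof.
intros HG n x; pose proof (gauge_L2 D M n HG) as H1; pose proof (gauge_L2 D M (S n) HG) as H2.
destruct HG as [HD [HM _]].
pose proof (wgt_pos sigma n Hsigma) as P1; pose proof (wgt_pos sigma (S n) Hsigma) as P2.
apply Cmod_N2_le; [apply Rmult_le_pos; [apply sob_nonneg|easy]|].
eapply Rle_trans; [apply (sobolev2 (D n) (D (S n)))|]; [apply HD|apply HD|apply HD|].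
rewrite Rpow_mult_distr; unfold sob; rewrite pow2_sqrt by (pose proof (sob_arg n); lra).
apply Rle_trans with (2 * (M ^ 2 / wgt sigma n) + M ^ 2 / wgt sigma (S n)).
- apply Rplus_le_compat.
  + apply Rmult_le_compat_l; [lra|]; apply Rle_div_r; lra.
  + apply Rle_div_r; lra.
- right; field; lra.
Qed.

(** A truncated norm is controlled by the sup norms of the orders up to [N]; in this way uniform
    convergence yields bounds for the limit in [gauge_complete]. *)
Lemma qsum_sup N : exists B, 0 <= B /\ forall D m, chain D -> 0 <= m ->
  (forall n x, (n <= N)%nat -> Cmod (D n x) <= m) -> qsum D N <= B * m ^ 2.
Proof.
assert (T : forall n, exists b, 0 <= b /\ forall D m, chain D -> 0 <= m ->
  (forall x, Cmod (D n x) <= m) -> qterm D n <= b * m ^ 2).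
{ intros n.
  pose proof (wgt_pos sigma n Hsigma) as P1; pose proof (bwgt_pos sigma n Hsigma) as P2.
  assert (P3 : 0 <= RI (om n) 0 1).
  { apply RI_nonneg; auto; try lra; intros x Hx; pose proof (Hom1 n x Hx); lra. }
  exists (wgt sigma n * RI (om n) 0 1 + bwgt sigma n); split; [nra|].
  intros D m HD Hm H; unfold qterm.
  assert (K : forall x, N2 (D n x) <= m ^ 2).
  { intros x; rewrite <- Cmod_sq; pose proof (Cmod_nonneg (D n x)); specialize (H x); nra. }
  assert (RI (fun x => om n x * N2 (D n x)) 0 1 <= m ^ 2 * RI (om n) 0 1).
  { rewrite <- RI_scal by auto; apply RI_le; try lra.
    - now apply cts_om_N2.
    - apply cts_mult; auto using cts_const.
    - intros x Hx; pose proof (Hom1 n x Hx); specialize (K x); nra. }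
  specialize (K 0); nra. }
induction N as [|N [B [HB IH]]].
- destruct (T 0%nat) as [b [Hb Hb']]; exists b; split; [easy|].
  intros D m HD Hm H; unfold qsum; simpl; apply Hb'; auto.
- destruct (T (S N)) as [b [Hb Hb']]; exists (B + b); split; [lra|].
  intros D m HD Hm H; unfold qsum in *; rewrite tech5.
  specialize (IH D m HD Hm); specialize (Hb' D m HD Hm).
  rewrite Rmult_plus_distr_r; apply Rplus_le_compat; auto.
Qed.

(** Each order converges uniformly. That the limits are derivatives of one another is checked in
    integrated form, through [ftc01] and [der_of_integral]. *)
Lemma fseq_limit (D : nat -> fseq) (c : nat -> R) (r : nat -> R) :
  (forall k, chain (D k)) -> (forall n, 0 <= c n) ->
  (forall k, 0 <= r k) -> (forall k, r (S k) <= r k / 2) ->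
  (forall k n x, Cmod (Csub (D (S k) n x) (D k n x)) <= c n * r k) ->
  exists E, chain E /\ forall k n x, Cmod (Csub (E n x) (D k n x)) <= 2 * (c n * (2 * r k)).
Proof.
intros HD Hc Hp Hr H.
assert (LR : forall n, exists G, cfun G /\ forall k x, Rabs (G x - Re (D k n x)) <= c n * (2 * r k)).
{ intros n; apply uniform_limit; auto; [intros; apply (HD k n)|].
  intros k x; eapply Rle_trans; [|apply (H k n x)]; apply (Re_le_Cmod (Csub _ _)). }
assert (LI : forall n, exists G, cfun G /\ forall k x, Rabs (G x - Im (D k n x)) <= c n * (2 * r k)).
{ intros n; apply uniform_limit; auto; [intros; apply (HD k n)|].
  intros k x; eapply Rle_trans; [|apply (H k n x)]; apply (Im_le_Cmod (Csub _ _)). }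
destruct (choice _ LR) as [GR HGR]; destruct (choice _ LI) as [GI HGI].
assert (L : forall (P : Cx -> R) (G : nat -> R -> R),
  (forall k n, cfun (fun x => P (D k n x)) /\ der (fun x => P (D k n x)) (fun x => P (D k (S n) x))) ->
  (forall n, cfun (G n) /\ forall k x, Rabs (G n x - P (D k n x)) <= c n * (2 * r k)) ->
  forall n, der (G n) (G (S n))).
{ intros P G HP HG n; apply der_of_integral; [apply cfun_cts, HG|]; intros x Hx.
  apply Rminus_diag_uniq, Rabs_eq_0, Rle_antisym; [|apply Rabs_pos].
  apply le_epsilon; intros e He.
  (* The identity at [x] has two end point errors of [2 * c n * r k] and one integral error of at
     most [2 * c (S n) * r k]; the 1 keeps the divisor positive. *)
  destruct (halving_small r Hp Hr (e / (4 * c n + 2 * c (S n) + 1))) as [k Hk].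
  { pose proof (Hc n); pose proof (Hc (S n)); apply Rdiv_lt_0_compat; lra. }
  pose proof (proj2 (HG n) k x) as B1; pose proof (proj2 (HG n) k 0) as B2.
  assert (B3 : Rabs (RI (G (S n)) 0 x - RI (fun y => P (D k (S n) y)) 0 x) <= c (S n) * (2 * r k)).
  { pose proof (cfun_cts _ (proj1 (HG (S n)))) as C1.
    pose proof (cfun_cts _ (proj1 (HP k (S n)))) as C2.
    replace (RI (G (S n)) 0 x - RI (fun y => P (D k (S n) y)) 0 x) with
      (RI (G (S n)) 0 x + -1 * RI (fun y => P (D k (S n) y)) 0 x) by ring.
    assert (C3 : cts (fun y => -1 * P (D k (S n) y)))
      by (apply cts_mult; auto; apply cts_const).
    rewrite <- RI_scal, <- RI_plus by auto.
    assert (K : forall y, Rabs (G (S n) y + -1 * P (D k (S n) y)) <= c (S n) * (2 * r k)).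
    { intros y; replace (G (S n) y + -1 * P (D k (S n) y)) with (G (S n) y - P (D k (S n) y)) by ring.
      apply HG. }
    pose proof (Hc (S n)); pose proof (Hp k).
    assert (0 <= c (S n) * (2 * r k)) by nra.
    apply Rabs_le_between; split.
    - apply Rle_trans with (RI (fun _ => - (c (S n) * (2 * r k))) 0 x).
      + rewrite RI_const; nra.
      + apply RI_le; try lra; [apply cts_const|now apply cts_plus|].
        intros y _; specialize (K y); apply Rabs_le_between in K; lra.
    - apply Rle_trans with (RI (fun _ => c (S n) * (2 * r k)) 0 x).
      + apply RI_le; try lra; [now apply cts_plus|apply cts_const|].
        intros y _; specialize (K y); apply Rabs_le_between in K; lra.
      + rewrite RI_const; nra. }
  assert (F : RI (fun y => P (D k (S n) y)) 0 x = P (D k n x) - P (D k n 0)).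
  { apply (ftc01 (fun y => P (D k n y))); try lra; apply HP. }
  apply (Rmult_lt_compat_l (4 * c n + 2 * c (S n) + 1)) in Hk;
    [|pose proof (Hc n); pose proof (Hc (S n)); lra].
  replace ((4 * c n + 2 * c (S n) + 1) * (e / (4 * c n + 2 * c (S n) + 1))) with e in Hk
    by (field; pose proof (Hc n); pose proof (Hc (S n)); lra).
  specialize (Hp k); pose proof (Hc n); pose proof (Hc (S n)).
  apply Rabs_le_between in B1, B2, B3; apply Rabs_le_between; split; nra. }
exists (fun n x => mkC (GR n x) (GI n x)); split.
- intros n; split; split; simpl.
  + apply HGR.
  + apply HGI.
  + apply (L Re); [|exact HGR]; intros k m; destruct (HD k m) as [[? ?] [? ?]]; auto.
  + apply (L Im); [|exact HGI]; intros k m; destruct (HD k m) as [[? ?] [? ?]]; auto.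
- intros k n x; apply Cmod_le_comp; simpl; [apply HGR|apply HGI].
Qed.

(** The bound for the limit is obtained one truncation at a time: for fixed [N], [E - D k] is split
    at [D (k + j)]. The first part has norm at most [2 * r k] for every [j], and the second tends to
    0 in [qsum] as [j] grows. *)
Lemma gauge_complete (D : nat -> fseq) (r : nat -> R) :
  (forall k, chain (D k)) -> (forall k, r (S k) <= r k / 2) ->
  (forall k, gauge (Tsub (D (S k)) (D k)) (r k)) ->
  exists E, chain E /\ forall k, gauge (Tsub E (D k)) (2 * r k).
Proof.
intros HD Hr HG.
assert (Hp : forall k, 0 <= r k) by (intros k; apply (HG k)).
assert (HS : forall k n x, Csub (D (S k) n x) (D k n x) = Tsub (D (S k)) (D k) n x).
{ intros; apply Ceq; simpl; ring. }
destruct (fseq_limit D sob r HD sob_nonneg Hp Hr) as [E [HE HB]].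
{ intros k n x; rewrite HS; now apply gauge_sup. }
exists E; split; [easy|].
assert (HE' : forall k, chain (Tsub E (D k))) by (intros; now apply chain_sub).
assert (K : forall j k, gauge (Tsub (D (k + j)%nat) (D k)) (2 * r k - 2 * r (k + j)%nat)).
{ induction j as [|j IH]; intros k.
  - rewrite Nat.add_0_r.
    replace (Tsub (D k) (D k)) with Tzero by (unfold C0; teq).
    apply gauge_zero; lra.
  - rewrite Nat.add_succ_r.
    replace (Tsub (D (S (k + j))) (D k)) with
      (Tadd (Tsub (D (S (k + j))) (D (k + j)%nat)) (Tsub (D (k + j)%nat) (D k))) by teq.
    eapply gauge_mono; [apply gauge_add; [apply HG|apply IH]|].
    specialize (Hr (k + j)%nat); lra. }
intros k; split; [|split]; [apply HE'|specialize (Hp k); lra|]; intros N.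
apply le_epsilon; intros e He.
destruct (qsum_sup N) as [B [HB0 HBN]].
assert (exists cN, 0 <= cN /\ forall n, (n <= N)%nat -> sob n <= cN) as [cN [HcN HcN']].
{ clear -N; induction N as [|N [c [Hc H]]].
  - exists (sob 0); split; [apply sob_nonneg|]; intros n Hn; replace n with 0%nat by lia; lra.
  - exists (c + sob (S N)); pose proof (sob_nonneg (S N)); split; [lra|].
    intros n Hn; destruct (Nat.eq_dec n (S N)) as [->|]; [lra|].
    specialize (H n ltac:(lia)); lra. }
(* On orders up to [N] the limit is within [4 * cN * r] of the sequence; [sqrt B] converts this into
   a bound for [qsum]. *)
set (A := sqrt B * (4 * cN)).
assert (HA : 0 <= A) by (apply Rmult_le_pos; [apply sqrt_pos|lra]).
assert (Hcl : forall j, qsum (Tsub E (D (k + j)%nat)) N <= (A * r (k + j)%nat) ^ 2).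
{ intros j; eapply Rle_trans; [apply (HBN _ (4 * cN * r (k + j)%nat)); auto|].
  - specialize (Hp (k + j)%nat); nra.
  - intros n x Hn.
    replace (Tsub E (D (k + j)%nat) n x) with (Csub (E n x) (D (k + j)%nat n x))
      by (apply Ceq; simpl; ring).
    eapply Rle_trans; [apply HB|].
    pose proof (sob_nonneg n); specialize (HcN' n Hn); specialize (Hp (k + j)%nat); nra.
  - unfold A; rewrite !Rpow_mult_distr, pow2_sqrt by easy; lra. }
(* With [z = r k] and [y = r (k + j)], [(2 z + A y)^2] exceeds [(2 z)^2] by [A y (4 z + A y)]. Since
   [y <= z], this is below [e] once [y] is smaller than the chosen quotient. *)
destruct (halving_small (fun j => r (k + j)%nat)) with
  (e := e / ((A + 1) * (4 * r k + A * r k + 1))) as [j Hj].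
{ intros j; apply Hp. } { intros j; rewrite Nat.add_succ_r; apply Hr. }
{ specialize (Hp k); apply Rdiv_lt_0_compat; [easy|]; apply Rmult_lt_0_compat; nra. }
replace (Tsub E (D k)) with (Tadd (Tsub (D (k + j)%nat) (D k)) (Tsub E (D (k + j)%nat))) by teq.
eapply Rle_trans; [apply (qsum_add_le _ _ N (2 * r k) (A * r (k + j)%nat))|].
- apply chain_sub; auto.
- auto.
- specialize (Hp k); lra.
- apply Rmult_le_pos; auto.
- eapply Rle_trans; [apply (K j k)|]; pose proof (Hp k); pose proof (Hp (k + j)%nat).
  pose proof (proj1 (proj2 (K j k))); nra.
- apply Hcl.
- pose proof (Hp k) as P1; pose proof (Hp (k + j)%nat) as P2.
  pose proof (halving_anti r Hp Hr j k) as P3.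
  set (y := r (k + j)%nat) in *; set (z := r k) in *.
  assert (Hq : 0 < (A + 1) * (4 * z + A * z + 1)) by (apply Rmult_lt_0_compat; nra).
  apply (Rmult_lt_compat_l _ _ _ Hq) in Hj.
  replace ((A + 1) * (4 * z + A * z + 1) * (e / ((A + 1) * (4 * z + A * z + 1)))) with e in Hj
    by (field; split; nra).
  assert (0 <= A * z) by nra. assert (0 <= A * y) by nra.
  assert (A * y * (4 * z + A * y) <= (A + 1) * (4 * z + A * z + 1) * y).
  { replace ((A + 1) * (4 * z + A * z + 1) * y) with ((A * y + y) * (4 * z + A * z + 1)) by ring.
    apply Rmult_le_compat; nra. }
  nra.
Qed.

End Gauge.

(** * The norms of X and Y and their relation to [inX] and [inY] *)

Definition omY (sigma : R) (n : nat) (x : R) : R := 1 + INR n * (x / sigma).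
Definition omX (sigma : R) (n : nat) (x : R) : R :=
  1 + INR n * (x / sigma) + INR n ^ 2 * (x / sigma) ^ 2.

Lemma cts_div_pow sigma k : cts (fun x => (x / sigma) ^ k).
Proof.
assert (C : cts (fun x => x / sigma)).
{ intros x; apply (continuous_mult (fun x => x) (fun _ => / sigma)); [apply continuous_id|apply continuous_const]. }
induction k as [|k IH]; simpl; [apply cts_const|now apply cts_mult].
Qed.

Lemma omY_cts sigma n : cts (omY sigma n).
Proof.
apply cts_plus; [apply cts_const|]; apply cts_mult; [apply cts_const|].
replace (fun x => x / sigma) with (fun x => (x / sigma) ^ 1); [apply cts_div_pow|].
apply functional_extensionality; intro; ring.
Qed.

Lemma omX_cts sigma n : cts (omX sigma n).
Proof.
apply cts_plus; [apply omY_cts|]; apply cts_mult; [apply cts_const|apply cts_div_pow].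
Qed.

Lemma omY_ge1 sigma n x : 0 < sigma -> 0 <= x <= 1 -> 1 <= omY sigma n x.
Proof.
intros Hs Hx; unfold omY; pose proof (pos_INR n).
assert (0 <= x / sigma) by (apply Rdiv_le_0_compat; lra); nra.
Qed.

Lemma omX_ge sigma n x : omY sigma n x <= omX sigma n x.
Proof.
unfold omX, omY; pose proof (pow2_ge_0 (INR n)); pose proof (pow2_ge_0 (x / sigma)); nra.
Qed.

Lemma omX_ge1 sigma n x : 0 < sigma -> 0 <= x <= 1 -> 1 <= omX sigma n x.
Proof.
intros Hs Hx; pose proof (omY_ge1 sigma n x Hs Hx); pose proof (omX_ge sigma n x); lra.
Qed.

Definition gY (sigma : R) (F : fseq) (M : R) : Prop := gauge sigma (omY sigma) F M.

(** The X-norm sees only the derivative; the value 0 at the point 1 fixes the constant of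
    integration. *)
Definition gX (sigma : R) (U : fseq) (M : R) : Prop :=
  chain U /\ U 0%nat 1 = C0 /\ gauge sigma (omX sigma) (shift U) M.

Definition cl (u : R -> Cx) : fseq := fun n x => dseq u n (clamp x).

Lemma series_finite_bounded a : (forall n, 0 <= a n) ->
  (series_finite a <-> exists B, forall N, sum_f_R0 a N <= B).
Proof.
intros Hp; split.
- intros [l Hl]; exists l; intros N; now apply sum_incr.
- intros [B HB]; destruct (Un_cv_crit (sum_f_R0 a)) as [l Hl].
  + intros n; simpl; specialize (Hp (S n)); lra.
  + exists B; intros y [n ->]; apply HB.
  + now exists l.
Qed.

Section Bridge.
Context (sigma : R) (Hsigma : 0 < sigma).

Lemma term_k_RI k d D n : chain D -> (forall x, 0 <= x <= 1 -> d n x = D n x) ->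
  term_k sigma k d n =
  wgt sigma n * INR n ^ k * RI (fun x => (x / sigma) ^ k * N2 (D n x)) 0 1.
Proof.
intros HD H; unfold term_k; f_equal; apply RInt01_RI.
- apply cts_mult; [apply cts_div_pow|apply cts_N2, HD].
- intros x Hx; now rewrite Cmod_sq, H.
Qed.

Lemma term_k_nonneg k d D n : chain D -> (forall x, 0 <= x <= 1 -> d n x = D n x) ->
  0 <= term_k sigma k d n.
Proof.
intros HD H; rewrite (term_k_RI k d D) by easy.
apply Rmult_le_pos; [apply Rmult_le_pos|].
- pose proof (wgt_pos sigma n Hsigma); lra.
- apply pow_le, pos_INR.
- apply RI_nonneg; try lra.
  + apply cts_mult; [apply cts_div_pow|apply cts_N2, HD].
  + intros x Hx; apply Rmult_le_pos; [|apply N2_nonneg].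
    apply pow_le, Rdiv_le_0_compat; lra.
Qed.

Lemma term_b_nonneg d n : 0 <= term_b sigma d n.
Proof.
unfold term_b; apply Rmult_le_pos; [|apply pow2_ge_0].
pose proof (bwgt_pos sigma n Hsigma) as H; unfold bwgt in H; lra.
Qed.

Lemma qterm_omY d D n : chain D -> (forall n x, 0 <= x <= 1 -> d n x = D n x) ->
  qterm sigma (omY sigma) D n =
  term_k sigma 0 d n + term_k sigma 1 d n + term_b sigma d n.
Proof.
intros HD H.
rewrite (term_k_RI 0 d D), (term_k_RI 1 d D) by auto.
unfold term_b; rewrite Cmod_sq, H by lra; unfold qterm, bwgt.
assert (C : forall k, cts (fun x => (x / sigma) ^ k * N2 (D n x)))
  by (intros; apply cts_mult; [apply cts_div_pow|apply cts_N2, HD]).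
rewrite (RI_ext _ (fun x => (x / sigma) ^ 0 * N2 (D n x) + INR n * ((x / sigma) ^ 1 * N2 (D n x))))
  by (try lra; intros; unfold omY; ring).
rewrite RI_plus, RI_scal; auto; [ring|].
apply cts_mult; auto using cts_const.
Qed.

Lemma qterm_omX d D n : chain D -> (forall n x, 0 <= x <= 1 -> d n x = D n x) ->
  qterm sigma (omX sigma) D n =
  term_k sigma 0 d n + term_k sigma 1 d n + term_k sigma 2 d n + term_b sigma d n.
Proof.
intros HD H.
transitivity (qterm sigma (omY sigma) D n + term_k sigma 2 d n); [|rewrite (qterm_omY d) by auto; ring].
rewrite (term_k_RI 2 d D) by auto; unfold qterm.
assert (C : forall k, cts (fun x => (x / sigma) ^ k * N2 (D n x)))
  by (intros; apply cts_mult; [apply cts_div_pow|apply cts_N2, HD]).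
rewrite (RI_ext _ (fun x => omY sigma n x * N2 (D n x) + INR n ^ 2 * ((x / sigma) ^ 2 * N2 (D n x))))
  by (try lra; intros; unfold omX, omY; ring).
rewrite RI_plus, RI_scal; auto; [ring| |].
- apply cts_mult; [apply omY_cts|apply cts_N2, HD].
- apply cts_mult; auto using cts_const.
Qed.

Lemma gauge_of_bound om D B : chain D -> (forall N, sum_f_R0 (qterm sigma om D) N <= B) ->
  exists M, gauge sigma om D M.
Proof.
intros HD H; exists (Rabs B + 1); pose proof (Rabs_pos B); split; [|split]; [easy|lra|].
intros N; specialize (H N); unfold qsum; pose proof (Rle_abs B); nra.
Qed.

Lemma chain_cl u : smooth01 u -> chain (cl u).
Proof. apply smooth_chain. Qed.

Lemma cl_dseq u n x : 0 <= x <= 1 -> dseq u n x = cl u n x.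
Proof. intros H; unfold cl; now rewrite clamp_id. Qed.

Lemma sum_le_comp a b N : (forall n, a n <= b n) -> sum_f_R0 a N <= sum_f_R0 b N.
Proof. intros H; apply sum_Rle; auto. Qed.

Lemma inY_gY f : inY sigma f -> exists M, gY sigma (cl f) M.
Proof.
intros [Hs [H0 [H1 Hb]]]; pose proof (chain_cl f Hs) as HD.
assert (E : forall n x, 0 <= x <= 1 -> dseq f n x = cl f n x) by (intros; now apply cl_dseq).
apply series_finite_bounded in H0; [|intros; eapply term_k_nonneg; eauto].
apply series_finite_bounded in H1; [|intros; eapply term_k_nonneg; eauto].
apply series_finite_bounded in Hb; [|intros; apply term_b_nonneg].
destruct H0 as [B0 H0], H1 as [B1 H1], Hb as [B2 H2].
apply (gauge_of_bound _ _ (B0 + B1 + B2) HD); intros N.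
rewrite (sum_eq _ (fun n => term_k sigma 0 (dseq f) n + term_k sigma 1 (dseq f) n + term_b sigma (dseq f) n))
  by (intros; now apply qterm_omY).
rewrite !plus_sum; specialize (H0 N); specialize (H1 N); specialize (H2 N); lra.
Qed.

Lemma gY_inY F M f : gY sigma F M -> (forall x, 0 <= x <= 1 -> F 0%nat x = f x) -> inY sigma f.
Proof.
intros [HD [HM H]] H0.
assert (E : forall n x, 0 <= x <= 1 -> dseq f n x = F n x) by (apply chain_dseq; auto).
split; [now apply (chain_smooth F)|]; cbv zeta.
assert (P : forall k n, 0 <= term_k sigma k (dseq f) n) by (intros; eapply term_k_nonneg; eauto).
assert (Pb := term_b_nonneg (dseq f)).
assert (Q : forall n, qterm sigma (omY sigma) F n =
  term_k sigma 0 (dseq f) n + term_k sigma 1 (dseq f) n + term_b sigma (dseq f) n)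
  by (intros; now apply qterm_omY).
split; [|split]; apply series_finite_bounded; auto; exists (M ^ 2); intros N;
  eapply Rle_trans; try apply (H N); apply sum_le_comp; intros n; rewrite Q;
  pose proof (P 0%nat n); pose proof (P 1%nat n); pose proof (Pb n); lra.
Qed.

Lemma inX_gX u : inX sigma u -> exists M, gX sigma (cl u) M.
Proof.
intros [Hs [H1u [H0 [H1 [H2 Hb]]]]]; pose proof (chain_cl u Hs) as HD0.
pose proof (chain_shift _ HD0) as HD.
set (d := fun n => dseq u (S n)) in *.
assert (E : forall n x, 0 <= x <= 1 -> d n x = shift (cl u) n x) by (intros; now apply cl_dseq).
apply series_finite_bounded in H0; [|intros; eapply term_k_nonneg; eauto].
apply series_finite_bounded in H1; [|intros; eapply term_k_nonneg; eauto].
apply series_finite_bounded in H2; [|intros; eapply term_k_nonneg; eauto].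
apply series_finite_bounded in Hb; [|intros; apply term_b_nonneg].
destruct H0 as [B0 H0], H1 as [B1 H1], H2 as [B2 H2], Hb as [B3 H3].
destruct (gauge_of_bound (omX sigma) _ (B0 + B1 + B2 + B3) HD) as [M HM].
- intros N.
  rewrite (sum_eq _ (fun n => term_k sigma 0 d n + term_k sigma 1 d n + term_k sigma 2 d n + term_b sigma d n))
    by (intros; now apply qterm_omX).
  rewrite !plus_sum; specialize (H0 N); specialize (H1 N); specialize (H2 N); specialize (H3 N); lra.
- exists M; split; [|split]; auto.
  rewrite <- cl_dseq by lra; rewrite smooth_dseq0; auto; lra.
Qed.

Lemma gX_inX U M u : gX sigma U M -> (forall x, 0 <= x <= 1 -> U 0%nat x = u x) -> inX sigma u.
Proof.
intros [HU [HU1 [HD [HM H]]]] H0.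
assert (E : forall n x, 0 <= x <= 1 -> dseq u (S n) x = shift U n x).
{ intros n x Hx; now rewrite (chain_dseq U u). }
split; [now apply (chain_smooth U)|].
split; [rewrite <- H0 by lra; exact HU1|]; cbv zeta.
set (d := fun n => dseq u (S n)) in *.
assert (P : forall k n, 0 <= term_k sigma k d n) by (intros; eapply term_k_nonneg; eauto).
assert (Pb := term_b_nonneg d).
assert (Q : forall n, qterm sigma (omX sigma) (shift U) n =
  term_k sigma 0 d n + term_k sigma 1 d n + term_k sigma 2 d n + term_b sigma d n)
  by (intros; now apply qterm_omX).
split; [|split; [|split]]; apply series_finite_bounded; auto; exists (M ^ 2); intros N;
  eapply Rle_trans; try apply (H N); apply sum_le_comp; intros n; rewrite Q;
  pose proof (P 0%nat n); pose proof (P 1%nat n); pose proof (P 2%nat n); pose proof (Pb n); lra.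
Qed.

End Bridge.

Lemma RI_abs f a b c : cts f -> a <= b -> (forall x, a <= x <= b -> Rabs (f x) <= c) ->
  Rabs (RI f a b) <= (b - a) * c.
Proof.
intros C Hab H; apply Rabs_le_between; split.
- replace (- ((b - a) * c)) with (RI (fun _ => - c) a b) by (rewrite RI_const; ring).
  apply RI_le; auto using cts_const.
  intros x Hx; specialize (H x Hx); apply Rabs_le_between in H; lra.
- rewrite <- RI_const; apply RI_le; auto using cts_const.
  intros x Hx; specialize (H x Hx); apply Rabs_le_between in H; lra.
Qed.

Lemma Csub_eq0 a b : Csub a b = C0 -> a = b.
Proof. intros H; injection H; intros; apply Ceq; lra. Qed.

(** [Lop] with the derivatives read off the sequence, so that linearity in [U] is a ring
    identity. *)
Definition LL (W : R -> Cx) (s : Cx) (U : fseq) (x : R) : Cx :=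
  Csub (Cadd (Cadd (Cmul (RtoC (x ^ 2)) (U 2%nat x)) (Cmul (RtoC (2 * x)) (U 1%nat x)))
             (Cmul s (U 1%nat x)))
       (Cmul (W x) (U 0%nat x)).

Definition solves (W : R -> Cx) (s : Cx) (U F : fseq) : Prop :=
  forall x, 0 <= x <= 1 -> LL W s U x = F 0%nat x.

(** * Bounded inverse and perturbation *)

Section Solve.
Context (sigma : R) (Hsigma : 0 < sigma) (W : R -> Cx).

Let HY := omY_cts sigma.
Let HY1 : forall n x, 0 <= x <= 1 -> 1 <= omY sigma n x := fun n x => omY_ge1 sigma n x Hsigma.
Let HX := omX_cts sigma.
Let HX1 : forall n x, 0 <= x <= 1 -> 1 <= omX sigma n x := fun n x => omX_ge1 sigma n x Hsigma.

Lemma gY_sub F G M M' : gY sigma F M -> gY sigma G M' -> gY sigma (Tsub F G) (M + M').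
Proof. exact (gauge_sub sigma Hsigma _ HY HY1 F G M M'). Qed.

Lemma gY_scal c F M : gY sigma F M -> gY sigma (Tscal c F) (Cmod c * M).
Proof. exact (gauge_scal sigma _ HY c F M). Qed.

Lemma gY_scalR c F M : 0 <= c -> gY sigma F M -> gY sigma (Tscal (RtoC c) F) (c * M).
Proof. intros Hc H; apply (gY_scal (RtoC c)) in H; rewrite Cmod_RtoC, Rabs_right in H by lra; exact H. Qed.

Lemma gY_mono F M M' : gY sigma F M -> M <= M' -> gY sigma F M'.
Proof. exact (gauge_mono sigma _ F M M'). Qed.

Lemma gY_sup F M : gY sigma F M -> forall n x, Cmod (F n x) <= sob sigma n * M.
Proof. exact (gauge_sup sigma Hsigma _ HY HY1 F M). Qed.

Lemma gX_add U V M M' : gX sigma U M -> gX sigma V M' -> gX sigma (Tadd U V) (M + M').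
Proof.
intros [H1 [H2 H3]] [G1 [G2 G3]]; split; [|split].
- now apply chain_add.
- unfold Tadd; rewrite H2, G2; apply Ceq; simpl; ring.
- exact (gauge_add sigma Hsigma _ HX HX1 _ _ M M' H3 G3).
Qed.

Lemma gX_scal c U M : gX sigma U M -> gX sigma (Tscal c U) (Cmod c * M).
Proof.
intros [H1 [H2 H3]]; split; [|split].
- now apply chain_scal.
- unfold Tscal; rewrite H2; apply Ceq; simpl; ring.
- exact (gauge_scal sigma _ HX c _ M H3).
Qed.

Lemma gX_mono U M M' : gX sigma U M -> M <= M' -> gX sigma U M'.
Proof.
intros [H1 [H2 H3]] H; split; [|split]; auto.
exact (gauge_mono sigma _ _ M M' H3 H).
Qed.

Lemma gX_sub U V M M' : gX sigma U M -> gX sigma V M' -> gX sigma (Tsub U V) (M + M').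
Proof.
intros HU HV; apply gX_add; [easy|].
replace M' with (Cmod (RtoC (-1)) * M'); [now apply gX_scal|].
rewrite Cmod_RtoC, Rabs_left by lra; ring.
Qed.

Lemma gX_zero M : 0 <= M -> gX sigma Tzero M.
Proof.
intros HM; split; [|split]; [apply chain_zero|reflexivity|].
exact (gauge_zero sigma _ HX M HM).
Qed.

Lemma gX_nonneg U M : gX sigma U M -> 0 <= M.
Proof. intros [_ [_ [_ [H _]]]]; exact H. Qed.

(** The X-norm is already taken on the derivative, and [omY <= omX]; hence differentiation maps X to
    Y with norm at most 1. *)
Lemma gX_shift_gY U M : gX sigma U M -> gY sigma (shift U) M.
Proof.
intros [H1 [H2 [H3 [H4 H5]]]]; split; [|split]; auto.
intros N; eapply Rle_trans; [|apply (H5 N)].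
apply sum_Rle; intros n _; unfold qterm.
apply Rplus_le_compat_r, Rmult_le_compat_l; [pose proof (wgt_pos sigma n Hsigma); lra|].
apply RI_le; try lra.
- apply cts_mult; [apply HY|apply cts_N2, H3].
- apply cts_mult; [apply HX|apply cts_N2, H3].
- intros x Hx; apply Rmult_le_compat_r; [apply N2_nonneg|apply omX_ge].
Qed.

Definition sobX (n : nat) : R := match n with O => 2 * sob sigma 0 | S m => sob sigma m end.

Lemma sobX_nonneg n : 0 <= sobX n.
Proof. destruct n; simpl; pose proof (sob_nonneg sigma 0); [lra|apply sob_nonneg]. Qed.

(** The derivative is integrated from [x] to 1, where the function vanishes; bounding the two
    components separately costs the factor 2. *)
Lemma chain_sup_of_deriv U c : chain U -> U 0%nat 1 = C0 -> 0 <= c ->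
  (forall x, Cmod (U 1%nat x) <= c) -> forall x, Cmod (U 0%nat x) <= 2 * c.
Proof.
intros HU H1 Hc H x; rewrite (cfun2_clamp (U 0%nat) x) by apply HU.
pose proof (clamp_range x) as Hx; set (y := clamp x) in *.
destruct (HU 0%nat) as [[A1 A2] [D1 D2]]; destruct (HU 1%nat) as [[B1 B2] _].
pose proof (ftc01 _ _ y 1 A1 B1 D1 Hx ltac:(lra)) as F1.
pose proof (ftc01 _ _ y 1 A2 B2 D2 Hx ltac:(lra)) as F2.
cbv beta in F1, F2; rewrite H1 in F1, F2; simpl in F1, F2.
apply Cmod_le_comp.
- replace (Re (U 0%nat y)) with (- RI (fun x => Re (U 1%nat x)) y 1) by lra.
  rewrite Rabs_Ropp; eapply Rle_trans; [apply (RI_abs _ _ _ c)|nra]; [now apply cfun_cts|lra|].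
  intros z _; eapply Rle_trans; [apply Re_le_Cmod|apply H].
- replace (Im (U 0%nat y)) with (- RI (fun x => Im (U 1%nat x)) y 1) by lra.
  rewrite Rabs_Ropp; eapply Rle_trans; [apply (RI_abs _ _ _ c)|nra]; [now apply cfun_cts|lra|].
  intros z _; eapply Rle_trans; [apply Im_le_Cmod|apply H].
Qed.

Lemma gX_sup U M : gX sigma U M -> forall n x, Cmod (U n x) <= sobX n * M.
Proof.
intros HU n x; pose proof (gX_nonneg U M HU) as HM; destruct HU as [H1 [H2 H3]].
pose proof (gauge_sup sigma Hsigma _ HX HX1 _ M H3) as S.
destruct n as [|n]; simpl; [|apply S].
rewrite Rmult_assoc; apply chain_sup_of_deriv; auto.
- apply Rmult_le_pos; [apply sob_nonneg|easy].
- apply (S 0%nat).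
Qed.

Lemma gY_complete (F : nat -> fseq) (r : nat -> R) :
  (forall k, chain (F k)) -> (forall k, r (S k) <= r k / 2) ->
  (forall k, gY sigma (Tsub (F (S k)) (F k)) (r k)) ->
  exists E, chain E /\ forall k, gY sigma (Tsub E (F k)) (2 * r k).
Proof. exact (gauge_complete sigma Hsigma _ HY HY1 F r). Qed.

(** Completeness is applied to the derivatives, and the limit is integrated back from the base point
    1, which restores the boundary condition. *)
Lemma gX_complete (U : nat -> fseq) (r : nat -> R) :
  (forall k, chain (U k)) -> (forall k, U k 0%nat 1 = C0) -> (forall k, r (S k) <= r k / 2) ->
  (forall k, gX sigma (Tsub (U (S k)) (U k)) (r k)) ->
  exists E, forall k, gX sigma (Tsub E (U k)) (2 * r k).
Proof.
intros HU HU1 Hr H.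
destruct (gauge_complete sigma Hsigma _ HX HX1 (fun k => shift (U k)) r) as [V [HV HVk]].
- intros k; now apply chain_shift.
- exact Hr.
- intros k; apply (H k).
- set (E := fun n => match n with
    | O => fun x => mkC (prim 1 (fun y => Re (V 0%nat y)) x) (prim 1 (fun y => Im (V 0%nat y)) x)
    | S m => V m end).
  assert (HE : chain E).
  { intros [|n]; [|apply HV]; split; split; simpl.
    - apply cfun_prim, (HV 0%nat).
    - apply cfun_prim, (HV 0%nat).
    - apply der_prim, (HV 0%nat).
    - apply der_prim, (HV 0%nat). }
  exists E; intros k; split; [|split].
  + now apply chain_sub.
  + unfold Tsub, Tadd, Tscal; rewrite HU1; simpl; unfold prim; rewrite clamp_id by lra.
    rewrite !RI_point; apply Ceq; simpl; ring.
  + exact (HVk k).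
Qed.

Lemma LL_add s U V x : LL W s (Tadd U V) x = Cadd (LL W s U x) (LL W s V x).
Proof. unfold LL, Tadd; apply Ceq; simpl; ring. Qed.

Lemma LL_scal s c U x : LL W s (Tscal c U) x = Cmul c (LL W s U x).
Proof. unfold LL, Tscal; apply Ceq; simpl; ring. Qed.

Lemma solves_add s U V F G : solves W s U F -> solves W s V G -> solves W s (Tadd U V) (Tadd F G).
Proof. intros H1 H2 x Hx; rewrite LL_add, H1, H2; auto. Qed.

Lemma solves_scal s c U F : solves W s U F -> solves W s (Tscal c U) (Tscal c F).
Proof. intros H1 x Hx; rewrite LL_scal, H1; auto. Qed.

Lemma solves_sub s U V F G : solves W s U F -> solves W s V G -> solves W s (Tsub U V) (Tsub F G).
Proof. intros; apply solves_add; auto; now apply solves_scal. Qed.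

Lemma solves_shift s s0 U F : solves W s0 U F ->
  solves W s U (Tadd F (Tscal (Csub s s0) (shift U))).
Proof.
intros H x Hx; unfold Tadd, Tscal, shift; rewrite <- (H x Hx); unfold LL.
apply Ceq; simpl; ring.
Qed.

Lemma solves_zero s : solves W s Tzero Tzero.
Proof. intros x _; unfold LL, Tzero, C0; apply Ceq; simpl; ring. Qed.

Lemma LL_bound s x : 0 <= x <= 1 -> exists A, 0 <= A /\
  forall U b, Cmod (U 0%nat x) <= b -> Cmod (U 1%nat x) <= b -> Cmod (U 2%nat x) <= b ->
    Cmod (LL W s U x) <= A * b.
Proof.
intros Hx; exists (1 + 2 + Cmod s + Cmod (W x)).
pose proof (Cmod_nonneg s); pose proof (Cmod_nonneg (W x)); split; [lra|].
intros U b B0 B1 B2; unfold LL.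
eapply Rle_trans; [apply Cmod_sub|].
eapply Rle_trans; [apply Rplus_le_compat_r, Cmod_triangle|].
eapply Rle_trans; [apply Rplus_le_compat_r, Rplus_le_compat_r, Cmod_triangle|].
rewrite !Cmod_mul, !Cmod_RtoC, !Rabs_right by nra.
pose proof (Cmod_nonneg (U 0%nat x)); pose proof (Cmod_nonneg (U 1%nat x)).
pose proof (Cmod_nonneg (U 2%nat x)).
assert (x ^ 2 * Cmod (U 2%nat x) <= 1 * b) by (apply Rmult_le_compat; nra).
assert (2 * x * Cmod (U 1%nat x) <= 2 * b) by (apply Rmult_le_compat; nra).
assert (Cmod s * Cmod (U 1%nat x) <= Cmod s * b) by (apply Rmult_le_compat_l; lra).
assert (Cmod (W x) * Cmod (U 0%nat x) <= Cmod (W x) * b) by (apply Rmult_le_compat_l; lra).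
lra.
Qed.

(** Orders 0, 1 and 2 converge uniformly, so [L_s] passes to the limit at each point, while the
    residuals [Fk] tend to 0. *)
Lemma solves_limit s (U Fk : nat -> fseq) E F (r : nat -> R) :
  (forall k, 0 <= r k) -> (forall k, r (S k) <= r k / 2) ->
  (forall k, gX sigma (Tsub E (U k)) (2 * r k)) -> (forall k, gY sigma (Fk k) (r k)) ->
  (forall k, solves W s (U k) (Tsub F (Fk k))) -> solves W s E F.
Proof.
intros Hp Hr HE HF HS x Hx.
set (c := sobX 0 + sobX 1 + sobX 2).
pose proof (sobX_nonneg 0); pose proof (sobX_nonneg 1); pose proof (sobX_nonneg 2).
destruct (LL_bound s x Hx) as [A [HA HB]].
assert (HAc : 0 <= A * (2 * c)) by (apply Rmult_le_pos; unfold c; lra).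
pose proof (sob_nonneg sigma 0) as Hs0.
set (B := A * (2 * c) + sob sigma 0) in *.
assert (K : forall k, Cmod (Csub (LL W s E x) (F 0%nat x)) <= B * r k).
{ intros k; pose proof (gX_sup _ _ (HE k)) as S; specialize (Hp k).
  replace (Csub (LL W s E x) (F 0%nat x)) with (Csub (LL W s (Tsub E (U k)) x) (Fk k 0%nat x)).
  - eapply Rle_trans; [apply Cmod_sub|].
    unfold B; rewrite Rmult_plus_distr_r; apply Rplus_le_compat; [|now apply gY_sup].
    replace (A * (2 * c) * r k) with (A * (c * (2 * r k))) by ring.
    apply HB; eapply Rle_trans; try apply S; apply Rmult_le_compat_r; unfold c; lra.
  - unfold Tsub at 1; rewrite LL_add, LL_scal, HS by easy; unfold Tsub, Tadd, Tscal.
    apply Ceq; simpl; ring. }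
assert (Z : Cmod (Csub (LL W s E x) (F 0%nat x)) <= 0).
{ apply le_epsilon; intros e He; rewrite Rplus_0_l.
  destruct (halving_small r Hp Hr (e / (B + 1))) as [k Hk].
  { apply Rdiv_lt_0_compat; unfold B; lra. }
  eapply Rle_trans; [apply (K k)|].
  apply (Rmult_lt_compat_l (B + 1)) in Hk; [|unfold B; lra].
  replace ((B + 1) * (e / (B + 1))) with e in Hk by (field; unfold B; lra).
  specialize (Hp k); lra. }
now apply Csub_eq0, Cmod_eq0.
Qed.

(* Summing approximate solutions whose residuals halve. *)
Lemma approx_solve s C : 0 <= C ->
  (forall F M, 0 < M -> gY sigma F M -> exists U F',
     gX sigma U (C * M) /\ gY sigma F' (M / 2) /\ solves W s U (Tsub F F')) ->
  forall F M, 0 < M -> gY sigma F M -> exists U, gX sigma U (2 * C * M) /\ solves W s U F.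
Proof.
intros HC Happ F M HM HF.
(* One correction step is made a total function so that it can be iterated; outside the hypotheses
   its value is arbitrary. *)
assert (Hch : exists step : fseq * R -> fseq * fseq, forall p, 0 < snd p -> gY sigma (fst p) (snd p) ->
  gX sigma (fst (step p)) (C * snd p) /\ gY sigma (snd (step p)) (snd p / 2) /\
  solves W s (fst (step p)) (Tsub (fst p) (snd (step p)))).
{ apply (choice (fun (p : fseq * R) (q : fseq * fseq) => 0 < snd p -> gY sigma (fst p) (snd p) ->
    gX sigma (fst q) (C * snd p) /\ gY sigma (snd q) (snd p / 2) /\
    solves W s (fst q) (Tsub (fst p) (snd q)))).
  intros [G m]; simpl; destruct (classic (0 < m /\ gY sigma G m)) as [[Hm HG]|Hn].
  - destruct (Happ G m Hm HG) as [U [F' H]]; exists (U, F'); simpl; auto.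
  - exists (G, G); tauto. }
destruct Hch as [step Hstep].
set (m := fun k : nat => M * (/ 2) ^ k).
assert (Hm : forall k, 0 < m k) by (intros; apply Rmult_lt_0_compat; auto; apply pow_lt; lra).
assert (HmS : forall k, m (S k) = m k / 2) by (intros; unfold m; simpl; field).
(* The first component is the partial sum of the corrections, the second the residual still to be
   solved, of norm at most [M / 2 ^ k]. *)
set (sq := fix sq k := match k with
  | O => (Tzero, F)
  | S k => (Tadd (fst (sq k)) (fst (step (snd (sq k), m k))), snd (step (snd (sq k), m k)))
  end).
assert (HY' : forall k, gY sigma (snd (sq k)) (m k)).
{ induction k as [|k IH].
  - simpl; unfold m; rewrite Rmult_1_r; exact HF.
  - rewrite HmS; apply (Hstep (snd (sq k), m k)); simpl; auto. }
assert (HSt : forall k, gX sigma (fst (step (snd (sq k), m k))) (C * m k) /\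
  solves W s (fst (step (snd (sq k), m k))) (Tsub (snd (sq k)) (snd (sq (S k))))).
{ intros k; destruct (Hstep (snd (sq k), m k)) as [A1 [_ A2]]; simpl; auto. }
assert (HSo : forall k, solves W s (fst (sq k)) (Tsub F (snd (sq k)))).
{ induction k as [|k IH].
  - simpl; replace (Tsub F F) with Tzero by (unfold C0; teq); apply solves_zero.
  - replace (Tsub F (snd (sq (S k)))) with
      (Tadd (Tsub F (snd (sq k))) (Tsub (snd (sq k)) (snd (sq (S k))))) by teq.
    simpl; apply solves_add; [exact IH|apply HSt]. }
assert (HXk : forall k, exists M', gX sigma (fst (sq k)) M').
{ induction k as [|k [M' IH]].
  - exists 0; apply gX_zero; lra.
  - exists (M' + C * m k); simpl; apply gX_add; [exact IH|apply HSt]. }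
destruct (gX_complete (fun k => fst (sq k)) (fun k => C * m k)) as [E HE].
- intros k; destruct (HXk k) as [M' [H _]]; exact H.
- intros k; destruct (HXk k) as [M' [_ [H _]]]; exact H.
- intros k; rewrite HmS; lra.
- intros k; replace (Tsub (fst (sq (S k))) (fst (sq k))) with (fst (step (snd (sq k), m k)));
    [apply HSt|].
  simpl; teq.
- exists E; split.
  + specialize (HE 0%nat); simpl in HE.
    replace (Tsub E Tzero) with E in HE by (unfold C0; teq).
    unfold m in HE; simpl in HE; rewrite Rmult_1_r in HE.
    replace (2 * C * M) with (2 * (C * M)) by ring; exact HE.
  (* A single sequence has to dominate both the errors, governed by [C * m k], and the residuals,
     governed by [m k]; hence [C + 1]. *)
  + apply (solves_limit s (fun k => fst (sq k)) (fun k => snd (sq k)) E F (fun k => (C + 1) * m k)).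
    * intros k; specialize (Hm k); nra.
    * intros k; rewrite HmS; lra.
    * intros k; eapply gX_mono; [apply HE|]; specialize (Hm k); nra.
    * intros k; eapply gY_mono; [apply HY'|]; specialize (Hm k); nra.
    * exact HSo.
Qed.

(** Baire's theorem in Y. If no [A n] were dense in a ball, each centre could be moved within its
    ball and the radius shrunk so that [A n] misses the doubled new ball. The limit of the centres
    stays within twice each radius, so it would lie in none of the sets. *)
Lemma gY_baire (A : nat -> fseq -> Prop) :
  (forall F M, gY sigma F M -> exists n, A n F) ->
  exists n F0 r, 0 < r /\ chain F0 /\
    forall F, gY sigma (Tsub F F0) r -> forall e, 0 < e -> exists H, A n H /\ gY sigma (Tsub F H) e.
Proof.
intros Hcov; apply NNPP; intros Hn.
assert (Hstep : forall p : nat * (fseq * R), exists q : fseq * R,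
  0 < snd (snd p) -> chain (fst (snd p)) ->
  gY sigma (Tsub (fst q) (fst (snd p))) (snd (snd p)) /\ 0 < snd q /\ snd q <= snd (snd p) / 2 /\
  chain (fst q) /\ forall H, A (fst p) H -> ~ gY sigma (Tsub (fst q) H) (2 * snd q)).
{ intros [n [F0 r]]; simpl.
  destruct (classic (0 < r /\ chain F0)) as [[Hr HF0]|Hc]; [|exists (F0, r); tauto].
  apply NNPP; intros Hq; apply Hn; exists n, F0, r; split; [|split]; auto.
  intros F HF e He; apply NNPP; intros HH; apply Hq.
  (* The bound [r / 2] makes the radii halve; [e / 2] keeps the doubled radius below [e], the
     distance within which [F] has no approximant in [A n]. *)
  exists (F, Rmin (r / 2) (e / 2)); simpl; intros _ _.
  pose proof (Rmin_l (r / 2) (e / 2)); pose proof (Rmin_r (r / 2) (e / 2)).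
  split; [exact HF|]; split; [apply Rmin_pos; lra|]; split; [easy|]; split.
  - replace F with (Tadd (Tsub F F0) F0) by teq; apply chain_add; [apply HF|exact HF0].
  - intros G HA HG; apply HH; exists G; split; [exact HA|].
    eapply gY_mono; [exact HG|lra]. }
destruct (choice _ Hstep) as [step HS]; clear Hstep.
set (sq := fix sq k := match k with O => (Tzero, 1) | S k => step (k, sq k) end).
assert (HP : forall k, 0 < snd (sq k) /\ chain (fst (sq k))).
{ induction k as [|k [I1 I2]]; [simpl; split; [lra|apply chain_zero]|].
  destruct (HS (k, sq k) I1 I2) as [_ [B1 [_ [B2 _]]]]; split; [exact B1|exact B2]. }
destruct (gY_complete (fun k => fst (sq k)) (fun k => snd (sq k))) as [E [HE HEk]].
- intros k; apply HP.
- intros k; destruct (HP k) as [I1 I2]; apply (HS (k, sq k) I1 I2).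
- intros k; destruct (HP k) as [I1 I2]; apply (HS (k, sq k) I1 I2).
- assert (HEg : gY sigma E (2 * 1)).
  { replace E with (Tsub E Tzero) by (unfold C0; teq); apply (HEk 0%nat). }
  destruct (Hcov E _ HEg) as [n HAn].
  destruct (HP n) as [I1 I2]; destruct (HS (n, sq n) I1 I2) as [_ [_ [_ [_ B]]]].
  apply (B E HAn), (gauge_sub_sym sigma _ HY), (HEk (S n)).
Qed.

(** Open mapping theorem. With [A n] the set of right-hand sides that have a solution of norm at
    most [n], Baire gives density near some [F0], symmetry and convexity move it to 0, and scaling
    supplies the solver with half residual that [approx_solve] asks for. *)
Lemma bounded_inverse s :
  (forall F M, gY sigma F M -> exists U M', gX sigma U M' /\ solves W s U F) ->
  exists C, 0 < C /\
    forall F M, 0 < M -> gY sigma F M -> exists U, gX sigma U (C * M) /\ solves W s U F.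
Proof.
intros Hsol.
destruct (gY_baire (fun n F => exists U, gX sigma U (INR n) /\ solves W s U F)) as
  [n [F0 [r [Hr [HF0 HB]]]]].
{ intros F M HF; destruct (Hsol F M HF) as [U [M' [HU HS]]].
  destruct (INR_unbounded M') as [n Hn]; exists n, U; split; [|exact HS].
  eapply gX_mono; [exact HU|lra]. }
(* [F] is half the difference of [F0 + F] and [F0 - F], both of which lie in the ball about [F0]. *)
assert (Hloc : forall F, gY sigma F r -> forall e, 0 < e -> exists U H,
  gX sigma U (INR n) /\ solves W s U H /\ gY sigma (Tsub F H) e).
{ intros F HF e He.
  destruct (HB (Tadd F0 F)) with (e := e) as [H1 [[U1 [X1 S1]] G1]]; auto.
  { replace (Tsub (Tadd F0 F) F0) with F by teq; exact HF. }
  destruct (HB (Tsub F0 F)) with (e := e) as [H2 [[U2 [X2 S2]] G2]]; auto.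
  { replace (Tsub (Tsub F0 F) F0) with (Tscal (RtoC (-1)) F) by teq.
    apply (gY_scal (RtoC (-1))) in HF; rewrite Cmod_RtoC, Rabs_left in HF by lra.
    replace r with (- (-1) * r) by ring; exact HF. }
  exists (Tscal (RtoC (/ 2)) (Tsub U1 U2)), (Tscal (RtoC (/ 2)) (Tsub H1 H2)); split; [|split].
  - pose proof (gX_scal (RtoC (/ 2)) _ _ (gX_sub _ _ _ _ X1 X2)) as X.
    rewrite Cmod_RtoC, Rabs_right in X by lra.
    replace (INR n) with (/ 2 * (INR n + INR n)) by field; exact X.
  - now apply solves_scal, solves_sub.
  - pose proof (gY_scalR (/ 2) _ _ ltac:(lra) (gY_sub _ _ _ _ G1 G2)) as X.
    replace e with (/ 2 * (e + e)) by field.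
    replace (Tsub F (Tscal (RtoC (/ 2)) (Tsub H1 H2))) with
      (Tscal (RtoC (/ 2)) (Tsub (Tsub (Tadd F0 F) H1) (Tsub (Tsub F0 F) H2))) by teq.
    exact X. }
(* [approx_solve] doubles the constant [n / r]; adding 1 makes it positive even for [n = 0]. *)
exists (2 * (INR n / r) + 1); pose proof (pos_INR n).
assert (HC : 0 <= INR n / r) by now apply Rdiv_le_0_compat.
split; [lra|].
intros F M HM HF.
destruct (approx_solve s (INR n / r) HC) with (F := F) (M := M) as [U [HU HS]]; auto.
- clear F M HM HF; intros F M HM HF.
  assert (Hq : 0 < r / M) by now apply Rdiv_lt_0_compat.
  assert (Hq' : 0 < M / r) by now apply Rdiv_lt_0_compat.
  destruct (Hloc (Tscal (RtoC (r / M)) F)) with (e := r / 2) as [U [G0 [X [S G]]]]; [|lra|].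
  + replace r with (r / M * M) at 2 by (field; lra).
    apply gY_scalR; [lra|easy].
  + exists (Tscal (RtoC (M / r)) U), (Tsub F (Tscal (RtoC (M / r)) G0)); split; [|split].
    * apply (gX_scal (RtoC (M / r))) in X; rewrite Cmod_RtoC, Rabs_right in X by lra.
      replace (INR n / r * M) with (M / r * INR n) by (field; lra); exact X.
    * apply (gY_scalR (M / r)) in G; [|lra].
      replace (M / 2) with (M / r * (r / 2)) by (field; lra).
      replace (Tsub F (Tscal (RtoC (M / r)) G0)) with
        (Tscal (RtoC (M / r)) (Tsub (Tscal (RtoC (r / M)) F) G0)); [exact G|].
      teq; lra.
    * replace (Tsub F (Tsub F (Tscal (RtoC (M / r)) G0))) with (Tscal (RtoC (M / r)) G0) by teq.
      now apply solves_scal.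
- exists U; split; [|exact HS]; eapply gX_mono; [exact HU|nra].
Qed.

(** The solution at [s0] leaves at [s] the residual [-(s - s0) U'], of norm at most
    [|s - s0| * C * M <= M / 2]; the summation in [approx_solve] is then the Neumann series. *)
Lemma perturbed_solve s0 s C : 0 < C ->
  (forall F M, 0 < M -> gY sigma F M -> exists U, gX sigma U (C * M) /\ solves W s0 U F) ->
  Cmod (Csub s s0) * C <= / 2 ->
  forall F M, 0 < M -> gY sigma F M -> exists U, gX sigma U (2 * C * M) /\ solves W s U F.
Proof.
intros HC H Hs; apply approx_solve; [lra|].
intros F M HM HF; destruct (H F M HM HF) as [U [HU HS]].
exists U, (Tscal (Copp (Csub s s0)) (shift U)); split; [|split]; [exact HU| |].
- eapply gY_mono; [apply gY_scal, gX_shift_gY, HU|].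
  rewrite Cmod_opp; nra.
- replace (Tsub F (Tscal (Copp (Csub s s0)) (shift U))) with
    (Tadd F (Tscal (Csub s s0) (shift U))) by teq.
  now apply solves_shift.
Qed.

(** A null solution [U] at [s] satisfies [L_{s0} U = (s0 - s) U']. By uniqueness at [s0] it is the
    solution given by the bounded inverse, so its norm bound can be halved indefinitely. *)
Lemma perturbed_unique s0 s C : 0 < C ->
  (forall F M, 0 < M -> gY sigma F M -> exists U, gX sigma U (C * M) /\ solves W s0 U F) ->
  (forall U M, gX sigma U M -> solves W s0 U Tzero -> U = Tzero) ->
  Cmod (Csub s s0) * C <= / 2 ->
  forall U M, gX sigma U M -> solves W s U Tzero -> U = Tzero.
Proof.
intros HC H Huniq Hs U M HU HS.
assert (Hs0 : solves W s0 U (Tscal (Csub s0 s) (shift U))).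
{ apply (solves_shift s0) in HS.
  replace (Tscal (Csub s0 s) (shift U)) with (Tadd Tzero (Tscal (Csub s0 s) (shift U))) by teq.
  exact HS. }
assert (Hmod : Cmod (Csub s0 s) = Cmod (Csub s s0)).
{ rewrite <- (Cmod_opp (Csub s s0)); f_equal; apply Ceq; simpl; ring. }
assert (Hhalf : forall m, 0 < m -> gX sigma U m -> gX sigma U (m / 2)).
{ intros m Hm HUm.
  destruct (H (Tscal (Csub s0 s) (shift U)) (/ (2 * C) * m)) as [V [HV HVs]].
  - assert (0 < / (2 * C)) by (apply Rinv_0_lt_compat; lra); nra.
  - eapply gY_mono; [apply gY_scal, gX_shift_gY, HUm|].
    apply Rmult_le_compat_r; [lra|]; rewrite Hmod.
    apply (Rmult_le_reg_r C); [lra|].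
    replace (/ (2 * C) * C) with (/ 2) by (field; lra); exact Hs.
  - assert (E : Tsub U V = Tzero).
    { eapply Huniq; [apply gX_sub; eassumption|].
      replace Tzero with (Tsub (Tscal (Csub s0 s) (shift U)) (Tscal (Csub s0 s) (shift U)))
        by (unfold C0; teq).
      now apply solves_sub. }
    replace U with (Tadd V (Tsub U V)) by teq; rewrite E.
    replace (Tadd V Tzero) with V by teq.
    replace (m / 2) with (C * (/ (2 * C) * m)) by (field; lra); exact HV. }
(* [M] may be 0, and [Hhalf] asks for a positive bound; hence the start at [M + 1]. *)
assert (Hk : forall k, gX sigma U ((M + 1) * (/ 2) ^ k)).
{ pose proof (gX_nonneg _ _ HU); induction k as [|k IH].
  - simpl; eapply gX_mono; [exact HU|lra].
  - apply Hhalf in IH; [|apply Rmult_lt_0_compat; [lra|apply pow_lt; lra]].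
    replace ((M + 1) * (/ 2) ^ S k) with ((M + 1) * (/ 2) ^ k / 2) by (simpl; field); exact IH. }
apply functional_extensionality; intro n; apply functional_extensionality; intro x.
apply Cmod_eq0, le_epsilon; intros e He; rewrite Rplus_0_l.
pose proof (gX_nonneg _ _ HU); pose proof (sobX_nonneg n).
destruct (halving_small (fun k => sobX n * ((M + 1) * (/ 2) ^ k))) with (e := e) as [k Hlt]; auto.
- intros k; assert (0 < (/ 2) ^ k) by (apply pow_lt; lra).
  apply Rmult_le_pos; [easy|]; apply Rmult_le_pos; lra.
- intros k; simpl; right; field.
- pose proof (gX_sup _ _ (Hk k) n x); lra.
Qed.

End Solve.

Lemma cfun_bounded g : cfun g -> exists B, 0 <= B /\ forall x, Rabs (g x) <= B.
Proof.
intros [Hg Cg].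
destruct (continuity_ab_maj (fun x => Rabs (g x)) 0 1) as [m [Hm _]]; [lra| |].
- intros c _; apply continuity_pt_filterlim.
  apply (continuous_comp g Rabs); [apply Cg|apply continuity_pt_filterlim, Rcontinuity_abs].
- exists (Rabs (g m)); split; [apply Rabs_pos|]; intros x; rewrite Hg; apply Hm, clamp_range.
Qed.

Lemma cfun2_bounded h : cfun2 h -> exists B, 0 <= B /\ forall x, Cmod (h x) <= B.
Proof.
intros [H1 H2]; destruct (cfun_bounded _ H1) as [B1 [P1 K1]]; destruct (cfun_bounded _ H2) as [B2 [P2 K2]].
exists (2 * (B1 + B2)); split; [lra|]; intros x.
apply Cmod_le_comp; [specialize (K1 x)|specialize (K2 x)]; lra.
Qed.

Lemma cfun2_limit (h : nat -> R -> Cx) c (r : nat -> R) :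
  (forall k, cfun2 (h k)) -> 0 <= c -> (forall k, 0 <= r k) -> (forall k, r (S k) <= r k / 2) ->
  (forall k x, Cmod (Csub (h (S k) x) (h k x)) <= c * r k) ->
  exists G, cfun2 G /\ forall k x, Cmod (Csub (G x) (h k x)) <= 2 * (c * (2 * r k)).
Proof.
intros Hh Hc Hp Hr H.
destruct (uniform_limit (fun k x => Re (h k x)) c r) as [G1 [C1 K1]]; auto; [intros; apply Hh| |].
{ intros k x; eapply Rle_trans; [|apply (H k x)]; apply (Re_le_Cmod (Csub _ _)). }
destruct (uniform_limit (fun k x => Im (h k x)) c r) as [G2 [C2 K2]]; auto; [intros; apply Hh| |].
{ intros k x; eapply Rle_trans; [|apply (H k x)]; apply (Im_le_Cmod (Csub _ _)). }
exists (fun x => mkC (G1 x) (G2 x)); split; [now split|].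
intros k x; apply Cmod_le_comp; simpl; [apply K1|apply K2].
Qed.

(** * The solution vanishing near the origin *)

Definition CJ (h : R -> Cx) (x : R) : Cx :=
  mkC (prim 0 (fun y => Re (h y)) x) (prim 0 (fun y => Im (h y)) x).

Lemma cfun2_CJ h : cfun2 h -> cfun2 (CJ h).
Proof. intros [H1 H2]; split; simpl; now apply cfun_prim. Qed.

Lemma der2_CJ h : cfun2 h -> der2 (CJ h) h.
Proof. intros [H1 H2]; split; simpl; now apply der_prim. Qed.

Definition vanish (d : R) (h : R -> Cx) : Prop := forall x, clamp x <= d -> h x = C0.

Lemma vanish_CJ d h : cfun2 h -> vanish d h -> vanish d (CJ h).
Proof.
intros [[_ C1] [_ C2]] H x Hx; pose proof (clamp_range x).
assert (Z : forall y, 0 <= y <= clamp x -> h y = C0)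
  by (intros y Hy; apply H; rewrite clamp_id; lra).
apply Ceq; simpl; unfold prim; apply Rabs_eq_0, Rle_antisym; try apply Rabs_pos.
- eapply Rle_trans; [apply (RI_abs _ 0 (clamp x) 0 C1)|lra]; [lra|].
  intros y Hy; rewrite Z by easy; simpl; rewrite Rabs_R0; lra.
- eapply Rle_trans; [apply (RI_abs _ 0 (clamp x) 0 C2)|lra]; [lra|].
  intros y Hy; rewrite Z by easy; simpl; rewrite Rabs_R0; lra.
Qed.

Lemma RI_exp m l c : 0 < l -> RI (fun y => m * exp (l * y)) 0 c = m / l * (exp (l * c) - 1).
Proof.
intros Hl.
assert (D : forall y, is_derive (fun y => m / l * exp (l * y)) y (m * exp (l * y))).
{ intros y; apply is_derive_Reals.
  replace (m * exp (l * y)) with (m / l * (exp (l * y) * (l * 1))) by (field; lra).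
  apply derivable_pt_lim_scal.
  apply (derivable_pt_lim_comp (fun y => l * y) exp y).
  - apply derivable_pt_lim_scal, derivable_pt_lim_id.
  - apply derivable_pt_lim_exp. }
assert (C : cts (fun y => m * exp (l * y))).
{ intros y; apply (continuous_mult (fun _ => m) (fun y => exp (l * y))); [apply continuous_const|].
  apply (continuous_comp (fun y => l * y) exp).
  - apply (continuous_mult (fun _ => l) (fun y => y)); [apply continuous_const|apply continuous_id].
  - apply continuity_pt_filterlim, derivable_continuous_pt, derivable_pt_exp. }
unfold RI; rewrite (is_RInt_unique (V := R_CompleteNormedModule) _ 0 c
  (m / l * exp (l * c) - m / l * exp (l * 0))).
- rewrite Rmult_0_r, exp_0; ring.
- apply (is_RInt_derive (V := R_CompleteNormedModule) (fun y => m / l * exp (l * y)));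
    [intros; apply D|intros; apply C].
Qed.

(** Bielecki's weighted sup norm: integrating [exp (l y)] gains the factor [1 / l], so a large [l]
    makes a Volterra operator contract on the whole interval at once. *)
Lemma prim_weighted u v m l : cfun u -> cfun v -> 0 <= m -> 0 < l ->
  (forall y, Rabs (u y - v y) <= m * exp (l * clamp y)) ->
  forall x, Rabs (prim 0 u x - prim 0 v x) <= m / l * exp (l * clamp x).
Proof.
intros [_ Cu] [_ Cv] Hm Hl H x; unfold prim; pose proof (clamp_range x) as Hx.
set (c := clamp x) in *.
assert (Ce : cts (fun y => m * exp (l * clamp y))).
{ intros y; apply (continuous_mult (fun _ => m) (fun y => exp (l * clamp y))); [apply continuous_const|].
  apply (continuous_comp (fun y => l * clamp y) exp).
  - apply (continuous_mult (fun _ => l) clamp); [apply continuous_const|apply clamp_continuous].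
  - apply continuity_pt_filterlim, derivable_continuous_pt, derivable_pt_exp. }
assert (B : RI (fun y => m * exp (l * clamp y)) 0 c <= m / l * exp (l * c)).
{ rewrite (RI_ext _ (fun y => m * exp (l * y))) by (try lra; intros; now rewrite clamp_id).
  rewrite RI_exp by easy.
  assert (0 <= m / l) by now apply Rdiv_le_0_compat.
  lra. }
replace (RI u 0 c - RI v 0 c) with (RI u 0 c + -1 * RI v 0 c) by ring.
assert (C1 : cts (fun y => -1 * v y)) by (apply cts_mult; auto; apply cts_const).
rewrite <- RI_scal, <- RI_plus by auto.
assert (C2 : cts (fun y => u y + -1 * v y)) by now apply cts_plus.
eapply Rle_trans; [|exact B]; apply Rabs_le_between; split.
- replace (- RI (fun y => m * exp (l * clamp y)) 0 c) with
    (RI (fun y => -1 * (m * exp (l * clamp y))) 0 c) by (rewrite RI_scal by easy; ring).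
  apply RI_le; auto; [apply cts_mult; auto; apply cts_const|lra|].
  intros y _; specialize (H y); apply Rabs_le_between in H; lra.
- apply RI_le; auto; [lra|].
  intros y _; specialize (H y); apply Rabs_le_between in H; lra.
Qed.

Lemma CJ_weighted u v m l : cfun2 u -> cfun2 v -> 0 <= m -> 0 < l ->
  (forall y, Cmod (Csub (u y) (v y)) <= m * exp (l * clamp y)) ->
  forall x, Cmod (Csub (CJ u x) (CJ v x)) <= 2 * m / l * exp (l * clamp x).
Proof.
intros [U1 U2] [V1 V2] Hm Hl H x.
replace (2 * m / l * exp (l * clamp x)) with (2 * (m / l * exp (l * clamp x))) by (field; lra).
apply Cmod_le_comp.
- apply (prim_weighted (fun y => Re (u y)) (fun y => Re (v y))); auto.
  intros y; eapply Rle_trans; [|apply H]; apply (Re_le_Cmod (Csub _ _)).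
- apply (prim_weighted (fun y => Im (u y)) (fun y => Im (v y))); auto.
  intros y; eapply Rle_trans; [|apply H]; apply (Im_le_Cmod (Csub _ _)).
Qed.

Section Volterra.
Context (p q b : R -> Cx) (Hp : cfun2 p) (Hq : cfun2 q) (Hb : cfun2 b).

(** With [h] standing for the second derivative, [CJ h] and [CJ (CJ h)] are the first derivative and
    the function with zero data at 0; a fixed point thus solves [v'' = b + p v' + q v]. *)
Definition volterra (h : R -> Cx) (x : R) : Cx :=
  Cadd (b x) (Cadd (Cmul (p x) (CJ h x)) (Cmul (q x) (CJ (CJ h) x))).

Lemma cfun2_volterra h : cfun2 h -> cfun2 (volterra h).
Proof.
intros Hh; apply cfun2_add; [easy|]; apply cfun2_add; apply cfun2_mul; auto using cfun2_CJ.
Qed.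

Lemma volterra_contraction : exists l, 0 < l /\ forall u v m, cfun2 u -> cfun2 v -> 0 <= m ->
  (forall y, Cmod (Csub (u y) (v y)) <= m * exp (l * clamp y)) ->
  forall x, Cmod (Csub (volterra u x) (volterra v x)) <= m / 2 * exp (l * clamp x).
Proof.
destruct (cfun2_bounded p Hp) as [Bp [Pp Kp]]; destruct (cfun2_bounded q Hq) as [Bq [Pq Kq]].
(* The two terms contribute [2 * Bp / l] and [4 * Bq / l ^ 2], the latter at most [4 * Bq / l] since
   [l >= 1]; with this [l] the sum is at most 1/2. *)
set (l := 8 * (Bp + Bq) + 1); assert (Hl : 0 < l) by (unfold l; lra).
exists l; split; [easy|]; intros u v m Hu Hv Hm H x.
pose proof (CJ_weighted u v m l Hu Hv Hm Hl H) as J1.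
assert (Hm1 : 0 <= 2 * m / l) by (apply Rdiv_le_0_compat; lra).
pose proof (CJ_weighted _ _ _ l (cfun2_CJ _ Hu) (cfun2_CJ _ Hv) Hm1 Hl J1 x) as J2.
specialize (J1 x).
replace (Csub (volterra u x) (volterra v x)) with
  (Cadd (Cmul (p x) (Csub (CJ u x) (CJ v x))) (Cmul (q x) (Csub (CJ (CJ u) x) (CJ (CJ v) x))))
  by (apply Ceq; simpl; ring).
eapply Rle_trans; [apply Cmod_triangle|]; rewrite !Cmod_mul.
set (e := exp (l * clamp x)) in *; assert (He : 0 < e) by apply exp_pos.
specialize (Kp x); specialize (Kq x).
apply Rle_trans with (Bp * (2 * m / l * e) + Bq * (2 * (2 * m / l) / l * e)).
{ apply Rplus_le_compat; apply Rmult_le_compat; auto; apply Cmod_nonneg. }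
assert (Hml : m / l * l = m) by (field; lra).
assert (Hml0 : 0 <= m / l) by now apply Rdiv_le_0_compat.
replace (2 * (2 * m / l) / l) with (4 * (m / l) * / l) by (field; lra).
replace (2 * m / l) with (2 * (m / l)) by (field; lra).
assert (Hl1 : / l <= 1) by (rewrite <- Rinv_1; apply Rinv_le_contravar; unfold l; lra).
assert (Hl0 : 0 < / l) by now apply Rinv_0_lt_compat.
set (z := m / l) in *.
assert (4 * z * / l <= 4 * z) by nra.
assert (Bq * (4 * z * / l) <= Bq * (4 * z)) by (apply Rmult_le_compat_l; lra).
replace (Bp * (2 * z * e) + Bq * (4 * z * / l * e)) with ((Bp * (2 * z) + Bq * (4 * z * / l)) * e) by ring.
apply Rmult_le_compat_r; [lra|].
assert (E : z * l = 8 * (z * Bp) + 8 * (z * Bq) + z) by (unfold l; ring).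
assert (0 <= z * Bp) by nra; assert (0 <= z * Bq) by nra; lra.
Qed.

(** Picard iteration started at 0: each iterate inherits from [b] the vanishing up to [d], and so
    does the uniform limit. *)
Lemma volterra_fixpoint d : vanish d b -> exists g, cfun2 g /\ vanish d g /\
  forall x, g x = volterra g x.
Proof.
intros Hvb; destruct volterra_contraction as [l [Hl Hcon]].
destruct (cfun2_bounded b Hb) as [B [PB KB]].
set (sq := fix sq k := match k with O => fun _ => C0 | S k => volterra (sq k) end).
assert (Csq : forall k, cfun2 (sq k)).
{ induction k as [|k IH]; [apply cfun2_const|now apply cfun2_volterra]. }
assert (Hexp : forall x, 1 <= exp (l * clamp x)).
{ intros x; rewrite <- exp_0; pose proof (clamp_range x).
  destruct (Req_dec (l * clamp x) 0) as [->|]; [lra|].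
  left; apply exp_increasing; nra. }
assert (Hexp' : forall x, exp (l * clamp x) <= exp l).
{ intros x; pose proof (clamp_range x).
  destruct (Req_dec (l * clamp x) l) as [->|]; [lra|].
  left; apply exp_increasing; nra. }
assert (Hd : forall k x, Cmod (Csub (sq (S k) x) (sq k x)) <= B * (/ 2) ^ k * exp (l * clamp x)).
{ induction k as [|k IH]; intros x.
  - simpl (/ 2 ^ 0).
    replace (Csub (sq 1%nat x) (sq 0%nat x)) with (b x).
    + specialize (KB x); specialize (Hexp x); simpl; nra.
    + assert (Z : CJ (fun _ => C0) x = C0).
      { apply (vanish_CJ 1); [apply cfun2_const|now intros y _|apply clamp_range]. }
      assert (Z' : CJ (CJ (fun _ => C0)) x = C0).
      { apply (vanish_CJ 1); [apply cfun2_CJ, cfun2_const| |apply clamp_range].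
        apply vanish_CJ; [apply cfun2_const|now intros y _]. }
      simpl; unfold volterra; rewrite Z, Z'; apply Ceq; simpl; ring.
  - replace (B * (/ 2) ^ S k) with (B * (/ 2) ^ k / 2) by (simpl; field).
    apply (Hcon (sq (S k)) (sq k)); auto.
    apply Rmult_le_pos; [easy|apply pow_le; lra]. }
set (r := fun k : nat => (/ 2) ^ k).
assert (Hr : forall k, 0 <= r k) by (intros; apply pow_le; lra).
assert (HrS : forall k, r (S k) <= r k / 2) by (intros; unfold r; simpl; lra).
assert (Hel : 0 < exp l) by apply exp_pos.
destruct (cfun2_limit sq (B * exp l) r) as [g [Cg Kg]]; auto.
{ apply Rmult_le_pos; lra. }
{ intros k x; eapply Rle_trans; [apply Hd|]; specialize (Hexp' x); specialize (Hr k); unfold r in *.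
  replace (B * exp l * (/ 2) ^ k) with (B * (/ 2) ^ k * exp l) by ring.
  apply Rmult_le_compat_l; [nra|easy]. }
set (c := 4 * (B * exp l)).
assert (Hc : 0 <= c) by (unfold c; nra).
assert (Kg' : forall k x, Cmod (Csub (g x) (sq k x)) <= c * r k).
{ intros k x; eapply Rle_trans; [apply Kg|]; unfold c; lra. }
assert (Small : forall z (A : R), 0 <= A -> (forall k, Cmod z <= A * r k) -> z = C0).
{ intros z A HA H; apply Cmod_eq0, le_epsilon; intros e He; rewrite Rplus_0_l.
  destruct (halving_small r Hr HrS (e / (A + 1))) as [k Hk]; [apply Rdiv_lt_0_compat; lra|].
  eapply Rle_trans; [apply (H k)|].
  apply (Rmult_lt_compat_l (A + 1)) in Hk; [|lra].
  replace ((A + 1) * (e / (A + 1))) with e in Hk by (field; lra); specialize (Hr k); lra. }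
exists g; split; [easy|]; split.
- assert (Vk : forall k, vanish d (sq k)).
  { induction k as [|k IH]; [now intros y _|].
    intros x Hx; simpl; unfold volterra.
    rewrite Hvb, (vanish_CJ d (sq k)), (vanish_CJ d (CJ (sq k))); auto using vanish_CJ, cfun2_CJ.
    apply Ceq; simpl; ring. }
  intros x Hx; apply (Small _ c Hc); intros k.
  replace (g x) with (Csub (g x) (sq k x)); [apply Kg'|].
  rewrite (Vk k x Hx); apply Ceq; simpl; ring.
- intros x; apply Csub_eq0, (Small _ (c + c * exp l)); [nra|]; intros k.
  replace (Csub (g x) (volterra g x)) with
    (Cadd (Csub (g x) (sq (S k) x)) (Csub (volterra (sq k) x) (volterra g x)))
    by (simpl; apply Ceq; simpl; ring).
  eapply Rle_trans; [apply Cmod_triangle|]; rewrite Rmult_plus_distr_r.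
  specialize (Hr k) as Hrk; specialize (HrS k).
  apply Rplus_le_compat.
  + eapply Rle_trans; [apply Kg'|]; apply Rmult_le_compat_l; lra.
  + eapply Rle_trans; [apply (Hcon _ _ (c * r k))|]; auto.
    * nra.
    * intros y; replace (Cmod (Csub (sq k y) (g y))) with (Cmod (Csub (g y) (sq k y))).
      -- eapply Rle_trans; [apply Kg'|]; specialize (Hexp y); assert (0 <= c * r k) by nra; nra.
      -- rewrite <- (Cmod_opp (Csub (sq k y) (g y))); f_equal; apply Ceq; simpl; ring.
    * specialize (Hexp' x); specialize (Hexp x).
      assert (0 <= c * r k) by nra.
      replace (c * exp l * r k) with (c * r k * exp l) by ring.
      apply Rmult_le_compat; lra.
Qed.

End Volterra.

(** * Differentiation of complex products and of the equation *)

Lemma locally_between a x b : a < x < b -> locally x (fun y => a < y < b).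
Proof.
intros H; assert (Hp : 0 < Rmin (x - a) (b - x)) by (apply Rmin_pos; lra).
exists (mkposreal _ Hp); intros y Hy.
unfold ball in Hy; simpl in Hy; unfold AbsRing_ball, abs, minus, plus, opp in Hy; simpl in Hy.
pose proof (Rmin_l (x - a) (b - x)); pose proof (Rmin_r (x - a) (b - x)).
apply Rabs_def2 in Hy; lra.
Qed.

Lemma is_derive_multR f g x f' g' : is_derive f x f' -> is_derive g x g' ->
  is_derive (fun y => f y * g y) x (f' * g x + f x * g').
Proof.
intros Hf Hg; apply is_derive_Reals in Hf, Hg; apply is_derive_Reals.
exact (derivable_pt_lim_mult f g x f' g' Hf Hg).
Qed.

Definition isd (h : R -> Cx) (x : R) (l : Cx) : Prop :=
  is_derive (fun y => Re (h y)) x (Re l) /\ is_derive (fun y => Im (h y)) x (Im l).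

Lemma isd_eq h x l l' : isd h x l -> l = l' -> isd h x l'.
Proof. now intros H <-. Qed.

Lemma isd_add f g x f' g' : isd f x f' -> isd g x g' -> isd (fun y => Cadd (f y) (g y)) x (Cadd f' g').
Proof.
intros [? ?] [? ?]; split; simpl.
- apply (is_derive_plus (fun y => Re (f y)) (fun y => Re (g y))); auto.
- apply (is_derive_plus (fun y => Im (f y)) (fun y => Im (g y))); auto.
Qed.

Lemma isd_mul f g x f' g' : isd f x f' -> isd g x g' ->
  isd (fun y => Cmul (f y) (g y)) x (Cadd (Cmul f' (g x)) (Cmul (f x) g')).
Proof.
intros [F1 F2] [G1 G2]; split; simpl.
- replace (Re f' * Re (g x) - Im f' * Im (g x) + (Re (f x) * Re g' - Im (f x) * Im g')) with
    ((Re f' * Re (g x) + Re (f x) * Re g') - (Im f' * Im (g x) + Im (f x) * Im g')) by ring.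
  apply (is_derive_minus (fun y => Re (f y) * Re (g y)) (fun y => Im (f y) * Im (g y)));
    now apply is_derive_multR.
- replace (Re f' * Im (g x) + Im f' * Re (g x) + (Re (f x) * Im g' + Im (f x) * Re g')) with
    ((Re f' * Im (g x) + Re (f x) * Im g') + (Im f' * Re (g x) + Im (f x) * Re g')) by ring.
  apply (is_derive_plus (fun y => Re (f y) * Im (g y)) (fun y => Im (f y) * Re (g y)));
    now apply is_derive_multR.
Qed.

Lemma isd_const c x : isd (fun _ => c) x C0.
Proof. split; simpl; apply is_derive_Reals, derivable_pt_lim_const. Qed.

Lemma isd_RtoC f x l : is_derive f x l -> isd (fun y => RtoC (f y)) x (RtoC l).
Proof. intros H; split; simpl; [exact H|apply is_derive_Reals, derivable_pt_lim_const]. Qed.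

Lemma isd_opp f x f' : isd f x f' -> isd (fun y => Copp (f y)) x (Copp f').
Proof.
intros [? ?]; split; simpl.
- apply (is_derive_opp (fun y => Re (f y))); auto.
- apply (is_derive_opp (fun y => Im (f y))); auto.
Qed.

Lemma isd_sub f g x f' g' : isd f x f' -> isd g x g' -> isd (fun y => Csub (f y) (g y)) x (Csub f' g').
Proof. intros; apply isd_add; auto; now apply isd_opp. Qed.

Lemma isd_ext_loc f g x l : locally x (fun y => f y = g y) -> isd f x l -> isd g x l.
Proof.
intros H [H1 H2]; split.
- apply (is_derive_ext_loc (fun y => Re (f y))); auto.
  apply (filter_imp (fun y => f y = g y)); auto; now intros y ->.
- apply (is_derive_ext_loc (fun y => Im (f y))); auto.
  apply (filter_imp (fun y => f y = g y)); auto; now intros y ->.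
Qed.

Lemma der2_isd h h' x : der2 h h' -> 0 < x < 1 -> isd h x (h' x).
Proof. intros [H1 H2] Hx; split; auto. Qed.

(** On (0,d) all derivatives of the zero function vanish; continuity adds the points 0 and [d]. *)
Lemma chain_vanish D d : chain D -> 0 < d <= 1 -> (forall x, 0 <= x < d -> D 0%nat x = C0) ->
  forall n, vanish d (D n).
Proof.
intros HD Hd H0.
assert (K : forall n x, 0 < x < d -> D n x = C0).
{ induction n as [|n IH]; intros x Hx; [apply H0; lra|].
  pose proof (der2_isd _ _ x (proj2 (HD n)) ltac:(lra)) as [D1 D2].
  assert (Z : isd (D n) x C0).
  { apply (isd_ext_loc (fun _ => C0)); [|apply isd_const].
    apply (filter_imp (fun y => 0 < y < d)); [intros y Hy; symmetry; now apply IH|].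
    now apply locally_between. }
  destruct Z as [Z1 Z2].
  apply Ceq; [rewrite <- (is_derive_unique _ _ _ D1)|rewrite <- (is_derive_unique _ _ _ D2)];
    now apply is_derive_unique. }
intros n x Hx; rewrite (cfun2_clamp (D n) x) by apply HD; pose proof (clamp_range x) as Hc.
set (c := clamp x) in *; clearbody c.
(* rescaling [0,d] to [0,1] *)
assert (E : forall y, D n (d * clamp y) = C0).
{ assert (Cs : forall g, cfun g -> cfun (fun y => g (d * clamp y))).
  { intros g [_ Cg]; apply (cfun_comp_clamp (fun y => g (d * y))).
    intros y; apply (continuous_comp (fun y => d * y) g); [|apply Cg].
    apply (continuous_mult (fun _ => d) (fun y => y)); [apply continuous_const|apply continuous_id]. }
  destruct (HD n) as [[C1 C2] _].
  apply (cfun2_eq_closed (fun y => D n (d * clamp y)) (fun _ => C0)); [|apply cfun2_const|].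
  - split; [apply (Cs _ C1)|apply (Cs _ C2)].
  - intros y Hy; apply K; rewrite clamp_id by lra; nra. }
specialize (E (c / d)).
assert (0 <= c / d) by (apply Rdiv_le_0_compat; lra).
assert (c / d <= 1) by (apply Rle_div_l; lra).
rewrite clamp_id in E by lra.
replace (d * (c / d)) with c in E by (field; lra); exact E.
Qed.

(* [Leib A B n i k] is the [n]-th derivative of the product of [A i] and [B k]. *)
Fixpoint Leib (A B : fseq) (n i k : nat) (x : R) : Cx :=
  match n with
  | O => Cmul (A i x) (B k x)
  | S n => Cadd (Leib A B n (S i) k x) (Leib A B n i (S k) x)
  end.

Lemma Leib_ext A B B' n : forall i k x, (forall j, (j <= k + n)%nat -> B j = B' j) ->
  Leib A B n i k x = Leib A B' n i k x.
Proof.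
induction n as [|n IH]; intros i k x H; simpl.
- rewrite H by lia; reflexivity.
- rewrite IH, (IH i (S k)); [reflexivity|intros; apply H; lia|intros; apply H; lia].
Qed.

Lemma Leib_isd A B x n : forall i k, (forall i, isd (A i) x (A (S i) x)) ->
  (forall j, (j <= k + n)%nat -> isd (B j) x (B (S j) x)) ->
  isd (Leib A B n i k) x (Leib A B (S n) i k x).
Proof.
induction n as [|n IH]; intros i k HA HB.
- simpl; apply isd_mul; [apply HA|apply HB; lia].
- change (Leib A B (S (S n)) i k x) with (Cadd (Leib A B (S n) (S i) k x) (Leib A B (S n) i (S k) x)).
  apply (isd_add (Leib A B n (S i) k) (Leib A B n i (S k))); apply IH; auto; intros; apply HB; lia.
Qed.

Lemma Leib_cfun2 A B n : forall i k, (forall i, cfun2 (A i)) ->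
  (forall j, (j <= k + n)%nat -> cfun2 (B j)) -> cfun2 (Leib A B n i k).
Proof.
induction n as [|n IH]; intros i k HA HB.
- apply cfun2_mul; [apply HA|apply HB; lia].
- apply (cfun2_add (Leib A B n (S i) k) (Leib A B n i (S k))); apply IH; auto; intros; apply HB; lia.
Qed.

Lemma Leib_zero A B x n : forall i k, (forall j, (j <= k + n)%nat -> B j x = C0) ->
  Leib A B n i k x = C0.
Proof.
induction n as [|n IH]; intros i k HB; simpl.
- rewrite HB by lia; apply Ceq; simpl; ring.
- rewrite !IH; [apply Ceq; simpl; ring|intros; apply HB; lia|intros; apply HB; lia].
Qed.

(** The function [1 / x ^ 2] cut off below [d / 2]. In the local solution the cut-off part
    multiplies functions that vanish there. Cutting at [d / 2] rather than [d] keeps the exact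
    formula valid around [d], where it has to be differentiated. *)
Definition ainv (d x : R) : R := / (Rmax (clamp x) (d / 2)) ^ 2.

Lemma cfun_ainv d : 0 < d -> cfun (ainv d).
Proof.
intros Hd; apply (cfun_comp_clamp (fun c => / (Rmax c (d / 2)) ^ 2)); intros x.
assert (C : continuous (fun c => Rmax c (d / 2)) x).
{ apply continuous_eps; intros e He; exists e; split; [easy|]; intros y Hy.
  eapply Rle_lt_trans; [|exact Hy].
  unfold Rmax; repeat destruct Rle_dec; unfold Rabs; repeat destruct Rcase_abs; lra. }
pose proof (Rmax_r x (d / 2)).
apply continuity_pt_filterlim, continuity_pt_inv.
- apply continuity_pt_filterlim; simpl.
  apply (continuous_mult (fun c => Rmax c (d / 2)) (fun c => Rmax c (d / 2) * 1)); auto.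
  apply (continuous_mult (fun c => Rmax c (d / 2)) (fun _ => 1)); auto; apply continuous_const.
- apply Rgt_not_eq, pow_lt; lra.
Qed.

Lemma ainv_eq d x : 0 < d -> d / 2 <= x <= 1 -> ainv d x = / x ^ 2.
Proof. intros Hd Hx; unfold ainv; rewrite clamp_id, Rmax_left by lra; reflexivity. Qed.

Lemma ainv_bound d x : 0 < d -> 0 <= ainv d x <= / (d / 2) ^ 2.
Proof.
intros Hd; pose proof (Rmax_r (clamp x) (d / 2)); unfold ainv; split.
- left; apply Rinv_0_lt_compat, pow_lt; lra.
- apply Rinv_le_contravar; [apply pow_lt; lra|]; apply pow_incr; lra.
Qed.

Section LocalSolution.
Context (WW F : fseq) (s : Cx) (d : R).
Context (HW : chain WW) (HF : chain F) (Hd : 0 < d <= 1) (HFv : forall n, vanish d (F n)).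

(* [x^2 V''] after [n] differentiations of the equation. *)
Definition rhs (n : nat) (V : fseq) (c x : R) : Cx :=
  Cadd (Csub (Csub (F n x) (Cmul (Cadd (RtoC (2 * (INR n + 1) * c)) s) (V (S n) x)))
             (Cmul (RtoC (INR n * (INR n + 1))) (V n x)))
       (Leib WW V n 0 0 x).

(** The Leibniz sum makes [V (n + 2)] depend on all lower orders, which is no structural recursion.
    So [tab n] is a table correct up to order [n + 1], extended one order at a time; [sol] reads its
    diagonal. *)
Fixpoint tab (v0 v1 : R -> Cx) (n : nat) : fseq :=
  match n with
  | O => fun m => match m with O => v0 | S _ => v1 end
  | S n => fun m => if (m <=? S n)%nat then tab v0 v1 n m
      else fun x => Cmul (RtoC (ainv d x)) (rhs n (tab v0 v1 n) (clamp x) x)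
  end.

Lemma tab_stable v0 v1 n m : (m <= S n)%nat -> tab v0 v1 (S n) m = tab v0 v1 n m.
Proof. intros H; simpl; apply Nat.leb_le in H; simpl in H; now rewrite H. Qed.

Definition sol (v0 v1 : R -> Cx) (m : nat) : R -> Cx := tab v0 v1 m m.

Lemma tab_sol v0 v1 n m : (m <= S n)%nat -> tab v0 v1 n m = sol v0 v1 m.
Proof.
intros H; unfold sol; destruct (Nat.eq_dec m (S n)) as [->|Hn].
- now rewrite tab_stable.
- assert (Hm : (m <= n)%nat) by lia; clear H Hn; induction n as [|n IH].
  + replace m with 0%nat by lia; reflexivity.
  + destruct (Nat.eq_dec m (S n)) as [->|]; [reflexivity|].
    rewrite tab_stable by lia; apply IH; lia.
Qed.

Lemma sol_rec v0 v1 n x : sol v0 v1 (S (S n)) x =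
  Cmul (RtoC (ainv d x)) (rhs n (sol v0 v1) (clamp x) x).
Proof.
rewrite <- (tab_sol v0 v1 (S n)) by lia; unfold tab at 1; fold tab.
replace (S (S n) <=? S n)%nat with false by (symmetry; apply Nat.leb_gt; lia).
f_equal; unfold rhs; rewrite !tab_sol by lia.
f_equal; apply Leib_ext; intros j Hj; apply tab_sol; lia.
Qed.

(** The derivative of [x^2 V^(n+2)] is [2 x V^(n+2) + x^2 V^(n+3)], hence the extra summand. The
    coefficients of [rhs] recur because [2 (n + 1) + n (n + 1) = (n + 1) (n + 2)]. *)
Lemma rhs_isd n V x : 0 < x < 1 -> (forall j, (j <= S n)%nat -> isd (V j) x (V (S j) x)) ->
  isd (fun y => rhs n V y y) x (Cadd (rhs (S n) V x x) (Cmul (RtoC (2 * x)) (V (S (S n)) x))).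
Proof.
intros Hx HV; eapply isd_eq.
- apply isd_add; [apply isd_sub; [apply isd_sub|]|].
  + apply der2_isd; [apply HF|easy].
  + apply isd_mul; [|apply HV; lia].
    apply isd_add; [|apply isd_const].
    apply isd_RtoC; apply (is_derive_scal (fun y => y) x (2 * (INR n + 1)) 1).
    apply is_derive_Reals, derivable_pt_lim_id.
  + apply isd_mul; [apply isd_const|apply HV; lia].
  + apply Leib_isd; [|intros; apply HV; lia].
    intros i; apply der2_isd; [apply HW|easy].
- cbv beta; unfold rhs; rewrite S_INR; apply Ceq; cbn -[Leib INR]; ring.
Qed.

(** Order 2 is the Volterra fixed point, orders 1 and 0 are its primitives, and higher orders are
    defined by the differentiated equation. What remains is that each of these is really the
    derivative of the preceding one. *)
Lemma local_solution : exists V, chain V /\ (forall n, vanish d (V n)) /\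
  forall n x, V (S (S n)) x = Cmul (RtoC (ainv d x)) (rhs n V (clamp x) x).
Proof.
assert (Ca : cfun2 (fun x => RtoC (ainv d x))).
{ split; simpl; [apply cfun_ainv; lra|apply cfun_const]. }
assert (Cl : forall c : R, cfun2 (fun x => RtoC (c * clamp x))).
{ intros c; split; simpl; [|apply cfun_const].
  apply cfun_mult; [apply cfun_const|apply cfun_clamp]. }
(* The equation divided by [x^2]: [v'' = f / x^2 - ((2 x + s) / x^2) v' + (W / x^2) v]. *)
destruct (volterra_fixpoint
  (fun x => Cmul (RtoC (ainv d x)) (Copp (Cadd (RtoC (2 * clamp x)) s)))
  (fun x => Cmul (RtoC (ainv d x)) (WW 0%nat x))
  (fun x => Cmul (RtoC (ainv d x)) (F 0%nat x))) with (d := d) as [g [Cg [Vg Hg]]].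
{ apply cfun2_mul; [easy|].
  apply (cfun2_ext (fun x => Cmul (RtoC (-1)) (Cadd (RtoC (2 * clamp x)) s))).
  - intros x; apply Ceq; simpl; ring.
  - apply cfun2_mul; [apply cfun2_const|]; apply cfun2_add; [apply Cl|apply cfun2_const]. }
{ apply cfun2_mul; [easy|apply HW]. }
{ apply cfun2_mul; [easy|apply HF]. }
{ intros x Hx; rewrite (HFv 0%nat x Hx); apply Ceq; simpl; ring. }
set (V := sol (CJ (CJ g)) (CJ g)).
assert (Hrec : forall n x, V (S (S n)) x = Cmul (RtoC (ainv d x)) (rhs n V (clamp x) x))
  by (intros; apply sol_rec).
assert (V2 : V 2%nat = g).
{ apply functional_extensionality; intros x; rewrite Hrec, Hg; unfold volterra, rhs.
  change (V 1%nat x) with (CJ g x); change (V 0%nat x) with (CJ (CJ g) x).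
  apply Ceq; simpl; ring. }
assert (Main : forall n, (forall m, (m <= S n)%nat -> cfun2 (V m) /\ vanish d (V m)) /\
  (forall m, (m <= n)%nat -> der2 (V m) (V (S m)))).
{ induction n as [|n [IH1 IH2]].
  - split.
    + intros m Hm; assert (m = 0 \/ m = 1)%nat as [->| ->] by lia.
      * split; [apply cfun2_CJ, cfun2_CJ, Cg|].
        apply vanish_CJ; [now apply cfun2_CJ|now apply vanish_CJ].
      * split; [apply cfun2_CJ, Cg|now apply vanish_CJ].
    + intros m Hm; replace m with 0%nat by lia; apply (der2_CJ (CJ g)), cfun2_CJ, Cg.
  - assert (S1 : cfun2 (V (S (S n))) /\ vanish d (V (S (S n)))).
    { split.
      - apply (cfun2_ext (fun x => Cmul (RtoC (ainv d x)) (rhs n V (clamp x) x)));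
          [intros; now rewrite Hrec|].
        apply cfun2_mul; [easy|].
        assert (Cm : forall h, cfun2 h -> cfun2 (fun x => Copp (h x))).
        { intros h [A B]; split; simpl; now apply cfun_opp. }
        apply cfun2_add; [apply cfun2_add; [apply cfun2_add; [apply HF|]|]|].
        + apply Cm, cfun2_mul; [|apply IH1; lia].
          apply cfun2_add; [apply Cl|apply cfun2_const].
        + apply Cm, cfun2_mul; [apply cfun2_const|apply IH1; lia].
        + apply Leib_cfun2; [intros; apply HW|intros; apply IH1; lia].
      - intros x Hx; rewrite Hrec; unfold rhs.
        rewrite (HFv n x Hx), (proj2 (IH1 (S n) ltac:(lia)) x Hx), (proj2 (IH1 n ltac:(lia)) x Hx).
        rewrite Leib_zero by (intros j Hj; apply IH1; [lia|easy]).
        apply Ceq; simpl; ring. }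
    assert (IH1' : forall m, (m <= S (S n))%nat -> cfun2 (V m) /\ vanish d (V m)).
    { intros m Hm; destruct (Nat.eq_dec m (S (S n))) as [->|]; [exact S1|apply IH1; lia]. }
    split; [exact IH1'|].
    intros m Hm; destruct (Nat.eq_dec m (S n)) as [->|]; [|apply IH2; lia].
    (* From order 1 to order 2 the relation holds by integration; beyond that the recursion itself
       is differentiated. *)
    destruct n as [|n].
    + rewrite V2; apply (der2_CJ g Cg).
    + assert (isdx : forall x, 0 < x < 1 -> isd (V (S (S n))) x (V (S (S (S n))) x)).
      (* Left of [d] the functions vanish; from [d] on, [ainv] is [1 / y ^ 2] near the point and
         [rhs_isd] applies. *)
      { intros x Hx; destruct (Rlt_dec x d) as [Hxd|Hxd].
        - rewrite (proj2 S1 x) by (rewrite clamp_id; lra).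
          apply (isd_ext_loc (fun _ => C0)); [|apply isd_const].
          apply (filter_imp (fun y => 0 < y < d)); [|apply locally_between; lra].
          intros y Hy; symmetry; apply (IH1 (S (S n)) ltac:(lia)); rewrite clamp_id; lra.
        - assert (Hx0 : x <> 0) by lra.
          apply (isd_ext_loc (fun y => Cmul (RtoC (/ y ^ 2)) (rhs n V y y))).
          + apply (filter_imp (fun y => d / 2 < y < 1)); [|apply locally_between; lra].
            intros y Hy; rewrite Hrec, ainv_eq, clamp_id by lra; reflexivity.
          + eapply isd_eq.
            * apply isd_mul.
              -- apply isd_RtoC, (is_derive_inv (fun y => y ^ 2) x (INR 2 * x ^ 1));
                   [|apply pow_nonzero; lra].
                 apply is_derive_Reals, (derivable_pt_lim_pow x 2).
              -- apply rhs_isd; [easy|].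
                 intros j Hj; apply der2_isd; [apply IH2; lia|easy].
            * rewrite (Hrec (S n)), (Hrec n), ainv_eq, clamp_id by lra.
              apply Ceq; cbn -[rhs]; field; easy. }
      split; intros x Hx; now apply isdx. }
exists V; split; [|split].
- intros n; split; [apply (Main n); lia|apply (Main n); lia].
- intros n; apply (Main n); lia.
- exact Hrec.
Qed.

End LocalSolution.

(** * Openness of the parameter domain *)

(** Neighbourhoods of [s0], made into a filter so that general limit lemmas give the continuity of
    the functions that define the domain. *)
Definition near (s0 : Cx) (P : Cx -> Prop) : Prop :=
  exists r, 0 < r /\ forall s, Cmod (Csub s s0) < r -> P s.

#[local] Instance near_filter s0 : Filter (near s0).
Proof.
split.
- exists 1; split; [lra|easy].
- intros P Q [r [Hr HP]] [r' [Hr' HQ]]; exists (Rmin r r'); split; [now apply Rmin_pos|].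
  intros s Hs; pose proof (Rmin_l r r'); pose proof (Rmin_r r r'); split; [apply HP|apply HQ]; lra.
- intros P Q H [r [Hr HP]]; exists r; split; auto.
Qed.

Definition contC (s0 : Cx) (f : Cx -> R) : Prop := filterlim f (near s0) (locally (f s0)).

Lemma contC_lipschitz s0 f : (forall s, Rabs (f s - f s0) <= Cmod (Csub s s0)) -> contC s0 f.
Proof.
intros H P [e He]; exists e; split; [apply cond_pos|]; intros s Hs; apply He.
eapply Rle_lt_trans; [apply H|exact Hs].
Qed.

Lemma contC_Re s0 : contC s0 Re.
Proof. apply contC_lipschitz; intros s; apply (Re_le_Cmod (Csub s s0)). Qed.

Lemma contC_Im s0 : contC s0 Im.
Proof. apply contC_lipschitz; intros s; apply (Im_le_Cmod (Csub s s0)). Qed.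

Lemma contC_Cmod s0 : contC s0 Cmod.
Proof.
apply contC_lipschitz; intros s; apply Rabs_le_between; split.
- pose proof (Cmod_triangle s (Csub s0 s)) as H.
  replace (Cadd s (Csub s0 s)) with s0 in H by (apply Ceq; simpl; ring).
  rewrite <- (Cmod_opp (Csub s s0)).
  replace (Copp (Csub s s0)) with (Csub s0 s) by (apply Ceq; simpl; ring); lra.
- pose proof (Cmod_triangle s0 (Csub s s0)) as H.
  replace (Cadd s0 (Csub s s0)) with s in H by (apply Ceq; simpl; ring); lra.
Qed.

Lemma contC_const s0 c : contC s0 (fun _ => c).
Proof. apply filterlim_const. Qed.

Lemma contC_plus s0 f g : contC s0 f -> contC s0 g -> contC s0 (fun s => f s + g s).
Proof.
intros Hf Hg; refine (filterlim_comp_2 _ _ _ Hf Hg _).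
apply (filterlim_plus (K := R_AbsRing) (V := R_NormedModule)).
Qed.

Lemma contC_mult s0 f g : contC s0 f -> contC s0 g -> contC s0 (fun s => f s * g s).
Proof.
intros Hf Hg; refine (filterlim_comp_2 _ _ _ Hf Hg _).
apply (filterlim_mult (K := R_AbsRing)).
Qed.

Lemma contC_comp s0 f (h : R -> R) : contC s0 f -> continuous h (f s0) -> contC s0 (fun s => h (f s)).
Proof. intros Hf Hh; exact (filterlim_comp _ _ _ f h _ _ _ Hf Hh). Qed.

Lemma contC_opp s0 f : contC s0 f -> contC s0 (fun s => - f s).
Proof. intros H; apply (contC_comp s0 f Ropp H), continuity_pt_filterlim, continuity_opp, derivable_continuous, derivable_id. Qed.

Lemma contC_inv s0 f : contC s0 f -> f s0 <> 0 -> contC s0 (fun s => / f s).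
Proof.
intros H H0; apply (contC_comp s0 f Rinv H), continuity_pt_filterlim.
apply (continuity_pt_inv (fun x => x)); [apply derivable_continuous, derivable_id|exact H0].
Qed.

Lemma contC_lt s0 f g : contC s0 f -> contC s0 g -> f s0 < g s0 -> near s0 (fun s => f s < g s).
Proof.
intros Hf Hg H.
assert (C : contC s0 (fun s => g s + - f s)) by (apply contC_plus; auto; now apply contC_opp).
apply (filter_imp (fun s => 0 < g s + - f s)); [intros; lra|].
apply C, (open_gt 0); lra.
Qed.

Lemma Omega_open sigma s0 : 0 < sigma -> Omega sigma s0 -> near s0 (Omega sigma).
Proof.
intros Hs [H1 H23]; apply filter_and.
- destruct H1 as [[HR HI]|[HR HM]].
  (* The strict inequality for the imaginary part still suffices when the real part turns positive,
     because the modulus is at least as large. *)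
  + apply (filter_imp (fun s => sigma < Rabs (Im s))).
    * intros s HIs; destruct (Rle_lt_dec (Re s) 0); [now left|right; split; [lra|]].
      pose proof (Im_le_Cmod s); lra.
    * apply contC_lt; [apply contC_const| |easy].
      apply (contC_comp s0 Im Rabs (contC_Im s0)), continuity_pt_filterlim, Rcontinuity_abs.
  + apply (filter_imp (fun s => 0 < Re s /\ sigma < Cmod s)); [intros s [? ?]; right; split; lra|].
    apply filter_and; apply contC_lt; auto using contC_const, contC_Re, contC_Cmod.
- assert (CM := contC_Cmod s0); assert (CR := contC_Re s0).
  destruct H23 as [[H2 H2']|[H3 H3']].
  + apply (filter_imp (fun s => Omega2 sigma s)); [now left|].
    assert (CP := contC_plus s0 _ _ CM CR).
    apply filter_and; apply contC_lt; auto using contC_const.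
    apply contC_mult; [apply contC_mult; auto using contC_opp|].
    apply (contC_inv s0 (fun s => 2 * (Cmod s + Re s))); [apply contC_mult; auto using contC_const|lra].
  + apply (filter_imp (fun s => Omega3 sigma s)); [now right|].
    assert (Hm : 0 < Cmod s0).
    { apply Rnot_le_lt; intros Hle; now apply H3, Cmod_eq0. }
    apply filter_and.
    * apply (filter_imp (fun s => 0 < Cmod s)); [|apply contC_lt; auto using contC_const].
      intros s Hms ->; unfold Cmod, C0 in Hms; simpl in Hms.
      rewrite !Rmult_0_l, Rplus_0_l, sqrt_0 in Hms; lra.
    * apply contC_lt; auto using contC_const.
      assert (Cq : contC s0 (fun s => sigma * (1 + Re s / Cmod s) + / 2 * Re s)).
      { apply contC_plus; apply contC_mult; auto using contC_const.
        apply contC_plus; [apply contC_const|]; apply contC_mult; auto.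
        apply contC_inv; auto; lra. }
      apply contC_plus.
      -- apply contC_mult; [apply contC_const|]; apply contC_plus; auto.
         apply contC_plus; [easy|apply contC_opp, contC_const].
      -- apply contC_opp; apply (contC_mult s0 _ (fun s => _ * 1)); auto.
         apply contC_mult; auto using contC_const.
Qed.

(** * Gevrey estimates for the local solution *)

Definition L2le (h : R -> Cx) (m : R) : Prop :=
  cfun2 h /\ 0 <= m /\ RI (fun x => N2 (h x)) 0 1 <= m ^ 2.

Lemma L2le_add f g m m' : L2le f m -> L2le g m' -> L2le (fun x => Cadd (f x) (g x)) (m + m').
Proof.
intros [Cf [Hm Hf]] [Cg [Hm' Hg]]; split; [now apply cfun2_add|split; [lra|]].
apply (young_square _ _ _ m m' Hm Hm' Hf Hg); intros t Ht.
pose proof (cts_N2 f Cf) as C1; pose proof (cts_N2 g Cg) as C2.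
assert (C3 : forall c h, cts h -> cts (fun x => c * h x)) by (intros; apply cts_mult; auto using cts_const).
rewrite <- !RI_scal, <- RI_plus by auto; apply RI_le; try lra.
- now apply cts_N2, cfun2_add.
- apply cts_plus; auto.
- intros x _; now apply N2_add.
Qed.

Lemma L2le_mul p h b m : cfun2 p -> 0 <= b -> (forall x, Cmod (p x) <= b) -> L2le h m ->
  L2le (fun x => Cmul (p x) (h x)) (b * m).
Proof.
intros Cp Hb Hp [Ch [Hm H]]; split; [now apply cfun2_mul|split; [nra|]].
pose proof (cts_N2 h Ch) as C1.
apply Rle_trans with (RI (fun x => b ^ 2 * N2 (h x)) 0 1).
- apply RI_le; try lra; [now apply cts_N2, cfun2_mul|apply cts_mult; auto using cts_const|].
  intros x _; rewrite N2_mul; apply Rmult_le_compat_r; [apply N2_nonneg|].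
  rewrite <- Cmod_sq; apply pow_incr; split; [apply Cmod_nonneg|apply Hp].
- rewrite RI_scal by easy; rewrite Rpow_mult_distr.
  apply Rmult_le_compat_l; [apply pow2_ge_0|easy].
Qed.

Lemma L2le_opp h m : L2le h m -> L2le (fun x => Copp (h x)) m.
Proof.
intros [[C1 C2] [Hm H]]; split; [split; simpl; now apply cfun_opp|split; [easy|]].
rewrite (RI_ext _ (fun x => N2 (h x))) by (try lra; intros; unfold N2; simpl; ring); easy.
Qed.

Lemma L2le_sub f g m m' : L2le f m -> L2le g m' -> L2le (fun x => Csub (f x) (g x)) (m + m').
Proof. intros; apply (L2le_add f (fun x => Copp (g x))); auto using L2le_opp. Qed.

Lemma L2le_mono h m m' : L2le h m -> m <= m' -> L2le h m'.
Proof.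
intros [Ch [Hm H]] Hmm; split; [easy|split; [lra|]].
eapply Rle_trans; [exact H|apply pow_incr; lra].
Qed.

Lemma L2le_ext f g m : (forall x, f x = g x) -> L2le f m -> L2le g m.
Proof. intros H; replace g with f; [easy|]; now apply functional_extensionality. Qed.

Lemma L2le_sup h b : cfun2 h -> 0 <= b -> (forall x, Cmod (h x) <= b) -> L2le h b.
Proof.
intros Ch Hb H; split; [easy|split; [easy|]].
apply Rle_trans with (RI (fun _ => b ^ 2) 0 1); [|rewrite RI_const; lra].
apply RI_le; try lra; auto using cts_const, cts_N2.
intros x _; rewrite <- Cmod_sq; apply pow_incr; split; [apply Cmod_nonneg|apply H].
Qed.

Notation factR n := (INR (Factorial.fact n)).

Lemma factR_S n : factR (S n) = (INR n + 1) * factR n.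
Proof. rewrite fact_simpl, mult_INR, S_INR; reflexivity. Qed.

Lemma factR_mono n m : (n <= m)%nat -> factR n <= factR m.
Proof. intros H; now apply le_INR, fact_le. Qed.

Lemma factR_mult i j : factR i * factR j <= factR (i + j).
Proof.
induction i as [|i IH]; [simpl; lra|].
rewrite Nat.add_succ_l, !factR_S, plus_INR.
pose proof (pos_INR i); pose proof (pos_INR j); pose proof (fact_pos (i + j)).
pose proof (fact_pos i); pose proof (fact_pos j).
rewrite Rmult_assoc; apply Rmult_le_compat; nra.
Qed.

(** Bernoulli's inequality for [1 / theta = 1 + h]. With [theta = sigma / sigma_star] this is the
    gain from the strict inequality between the radii: it absorbs a factor [n + 1]. *)
Lemma geometric_linear_bound theta : 0 < theta < 1 ->
  exists c, 1 <= c /\ forall n, theta ^ n * (INR n + 1) <= c.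
Proof.
intros Ht; set (h := / theta - 1).
assert (Hh : 0 < h).
{ unfold h; assert (1 < / theta); [|lra].
  rewrite <- Rinv_1; apply Rinv_lt_contravar; lra. }
assert (Hi : 0 < / h) by now apply Rinv_0_lt_compat.
exists (1 + / h); split; [lra|]; intros n.
assert (Hp : theta ^ n * (1 + INR n * h) <= 1).
{ pose proof (poly n h Hh) as P; replace (1 + h) with (/ theta) in P by (unfold h; ring).
  rewrite pow_inv in P; pose proof (pow_lt theta n (proj1 Ht)).
  apply Rle_trans with (theta ^ n * / theta ^ n); [apply Rmult_le_compat_l; lra|].
  right; field; lra. }
pose proof (pow_lt theta n (proj1 Ht)); pose proof (pos_INR n).
assert (INR n + 1 <= (1 + INR n * h) * (1 + / h)).
{ replace ((1 + INR n * h) * (1 + / h)) with (1 + INR n + INR n * h + / h) by (field; lra); nra. }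
apply Rle_trans with (theta ^ n * ((1 + INR n * h) * (1 + / h))); [nra|].
rewrite <- Rmult_assoc; nra.
Qed.

(* The bound [i! k! (n+i+k+1)! / (i+k+1)!] obeys the recursion defining [Leib], so no binomial sum is needed. *)
Lemma Leib_L2le A B N K : (forall i k, (i + k = N)%nat ->
    L2le (fun x => Cmul (A i x) (B k x)) (K * (factR i * factR k))) ->
  forall n i k, (n + i + k = N)%nat ->
    L2le (Leib A B n i k) (K * (factR i * factR k * (factR (S N) / factR (S (i + k))))).
Proof.
intros H; induction n as [|n IH]; intros i k Hn.
- eapply L2le_mono; [apply (H i k); lia|].
  right; replace (i + k)%nat with N by lia; field.
  pose proof (fact_pos (S N)); lra.
- eapply L2le_mono; [apply (L2le_add (Leib A B n (S i) k) (Leib A B n i (S k))); apply IH; lia|].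
  right; replace (S i + k)%nat with (S (i + k)) by lia; replace (i + S k)%nat with (S (i + k)) by lia.
  rewrite (factR_S (S (i + k))), (factR_S i), (factR_S k), S_INR, plus_INR.
  pose proof (fact_pos (S (i + k))); pose proof (pos_INR i); pose proof (pos_INR k).
  field; split; lra.
Qed.

(* The truncated predecessors make [gev 0 = gev 1 = 1]. *)
Definition gev (m : nat) : R := factR (m - 1) * factR (m - 2).

Lemma gev_pos m : 0 < gev m.
Proof. apply Rmult_lt_0_compat; apply fact_pos. Qed.

(** For [k >= 2] it is [i! (k-1)! <= (i+k-1)!] together with [(k-2)! <= k!]. For [k = 0] the
    truncation in [gev] leaves [i!] against [(i-1)!], and the missing factor [i] is paid by
    [theta ^ i]. *)
Lemma gev_leibniz theta c i k : 0 < theta < 1 -> 1 <= c ->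
  (forall n, theta ^ n * (INR n + 1) <= c) ->
  theta ^ i * factR i * gev k <= c * (factR k * factR (i + k - 1)).
Proof.
intros Ht Hc H; unfold gev.
pose proof (pow_lt theta i (proj1 Ht)) as P; pose proof (fact_pos i) as Pi.
assert (P1 : theta ^ i <= 1).
{ rewrite <- (pow1 i); apply pow_incr; lra. }
destruct k as [|[|k]].
- simpl (0 - 1)%nat; simpl (0 - 2)%nat; rewrite Nat.add_0_r; simpl (factR 0).
  destruct i as [|i]; [simpl; lra|].
  simpl (S i - 1)%nat; rewrite Nat.sub_0_r, factR_S; specialize (H (S i)); rewrite S_INR in H.
  pose proof (fact_pos i); nra.
- simpl (1 - 1)%nat; simpl (1 - 2)%nat; replace (i + 1 - 1)%nat with i by lia; simpl (factR 0).
  change (factR 1) with 1; nra.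
- replace (S (S k) - 1)%nat with (S k) by lia; replace (S (S k) - 2)%nat with k by lia.
  replace (i + S (S k) - 1)%nat with (i + S k)%nat by lia.
  pose proof (factR_mult i (S k)) as M1; pose proof (factR_mono k (S (S k)) ltac:(lia)) as M2.
  pose proof (fact_pos k); pose proof (fact_pos (S k)); pose proof (fact_pos (i + S k)).
  pose proof (fact_pos (S (S k))).
  apply Rle_trans with (1 * (factR k * (factR i * factR (S k)))); [|].
  + replace (theta ^ i * factR i * (factR (S k) * factR k)) with
      (theta ^ i * (factR k * (factR i * factR (S k)))) by ring.
    apply Rmult_le_compat_r; [|easy].
    repeat apply Rmult_le_pos; lra.
  + apply Rmult_le_compat; try lra; [repeat apply Rmult_le_pos; lra|].
    apply Rmult_le_compat; try lra; nra.
Qed.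

Lemma sum_telescope_bound N : sum_f_R0 (fun n => / ((INR n + 1) * (INR n + 2))) N <= 1.
Proof.
assert (H : sum_f_R0 (fun n => / ((INR n + 1) * (INR n + 2))) N = 1 - / (INR N + 2)).
{ induction N as [|N IH]; [simpl; field|].
  rewrite tech5, IH, S_INR; pose proof (pos_INR N); field; lra. }
rewrite H; pose proof (pos_INR N).
assert (0 < / (INR N + 2)) by (apply Rinv_0_lt_compat; lra); lra.
Qed.

(** The comparison series telescopes to at most 1, and [B <= (B + 1) ^ 2] turns the bound on sums
    into one on the norm. *)
Lemma gauge_of_terms sigma om D B : chain D -> 0 <= B ->
  (forall n, qterm sigma om D n <= B * / ((INR n + 1) * (INR n + 2))) ->
  gauge sigma om D (B + 1).
Proof.
intros HD HB H; split; [easy|split; [lra|]]; intros N.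
apply Rle_trans with (sum_f_R0 (fun n => B * / ((INR n + 1) * (INR n + 2))) N).
- now apply sum_le_comp.
- rewrite (sum_eq _ (fun n => / ((INR n + 1) * (INR n + 2)) * B)) by (intros; ring).
  rewrite <- scal_sum; pose proof (sum_telescope_bound N); nra.
Qed.

Section GevreySolution.
Context (WW F V : fseq) (s : Cx) (d sigma theta cW c M : R).
Context (Hd : 0 < d) (Hsigma : 0 < sigma) (Ht : 0 < theta < 1) (HcW : 0 <= cW) (HM : 0 <= M).
Context (Hc1 : 1 <= c) (Hc : forall n, theta ^ n * (INR n + 1) <= c).
Context (HW : chain WW) (HV : chain V).
Context (HWb : forall i x, Cmod (WW i x) <= cW * (theta / sigma) ^ i * factR i ^ 2).
Context (HFb : forall n, L2le (F n) (M * (/ sigma) ^ n * (factR n * factR (S n)))).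
Context (Hrec : forall n x, V (S (S n)) x = Cmul (RtoC (ainv d x)) (rhs WW F s n V (clamp x) x)).

Let A := / (d / 2) ^ 2.
Let q := / sigma.
Let S' := Cmod s.
Let Bc := A * (sigma * (2 + S') + sigma ^ 2 + sigma ^ 2 * (cW * c)).

(** Since [gev (n + 2) = (n+1)! n!], the bound for [F n] matches exactly and gives the summand
    without [K]. Relative to it the other terms carry [2 / n] and [|s| / (n (n+1))] from
    [V (n + 1)], [1 / (n (n-1))] from [V n], and [1 / n] from the Leibniz sum; [Bc] collects their
    constants. From [n = 2] on no predecessor is truncated. *)
Lemma gevrey_step K n : 0 <= K -> (2 <= n)%nat ->
  (forall j, (j <= S n)%nat -> L2le (V j) (K * q ^ j * gev j)) ->
  L2le (V (S (S n))) ((A * M * sigma ^ 2 + K * Bc / INR n) * q ^ S (S n) * gev (S (S n))).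
Proof.
intros HK Hn IH.
assert (HA : 0 < A) by (apply Rinv_0_lt_compat, pow_lt; lra).
assert (Hq : 0 < q) by now apply Rinv_0_lt_compat.
assert (HS : 0 <= S') by apply Cmod_nonneg.
pose proof (pos_INR n) as Hn0.
assert (T2 : L2le (fun x => Cmul (Cadd (RtoC (2 * (INR n + 1) * clamp x)) s) (V (S n) x))
  ((2 * (INR n + 1) + S') * (K * q ^ S n * gev (S n)))).
{ apply L2le_mul; [| |intros x|apply IH; lia].
  - apply cfun2_add; [|apply cfun2_const]; split; simpl; [|apply cfun_const].
    apply cfun_mult; [apply cfun_const|apply cfun_clamp].
  - lra.
  - eapply Rle_trans; [apply Cmod_triangle|]; apply Rplus_le_compat_r.
    pose proof (clamp_range x); rewrite Cmod_RtoC, Rabs_right; nra. }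
assert (T3 : L2le (fun x => Cmul (RtoC (INR n * (INR n + 1))) (V n x))
  (INR n * (INR n + 1) * (K * q ^ n * gev n))).
{ apply (L2le_mul (fun _ => RtoC (INR n * (INR n + 1)))); [apply cfun2_const|nra|intros _|apply IH; lia].
  rewrite Cmod_RtoC, Rabs_right; nra. }
assert (T4 : L2le (Leib WW V n 0 0) (cW * c * K * q ^ n * factR (n - 1) * factR (S n))).
{ eapply L2le_mono; [apply (Leib_L2le WW V n (cW * c * K * q ^ n * factR (n - 1)))|]; [|lia|].
  - intros i k Hik; eapply L2le_mono.
    + apply L2le_mul; [apply HW| |apply HWb|apply IH; lia].
      apply Rmult_le_pos; [apply Rmult_le_pos; [easy|]|apply pow2_ge_0].
      apply pow_le, Rdiv_le_0_compat; lra.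
    + pose proof (gev_leibniz theta c i k Ht Hc1 Hc) as L; rewrite Hik in L.
      unfold Rdiv; fold q; rewrite Rpow_mult_distr.
      replace (q ^ n) with (q ^ i * q ^ k) by (rewrite <- pow_add; now rewrite Hik).
      replace (cW * (theta ^ i * q ^ i) * factR i ^ 2 * (K * q ^ k * gev k)) with
        (cW * (q ^ i * q ^ k) * K * factR i * (theta ^ i * factR i * gev k)) by ring.
      replace (cW * c * K * (q ^ i * q ^ k) * factR (n - 1) * (factR i * factR k)) with
        (cW * (q ^ i * q ^ k) * K * factR i * (c * (factR k * factR (n - 1)))) by ring.
      apply Rmult_le_compat_l; [|exact L].
      pose proof (pow_lt q i Hq); pose proof (pow_lt q k Hq); pose proof (fact_pos i).
      repeat apply Rmult_le_pos; lra.
  - right; simpl (0 + 0)%nat; change (factR 1) with 1; change (factR 0) with 1; field. }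
assert (T : L2le (fun x => rhs WW F s n V (clamp x) x)
  (M * q ^ n * (factR n * factR (S n)) + (2 * (INR n + 1) + S') * (K * q ^ S n * gev (S n)) +
   INR n * (INR n + 1) * (K * q ^ n * gev n) + cW * c * K * q ^ n * factR (n - 1) * factR (S n))).
{ unfold rhs; apply L2le_add; [|exact T4]; apply L2le_sub; [|exact T3]; apply L2le_sub; [|exact T2].
  apply HFb. }
apply (L2le_ext (fun x => Cmul (RtoC (ainv d x)) (rhs WW F s n V (clamp x) x)));
  [intros; now rewrite Hrec|].
eapply L2le_mono; [apply L2le_mul; [| |intros x|exact T]|].
- split; simpl; [now apply cfun_ainv|apply cfun_const].
- apply Rlt_le, HA.
- pose proof (ainv_bound d x Hd); rewrite Cmod_RtoC, Rabs_right; [|lra]; unfold A; lra.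
- clear T T2 T3 T4; destruct n as [|[|p]]; [lia|lia|]; unfold gev.
  replace (S (S (S (S p))) - 1)%nat with (S (S (S p))) by lia.
  replace (S (S (S (S p))) - 2)%nat with (S (S p)) by lia.
  replace (S (S (S p)) - 1)%nat with (S (S p)) by lia.
  replace (S (S (S p)) - 2)%nat with (S p) by lia.
  replace (S (S p) - 1)%nat with (S p) by lia.
  replace (S (S p) - 2)%nat with p by lia.
  unfold Bc; rewrite !factR_S, !S_INR.
  change (q ^ S (S (S (S p)))) with (q * (q * q ^ S (S p))).
  change (q ^ S (S (S p))) with (q * q ^ S (S p)).
  assert (Hqn : 0 < q ^ S (S p)) by now apply pow_lt.
  set (Q := q ^ S (S p)) in *; clearbody Q.
  pose proof (fact_pos p) as Hf; set (f := factR p) in *; clearbody f.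
  pose proof (pos_INR p) as Hp; set (m := INR p) in *; clearbody m.
  unfold q; clearbody A S'.
  assert (X : 0 <= A * K * Q * f ^ 2) by (repeat apply Rmult_le_pos; try lra; apply pow2_ge_0).
  (* The right side exceeds the left by an explicit nonnegative amount: the slack in replacing
     [1 / (n (n+1))] and [1 / (n (n-1))] by [1 / n], where [n = m + 2]. *)
  match goal with |- ?l <= ?r =>
    replace r with (l + A * K * Q * f ^ 2 * ((m + 1) ^ 2 * (m + 2) ^ 2 * S' * / sigma
       + (m + 1) * (m + 2) * (m + 3) * m)) end.
  2:{ field. split; lra. }
  assert (0 < / sigma) by easy.
  rewrite <- (Rplus_0_r (A * _)) at 1; apply Rplus_le_compat_l.
  apply Rmult_le_pos; [easy|]; repeat (apply Rplus_le_le_0_compat || apply Rmult_le_pos || apply pow_le); lra.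
Qed.

(** For [n > 2 * Bc] the step multiplies [K] by at most 1/2, so any [K >= 2 * A * M * sigma ^ 2]
    reproduces itself; the finitely many lower orders are bounded functions, covered by enlarging
    [K]. *)
Lemma gevrey_solution : exists K, 0 <= K /\ forall m, L2le (V m) (K * q ^ m * gev m).
Proof.
assert (HA : 0 < A) by (apply Rinv_0_lt_compat, pow_lt; lra).
assert (Hq : 0 < q) by now apply Rinv_0_lt_compat.
assert (HS : 0 <= S') by apply Cmod_nonneg.
assert (Hg : forall m, 0 < q ^ m * gev m)
  by (intros; apply Rmult_lt_0_compat; [now apply pow_lt|apply gev_pos]).
assert (HB : 0 <= Bc).
{ apply Rmult_le_pos; [lra|]; pose proof (pow2_ge_0 sigma).
  repeat (apply Rplus_le_le_0_compat || apply Rmult_le_pos); lra. }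
assert (Up : forall K K' m, L2le (V m) (K * q ^ m * gev m) -> K <= K' -> L2le (V m) (K' * q ^ m * gev m)).
{ intros K K' m H HKK; eapply L2le_mono; [exact H|].
  rewrite !Rmult_assoc; apply Rmult_le_compat_r; [apply Rlt_le, Hg|easy]. }
assert (Init : forall N, exists K, 0 <= K /\ forall m, (m <= N)%nat -> L2le (V m) (K * q ^ m * gev m)).
{ assert (One : forall m, exists K, 0 <= K /\ L2le (V m) (K * q ^ m * gev m)).
  { intros m; destruct (cfun2_bounded (V m)) as [b [Hb Kb]]; [apply HV|].
    exists (b / (q ^ m * gev m)); specialize (Hg m); split; [now apply Rdiv_le_0_compat|].
    rewrite Rmult_assoc; replace (b / (q ^ m * gev m) * (q ^ m * gev m)) with b.
    - apply L2le_sup; auto; apply HV.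
    - field; split; intros E; rewrite E in Hg; lra. }
  induction N as [|N [K [HK IH]]].
  - destruct (One 0%nat) as [K [HK H]]; exists K; split; [easy|].
    intros m Hm; now replace m with 0%nat by lia.
  - destruct (One (S N)) as [K' [HK' H]]; exists (K + K'); split; [lra|].
    intros m Hm; destruct (Nat.eq_dec m (S N)) as [->|].
    + eapply Up; [exact H|lra].
    + eapply Up; [apply IH; lia|lra]. }
destruct (INR_unbounded (2 * Bc)) as [n0 Hn0].
set (N := (n0 + 4)%nat); destruct (Init N) as [K0 [HK0 HI]].
assert (HAM : 0 <= A * M * sigma ^ 2) by (apply Rmult_le_pos; [nra|apply pow2_ge_0]).
set (K := K0 + 2 * (A * M * sigma ^ 2)).
exists K; split; [unfold K; lra|].
intros m; induction m as [m IH] using (well_founded_induction lt_wf).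
destruct (le_lt_dec m N) as [Hm|Hm]; [eapply Up; [now apply HI|unfold K; lra]|].
destruct m as [|[|n]]; [unfold N in Hm; lia|unfold N in Hm; lia|].
eapply Up; [apply (gevrey_step K n)|].
- unfold K; lra.
- unfold N in Hm; lia.
- intros j Hj; apply IH; lia.
- assert (INR n0 <= INR n) by (apply le_INR; unfold N in Hm; lia).
  assert (Hn : 0 < INR n) by (apply lt_0_INR; unfold N in Hm; lia).
  assert (K * Bc / INR n <= K / 2); [|unfold K in *; lra].
  apply Rle_div_l; [easy|]; assert (0 <= K) by (unfold K; lra); nra.
Qed.

(** The boundary terms vanish, and [omX] is at most a constant times [(n+1)^2]. For [n >= 1] this
    leaves [((n+1) n! (n-1)! / (n! (n+1)!))^2 = 1 / n^2], which is summable. *)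
Lemma gevrey_gauge : (forall n, V n 0 = C0) -> exists M', gauge sigma (omX sigma) (shift V) M'.
Proof.
intros V0; destruct gevrey_solution as [K [HK HL]].
assert (Hq : 0 < q) by now apply Rinv_0_lt_compat.
set (B := 3 * K ^ 2 * q ^ 2 * (1 + q) ^ 2 * 2).
exists (B + 1); apply gauge_of_terms; [now apply chain_shift|unfold B; nra|].
intros n; unfold qterm, shift; rewrite V0.
replace (N2 C0) with 0 by (unfold N2; simpl; ring); rewrite Rmult_0_r, Rplus_0_r.
destruct (HL (S n)) as [CV [_ HI]]; pose proof (cts_N2 _ CV) as CN.
pose proof (pos_INR n) as Hn.
assert (HR : RI (fun x => omX sigma n x * N2 (V (S n) x)) 0 1 <=
  ((1 + q) * (INR n + 1)) ^ 2 * (K * q ^ S n * gev (S n)) ^ 2).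
{ apply Rle_trans with (RI (fun x => ((1 + q) * (INR n + 1)) ^ 2 * N2 (V (S n) x)) 0 1).
  - apply RI_le; try lra.
    + apply cts_mult; [apply omX_cts|easy].
    + apply cts_mult; [apply cts_const|easy].
    + intros x Hx; apply Rmult_le_compat_r; [apply N2_nonneg|].
      unfold omX, Rdiv; fold q.
      assert (0 <= x * q <= q) by nra.
      assert (0 <= INR n * (x * q) <= INR n * q) by nra.
      assert (0 <= INR n * q) by nra.
      assert (1 + INR n * q <= (1 + q) * (INR n + 1)) by nra.
      apply Rle_trans with ((1 + INR n * q) ^ 2); [nra|apply pow_incr; lra].
  - rewrite RI_scal by easy; apply Rmult_le_compat_l; [apply pow2_ge_0|easy]. }
pose proof (wgt_pos sigma n Hsigma) as Hw.
eapply Rle_trans; [apply Rmult_le_compat_l; [lra|exact HR]|].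
unfold wgt, B; rewrite pow_mult.
assert (Hsq : (sigma ^ 2) ^ n * (q ^ n) ^ 2 = 1).
{ rewrite <- !pow_mult, (Nat.mul_comm n 2), <- Rpow_mult_distr.
  unfold q; rewrite Rinv_r by lra; now rewrite pow1. }
pose proof (fact_pos n); pose proof (fact_pos (S n)).
replace ((sigma ^ 2) ^ n / (factR n ^ 2 * factR (S n) ^ 2) *
  (((1 + q) * (INR n + 1)) ^ 2 * (K * q ^ S n * gev (S n)) ^ 2)) with
  ((sigma ^ 2) ^ n * (q ^ n) ^ 2 * (K ^ 2 * q ^ 2 * (1 + q) ^ 2) *
   ((INR n + 1) * gev (S n) / (factR n * factR (S n))) ^ 2) by (change (q ^ S n) with (q * q ^ n); field; lra).
rewrite Hsq.
(* The constant 6 turns [1 / n^2 <= 6 / ((n+1) (n+2))] into an equality at [n = 1]. *)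
assert (Hr : ((INR n + 1) * gev (S n) / (factR n * factR (S n))) ^ 2 <= 6 * / ((INR n + 1) * (INR n + 2))).
{ unfold gev; replace (S n - 1)%nat with n by lia; replace (S n - 2)%nat with (n - 1)%nat by lia.
  destruct n as [|n]; [simpl; lra|].
  replace (S n - 1)%nat with n by lia; rewrite !factR_S, !S_INR.
  pose proof (pos_INR n); pose proof (fact_pos n).
  replace ((INR n + 1 + 1) * ((INR n + 1) * factR n * factR n) /
    ((INR n + 1) * factR n * ((INR n + 1 + 1) * ((INR n + 1) * factR n)))) with (/ (INR n + 1))
    by (field; lra).
  apply Rle_trans with (6 * / (6 * (INR n + 1) ^ 2)); [right; field; lra|].
  apply Rmult_le_compat_l; [lra|]; apply Rinv_le_contravar; [apply Rmult_lt_0_compat; lra|nra]. }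
assert (0 <= K ^ 2 * q ^ 2 * (1 + q) ^ 2)
  by (apply Rmult_le_pos; [apply Rmult_le_pos|]; apply pow2_ge_0).
nra.
Qed.

End GevreySolution.

Lemma gY_L2le sigma F M n : 0 < sigma -> gY sigma F M ->
  L2le (F n) (M * (/ sigma) ^ n * (factR n * factR (S n))).
Proof.
intros Hs HF.
pose proof (gauge_L2 sigma Hs _ (omY_cts sigma) (fun n x => omY_ge1 sigma n x Hs) F M n HF) as H.
destruct HF as [HD [HM _]]; split; [apply HD|].
pose proof (fact_pos n); pose proof (fact_pos (S n)).
assert (Hq : 0 < / sigma) by now apply Rinv_0_lt_compat.
pose proof (pow_lt _ n Hq); split; [repeat apply Rmult_le_pos; lra|].
pose proof (wgt_pos sigma n Hs) as Hw.
apply (Rmult_le_reg_l (wgt sigma n)); [easy|].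
eapply Rle_trans; [exact H|right]; unfold wgt; rewrite pow_inv, pow_mult.
replace ((sigma ^ 2) ^ n) with ((sigma ^ n) ^ 2) by (rewrite <- !pow_mult; f_equal; lia).
pose proof (pow_lt sigma n Hs); field; lra.
Qed.

(** Puts [W] itself in Y, so that [L_s^{-1} W] is available. The factorials give
    [n!^2 / (n! (n+1)!) = 1 / (n+1)], and [Hc] supplies the further decay needed for summability. *)
Lemma gevrey_gY sigma theta c cW WW : 0 < sigma -> 0 < theta < 1 -> 1 <= c -> 0 <= cW ->
  (forall n, theta ^ n * (INR n + 1) <= c) -> chain WW ->
  (forall i x, Cmod (WW i x) <= cW * (theta / sigma) ^ i * factR i ^ 2) ->
  exists M, 0 < M /\ gY sigma WW M.
Proof.
intros Hs Ht Hc1 HcW Hc HW HWb.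
assert (Hq : 0 < / sigma) by now apply Rinv_0_lt_compat.
set (B := 2 * cW ^ 2 * c ^ 2 * (1 + / sigma + sigma)).
assert (HB : 0 <= B).
{ pose proof (pow2_ge_0 cW); pose proof (pow2_ge_0 c).
  unfold B; repeat apply Rmult_le_pos; lra. }
exists (B + 1); split; [lra|]; apply gauge_of_terms; auto.
intros n; pose proof (pos_INR n) as Hn; pose proof (fact_pos n) as Hf.
pose proof (pow_lt theta n (proj1 Ht)) as Htn; pose proof (pow_lt sigma n Hs) as Hsn.
set (m := cW * (theta / sigma) ^ n * factR n ^ 2).
assert (Hm : forall x, N2 (WW n x) <= m ^ 2).
{ intros x; rewrite <- Cmod_sq; apply pow_incr; split; [apply Cmod_nonneg|apply HWb]. }
assert (HR : RI (fun x => omY sigma n x * N2 (WW n x)) 0 1 <= (1 + / sigma) * (INR n + 1) * m ^ 2).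
{ replace ((1 + / sigma) * (INR n + 1) * m ^ 2) with
    (RI (fun _ => (1 + / sigma) * (INR n + 1) * m ^ 2) 0 1) by (rewrite RI_const; ring).
  apply RI_le; try lra.
  - apply cts_mult; [apply omY_cts|apply cts_N2, HW].
  - apply cts_const.
  - intros x Hx; apply Rmult_le_compat.
    + pose proof (omY_ge1 sigma n x Hs Hx); lra.
    + apply N2_nonneg.
    + unfold omY, Rdiv; assert (0 <= x * / sigma <= / sigma) by nra; nra.
    + apply Hm. }
specialize (Hm 0).
unfold qterm; pose proof (wgt_pos sigma n Hs) as Hw.
assert (Eb : bwgt sigma n = wgt sigma n * sigma).
{ unfold bwgt, wgt; rewrite pow_add, pow_1; unfold Rdiv; ring. }
rewrite Eb.
apply Rle_trans with (wgt sigma n * ((1 + / sigma) * (INR n + 1) * m ^ 2) + wgt sigma n * sigma * m ^ 2).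
{ apply Rplus_le_compat; apply Rmult_le_compat_l; nra. }
apply Rle_trans with (wgt sigma n * m ^ 2 * ((1 + / sigma + sigma) * (INR n + 1))).
{ assert (0 <= wgt sigma n * m ^ 2) by (apply Rmult_le_pos; [lra|apply pow2_ge_0]).
  assert (0 <= wgt sigma n * m ^ 2 * (sigma * INR n)) by (apply Rmult_le_pos; nra).
  nra. }
assert (Em : wgt sigma n * m ^ 2 = cW ^ 2 * (theta ^ n * / (INR n + 1)) ^ 2).
{ unfold wgt, m; rewrite factR_S, pow_mult; unfold Rdiv; rewrite (Rpow_mult_distr theta), pow_inv.
  replace ((sigma ^ 2) ^ n) with ((sigma ^ n) ^ 2) by (rewrite <- !pow_mult; f_equal; lia).
  field; lra. }
rewrite Em; specialize (Hc n).
assert (Hc2 : (theta ^ n) ^ 2 * (INR n + 1) ^ 2 <= c ^ 2).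
{ rewrite <- Rpow_mult_distr; apply pow_incr; split; [|easy]; apply Rmult_le_pos; lra. }
apply Rle_trans with (cW ^ 2 * (1 + / sigma + sigma) * ((theta ^ n) ^ 2 * (INR n + 1) ^ 2) * / (INR n + 1) ^ 3).
{ right; field; lra. }
assert (H3 : / (INR n + 1) ^ 3 <= 2 * / ((INR n + 1) * (INR n + 2))).
{ apply Rle_trans with (2 * / (2 * (INR n + 1) ^ 3)); [right; field; lra|].
  apply Rmult_le_compat_l; [lra|]; apply Rinv_le_contravar; [apply Rmult_lt_0_compat; lra|].
  nra. }
assert (H4 : 0 < / (INR n + 1) ^ 3) by (apply Rinv_0_lt_compat, pow_lt; lra).
assert (H5 : 0 <= cW ^ 2 * (1 + / sigma + sigma)) by (apply Rmult_le_pos; [apply pow2_ge_0|lra]).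
replace (B * / ((INR n + 1) * (INR n + 2))) with
  (cW ^ 2 * (1 + / sigma + sigma) * c ^ 2 * (2 * / ((INR n + 1) * (INR n + 2)))) by (unfold B; ring).
apply Rmult_le_compat; try lra.
- apply Rmult_le_pos; [easy|]; apply Rmult_le_pos; apply pow2_ge_0.
- apply Rmult_le_compat_l; lra.
Qed.

(** * Energy estimate *)

Lemma is_derive_N2 h x l : isd h x l ->
  is_derive (fun y => N2 (h y)) x (2 * (Re (h x) * Re l + Im (h x) * Im l)).
Proof.
intros [H1 H2].
replace (2 * (Re (h x) * Re l + Im (h x) * Im l)) with
  (INR 2 * Re l * Re (h x) ^ 1 + INR 2 * Im l * Im (h x) ^ 1) by (simpl; ring).
apply (is_derive_plus (fun y => Re (h y) ^ 2) (fun y => Im (h y) ^ 2));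
  [apply (is_derive_pow (fun y => Re (h y)) 2)|apply (is_derive_pow (fun y => Im (h y)) 2)]; auto.
Qed.

(** Gronwall's inequality for [|v|^2 + |v'|^2] with zero data at 0. The constant is chosen before
    [s] and depends only on [d] and the bounds for [W] and [s], hence is uniform near [s0]. *)
Lemma energy_estimate d bW S0 : 0 < d -> 0 <= bW -> 0 <= S0 -> exists C, 0 <= C /\
  forall (WW F V : fseq) (s : Cx), chain V -> cfun2 (F 0%nat) ->
    (forall x, Cmod (WW 0%nat x) <= bW) -> Cmod s <= S0 ->
    V 0%nat 0 = C0 -> V 1%nat 0 = C0 ->
    (forall x, V 2%nat x = Cmul (RtoC (ainv d x)) (rhs WW F s 0 V (clamp x) x)) ->
    (forall x, 0 <= x <= 1 -> N2 (V 0%nat x) + N2 (V 1%nat x) <= C * RI (fun x => N2 (F 0%nat x)) 0 1) /\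
    RI (fun x => N2 (V 2%nat x)) 0 1 <= C * RI (fun x => N2 (F 0%nat x)) 0 1.
Proof.
intros Hd HbW HS.
set (A := / (d / 2) ^ 2); assert (HA : 0 < A) by (apply Rinv_0_lt_compat, pow_lt; lra).
(* These give [|v''|^2 <= G |f|^2 + P E]: [A] bounds [ainv], [2 + S0] bounds [2 x + s], and 3 comes
   from squaring a sum of three terms. [B] is the Gronwall rate, from [E' <= 2 E + |v''|^2]. *)
set (G := 3 * A ^ 2); set (P := G * ((2 + S0) ^ 2 + bW ^ 2)); set (B := 2 + P).
assert (HG : 0 <= G) by (unfold G; pose proof (pow2_ge_0 A); lra).
assert (HP : 0 <= P).
{ apply Rmult_le_pos; [easy|]; pose proof (pow2_ge_0 (2 + S0)); pose proof (pow2_ge_0 bW); lra. }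
set (C1 := exp B * G); assert (HC1 : 0 <= C1) by (apply Rmult_le_pos; [apply Rlt_le, exp_pos|easy]).
exists (C1 + (G + P * C1)); split; [nra|].
intros WW F V s HV HF HW Hs V00 V10 Hrec.
pose proof (cts_N2 _ HF) as CF.
set (I := RI (fun x => N2 (F 0%nat x)) 0 1).
assert (HI : 0 <= I) by (apply RI_nonneg; auto; try lra; intros; apply N2_nonneg).
assert (H2 : forall x, N2 (V 2%nat x) <= G * N2 (F 0%nat x) + P * (N2 (V 0%nat x) + N2 (V 1%nat x))).
{ intros x; rewrite Hrec; unfold rhs; simpl INR; cbn [Leib].
  pose proof (ainv_bound d x Hd) as [a0 a1]; fold A in a1.
  pose proof (clamp_range x) as Hx.
  rewrite N2_mul.
  assert (Na : N2 (RtoC (ainv d x)) <= A ^ 2).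
  { unfold N2; simpl; nra. }
  set (f := Cmod (F 0%nat x)); set (v0 := Cmod (V 0%nat x)); set (v1 := Cmod (V 1%nat x)).
  assert (Hf : 0 <= f) by apply Cmod_nonneg; assert (Hv0 : 0 <= v0) by apply Cmod_nonneg.
  assert (Hv1 : 0 <= v1) by apply Cmod_nonneg.
  assert (M : Cmod (Cadd (Csub (Csub (F 0%nat x)
     (Cmul (Cadd (RtoC (2 * (0 + 1) * clamp x)) s) (V 1%nat x)))
     (Cmul (RtoC (0 * (0 + 1))) (V 0%nat x))) (Cmul (WW 0%nat x) (V 0%nat x)))
    <= f + (2 + S0) * v1 + bW * v0).
  { eapply Rle_trans; [apply Cmod_triangle|].
    eapply Rle_trans; [apply Rplus_le_compat_r, Cmod_sub|].
    eapply Rle_trans; [apply Rplus_le_compat_r, Rplus_le_compat_r, Cmod_sub|].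
    rewrite !Cmod_mul; fold f v0 v1.
    rewrite (Cmod_RtoC (0 * (0 + 1))), Rmult_0_l, Rabs_R0.
    assert (Cmod (Cadd (RtoC (2 * (0 + 1) * clamp x)) s) <= 2 + S0).
    { eapply Rle_trans; [apply Cmod_triangle|]; rewrite Cmod_RtoC, Rabs_right; lra. }
    specialize (HW x).
    assert (Cmod (Cadd (RtoC (2 * (0 + 1) * clamp x)) s) * v1 <= (2 + S0) * v1)
      by (apply Rmult_le_compat_r; lra).
    assert (Cmod (WW 0%nat x) * v0 <= bW * v0) by (apply Rmult_le_compat_r; lra).
    lra. }
  match goal with |- _ * N2 ?z <= _ => set (z0 := z) in * end.
  assert (Nz : N2 z0 <= 3 * (f ^ 2 + (2 + S0) ^ 2 * v1 ^ 2 + bW ^ 2 * v0 ^ 2)).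
  { rewrite <- Cmod_sq; apply Rle_trans with ((f + (2 + S0) * v1 + bW * v0) ^ 2).
    - apply pow_incr; split; [apply Cmod_nonneg|exact M].
    - set (y1 := (2 + S0) * v1); set (y2 := bW * v0).
      replace ((2 + S0) ^ 2 * v1 ^ 2) with (y1 ^ 2) by (unfold y1; ring).
      replace (bW ^ 2 * v0 ^ 2) with (y2 ^ 2) by (unfold y2; ring).
      pose proof (pow2_ge_0 (f - y1)); pose proof (pow2_ge_0 (f - y2)); pose proof (pow2_ge_0 (y1 - y2)).
      nra. }
  rewrite <- (Cmod_sq (F 0%nat x)), <- (Cmod_sq (V 0%nat x)), <- (Cmod_sq (V 1%nat x)); fold f v0 v1.
  apply Rle_trans with (A ^ 2 * (3 * (f ^ 2 + (2 + S0) ^ 2 * v1 ^ 2 + bW ^ 2 * v0 ^ 2))).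
  - apply Rmult_le_compat; auto using N2_nonneg.
  - replace (A ^ 2 * (3 * (f ^ 2 + (2 + S0) ^ 2 * v1 ^ 2 + bW ^ 2 * v0 ^ 2))) with
      (G * (f ^ 2 + (2 + S0) ^ 2 * v1 ^ 2 + bW ^ 2 * v0 ^ 2)) by (unfold G; ring).
    unfold P.
    assert (0 <= G * (bW ^ 2 * v1 ^ 2)) by (apply Rmult_le_pos; [easy|apply Rmult_le_pos; apply pow2_ge_0]).
    assert (0 <= G * ((2 + S0) ^ 2 * v0 ^ 2)) by (apply Rmult_le_pos; [easy|apply Rmult_le_pos; apply pow2_ge_0]).
    nra. }
set (E := fun x => N2 (V 0%nat x) + N2 (V 1%nat x)) in *.
assert (HE : forall x, 0 <= E x) by (intros; unfold E; pose proof (N2_nonneg (V 0%nat x)); pose proof (N2_nonneg (V 1%nat x)); lra).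
set (E' := fun x => 2 * (Re (V 0%nat x) * Re (V 1%nat x) + Im (V 0%nat x) * Im (V 1%nat x)) +
                    2 * (Re (V 1%nat x) * Re (V 2%nat x) + Im (V 1%nat x) * Im (V 2%nat x))).
assert (HE' : forall x, E' x <= B * E x + G * N2 (F 0%nat x)).
{ intros x; specialize (H2 x); fold (E x) in H2; unfold B.
  apply Rle_trans with (2 * E x + N2 (V 2%nat x)); [|lra].
  unfold E', E, N2.
  pose proof (pow2_ge_0 (Re (V 0%nat x) - Re (V 1%nat x))); pose proof (pow2_ge_0 (Im (V 0%nat x) - Im (V 1%nat x))).
  pose proof (pow2_ge_0 (Re (V 1%nat x) - Re (V 2%nat x))); pose proof (pow2_ge_0 (Im (V 1%nat x) - Im (V 2%nat x))).
  pose proof (pow2_ge_0 (Re (V 0%nat x))); pose proof (pow2_ge_0 (Im (V 0%nat x))).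
  nra. }
assert (CE : cts E) by (apply cts_plus; apply cts_N2, HV).
assert (Cexp : cts (fun x => exp (- B * x))).
{ intros y; apply (continuous_comp (fun y => - B * y) exp).
  - apply (continuous_mult (fun _ => - B) (fun y => y)); [apply continuous_const|apply continuous_id].
  - apply continuity_pt_filterlim, derivable_continuous_pt, derivable_pt_exp. }
assert (Dexp : forall x, is_derive (fun x => exp (- B * x)) x (- B * exp (- B * x))).
{ intros x; apply is_derive_Reals.
  replace (- B * exp (- B * x)) with (exp (- B * x) * (- B * 1)) by ring.
  apply (derivable_pt_lim_comp (fun y => - B * y) exp x).
  - apply derivable_pt_lim_scal, derivable_pt_lim_id.
  - apply derivable_pt_lim_exp. }
assert (Bnd : forall x, 0 <= x <= 1 -> E x <= C1 * I).
{ intros x Hx.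
  (* With the integrating factor, [h] is nonincreasing and starts at 0. *)
  set (h := fun y => E y * exp (- B * y) - G * RI (fun x => N2 (F 0%nat x)) 0 y).
  destruct (MVT_gen h 0 x (fun y => E' y * exp (- B * y) + E y * (- B * exp (- B * y)) - G * N2 (F 0%nat y)))
    as [c [Hc Hmv]].
  - intros y Hy; rewrite Rmin_left, Rmax_right in Hy by lra.
    apply (is_derive_minus (fun y => E y * exp (- B * y)) (fun y => G * RI (fun x => N2 (F 0%nat x)) 0 y)).
    + apply (is_derive_multR E (fun y => exp (- B * y)) y (E' y)); [|apply Dexp].
      apply (is_derive_plus (fun y => N2 (V 0%nat y)) (fun y => N2 (V 1%nat y)));
        apply is_derive_N2, der2_isd; try apply HV; lra.
    + apply is_derive_scal; now apply is_derive_RI.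
  - intros y _; apply continuity_pt_filterlim.
    apply (continuous_minus (fun y => E y * exp (- B * y)) (fun y => G * RI (fun x => N2 (F 0%nat x)) 0 y)).
    + apply (cts_mult E); auto.
    + apply (continuous_mult (fun _ => G)); [apply continuous_const|now apply RI_continuous].
  - rewrite Rmin_left, Rmax_right in Hc by lra.
    unfold h in Hmv; rewrite RI_point in Hmv.
    replace (E 0) with 0 in Hmv by (unfold E; rewrite V00, V10; unfold N2; simpl; ring).
    specialize (HE' c); pose proof (N2_nonneg (F 0%nat c)) as HFc.
    assert (Hec : 0 < exp (- B * c) <= 1).
    { split; [apply exp_pos|]; rewrite <- exp_0.
      destruct (Req_dec (- B * c) 0) as [->|]; [lra|].
      left; apply exp_increasing; unfold B in *; nra. }
    assert (Hneg : E' c * exp (- B * c) + E c * (- B * exp (- B * c)) - G * N2 (F 0%nat c) <= 0).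
    { assert (0 <= G * N2 (F 0%nat c)) by now apply Rmult_le_pos.
      assert ((E' c - B * E c) * exp (- B * c) <= G * N2 (F 0%nat c) * exp (- B * c))
        by (apply Rmult_le_compat_r; lra).
      nra. }
    assert (HIx : RI (fun x => N2 (F 0%nat x)) 0 x <= I).
    { apply RI_sub_le; auto; try lra; intros; apply N2_nonneg. }
    assert (Hex : E x * exp (- B * x) <= G * I) by nra.
    assert (E1 : exp (- B * x) * exp (B * x) = 1) by (rewrite <- exp_plus, <- exp_0; f_equal; ring).
    assert (E2 : exp (B * x) <= exp B).
    { destruct (Req_dec (B * x) B) as [->|]; [lra|]; left; apply exp_increasing.
      assert (0 <= B) by (unfold B; lra); nra. }
    pose proof (exp_pos (B * x)).
    replace (E x) with (E x * exp (- B * x) * exp (B * x)) by (rewrite Rmult_assoc, E1; ring).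
    apply Rle_trans with (G * I * exp (B * x)); [apply Rmult_le_compat_r; lra|].
    assert (0 <= G * I) by now apply Rmult_le_pos.
    unfold C1; nra. }
split.
- intros x Hx; fold (E x); specialize (Bnd x Hx).
  assert (0 <= (G + P * C1) * I) by (apply Rmult_le_pos; [nra|easy]); lra.
- apply Rle_trans with (RI (fun x => G * N2 (F 0%nat x) + P * (C1 * I)) 0 1).
  + apply RI_le; try lra.
    * apply cts_N2, HV.
    * apply cts_plus; [apply cts_mult|]; auto using cts_const.
    * intros x Hx; eapply Rle_trans; [apply H2|]; apply Rplus_le_compat_l, Rmult_le_compat_l; [easy|].
      now apply Bnd.
  + rewrite RI_plus, RI_scal, RI_const; auto using cts_const; [fold I; nra|].
    apply cts_mult; auto using cts_const.
Qed.

(** * Invertibility and the final estimate *)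

Lemma Lop_LL W s u U x : chain U -> (forall x, 0 <= x <= 1 -> U 0%nat x = u x) -> 0 <= x <= 1 ->
  Lop W s u x = LL W s U x.
Proof.
intros HU H0 Hx; unfold Lop, LL.
now rewrite !(chain_dseq U u HU H0), H0.
Qed.

Lemma cl_0 u x : smooth01 u -> 0 <= x <= 1 -> cl u 0%nat x = u x.
Proof. intros Hs Hx; rewrite <- cl_dseq, smooth_dseq0; auto. Qed.

Lemma solves_cl W s u F : smooth01 u -> eq01 (Lop W s u) (F 0%nat) -> solves W s (cl u) F.
Proof.
intros Hs H x Hx; rewrite <- (H x Hx); symmetry; apply Lop_LL; auto using chain_cl.
intros; now apply cl_0.
Qed.

Section Invertibility.
Context (sigma : R) (Hsigma : 0 < sigma) (W : R -> Cx) (s : Cx).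

Lemma gX_inD U F M M' u : gX sigma U M -> gY sigma F M' -> solves W s U F ->
  (forall x, 0 <= x <= 1 -> U 0%nat x = u x) -> inD sigma W s u /\ eq01 (Lop W s u) (F 0%nat).
Proof.
intros HU HF HS H0.
assert (E : eq01 (Lop W s u) (F 0%nat)).
{ intros x Hx; rewrite (Lop_LL W s u U); auto; apply HU. }
split; [split|exact E].
- now apply (gX_inX sigma Hsigma U M).
- apply (gY_inY sigma Hsigma F M'); auto; intros; symmetry; auto.
Qed.

Lemma invertible_solvable : L_invertible sigma W s ->
  forall F M, gY sigma F M -> exists U M', gX sigma U M' /\ solves W s U F.
Proof.
intros [Hex _] F M HF; destruct (Hex (F 0%nat)) as [u [[Hu _] E]].
{ now apply (gY_inY sigma Hsigma F M). }
destruct (inX_gX sigma Hsigma u Hu) as [M' HU].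
exists (cl u), M'; split; [exact HU|]; apply solves_cl; [apply Hu|exact E].
Qed.

(** Uniqueness is stated for values on [0,1]; comparison with the zero function and [chain_unique]
    extend it to all orders. *)
Lemma invertible_injective : L_invertible sigma W s ->
  forall U M, gX sigma U M -> solves W s U Tzero -> U = Tzero.
Proof.
intros [_ Hun] U M HU HS.
pose proof (gauge_zero sigma _ (omY_cts sigma) 0 (Rle_refl 0)) as H0.
destruct (gX_inD U Tzero M 0 (U 0%nat) HU H0 HS) as [D1 E1]; [easy|].
destruct (gX_inD Tzero Tzero 0 0 (Tzero 0%nat) (gX_zero sigma 0 (Rle_refl 0)) H0 (solves_zero W s))
  as [D2 E2]; [easy|].
apply chain_unique; [apply HU|apply chain_zero|].
intros x Hx; apply (Hun _ _ D1 D2); [|lra].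
intros y Hy; now rewrite E1, E2.
Qed.

Lemma invertible_of_gauge :
  (forall F M, gY sigma F M -> exists U M', gX sigma U M' /\ solves W s U F) ->
  (forall U M, gX sigma U M -> solves W s U Tzero -> U = Tzero) -> L_invertible sigma W s.
Proof.
intros Hex Hun; split.
- intros f Hf; destruct (inY_gY sigma Hsigma f Hf) as [M HF].
  destruct (Hex (cl f) M HF) as [U [M' [HU HS]]].
  destruct (gX_inD U (cl f) M' M (U 0%nat) HU HF HS) as [D E]; [easy|].
  exists (U 0%nat); split; [exact D|]; intros x Hx; rewrite (E x Hx); apply cl_0; auto; apply Hf.
- intros u1 u2 [X1 _] [X2 _] E x Hx.
  destruct (inX_gX sigma Hsigma u1 X1) as [M1 H1]; destruct (inX_gX sigma Hsigma u2 X2) as [M2 H2].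
  assert (Z : Tsub (cl u1) (cl u2) = Tzero).
  { eapply Hun; [apply gX_sub; eassumption|].
    intros y Hy; unfold Tsub; rewrite LL_add, LL_scal.
    rewrite <- (Lop_LL W s u1), <- (Lop_LL W s u2), E; auto using chain_cl.
    - unfold Tzero; apply Ceq; simpl; ring.
    - apply H2.
    - intros; apply cl_0; auto; apply X2.
    - apply H1.
    - intros; apply cl_0; auto; apply X1. }
  assert (Zx : Tsub (cl u1) (cl u2) 0%nat x = C0) by now rewrite Z.
  unfold Tsub, Tadd, Tscal in Zx; rewrite !cl_0 in Zx by (auto; first [apply X1|apply X2]).
  injection Zx; intros; apply Ceq; lra.
Qed.

End Invertibility.

(** The hypothesis bounds the derivatives on (0,1); continuity carries the bound to the end points
    and the constant extension. *)
Lemma gevrey_bound W sigma_star : gevrey sigma_star 2 W -> 0 < sigma_star ->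
  exists cW, 0 <= cW /\ forall i x, Cmod (cl W i x) <= cW * (/ sigma_star) ^ i * factR i ^ 2.
Proof.
intros [Hs [cW [HcW H]]] Hss; exists cW; split; [lra|]; intros i x.
assert (Hm : 0 <= cW * (/ sigma_star) ^ i * factR i ^ 2).
{ apply Rmult_le_pos; [apply Rmult_le_pos; [lra|]|apply pow2_ge_0].
  apply pow_le, Rlt_le, Rinv_0_lt_compat, Hss. }
apply Cmod_N2_le; [easy|].
destruct (chain_cl W Hs i) as [[C1 C2] _].
apply (cfun_le_closed (fun x => N2 (cl W i x))).
- unfold N2; apply cfun_plus; simpl; apply cfun_mult; auto; apply cfun_mult; auto using cfun_const.
- intros y Hy; rewrite <- Cmod_sq; apply pow_incr; split; [apply Cmod_nonneg|].
  rewrite <- cl_dseq by lra; now apply H.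
Qed.

(** Up to [d] both sides vanish; beyond it [ainv] is [1 / x^2] and the recursion at order 0 is the
    equation divided by [x^2]. *)
Lemma local_solution_solves W F V s d : smooth01 W -> 0 < d <= 1 -> (forall n, vanish d (F n)) ->
  (forall n, vanish d (V n)) ->
  (forall x, V 2%nat x = Cmul (RtoC (ainv d x)) (rhs (cl W) F s 0 V (clamp x) x)) ->
  solves W s V F.
Proof.
intros HW Hd HF HV Hrec x Hx; unfold LL; destruct (Rle_dec x d) as [Hxd|Hxd].
- rewrite !HV, HF by (rewrite clamp_id; lra); apply Ceq; simpl; ring.
- rewrite Hrec, ainv_eq, clamp_id by lra; unfold rhs; cbn [Leib]; rewrite cl_0 by easy.
  apply Ceq; simpl; field; lra.
Qed.

Lemma H2norm_RI u : smooth01 u -> H2norm u = sqrt (RI (fun x => N2 (cl u 0%nat x)) 0 1 +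
  RI (fun x => N2 (cl u 1%nat x)) 0 1 + RI (fun x => N2 (cl u 2%nat x)) 0 1).
Proof.
intros Hs; unfold H2norm; f_equal.
assert (C : forall n, cts (fun x => N2 (cl u n x))) by (intros; apply cts_N2, chain_cl, Hs).
rewrite <- !RI_plus by auto using cts_plus; apply RInt01_RI; [auto using cts_plus|].
intros x Hx; now rewrite !Cmod_sq, cl_0, <- !cl_dseq.
Qed.

Lemma L2norm_RI f : smooth01 f -> L2norm f = sqrt (RI (fun x => N2 (cl f 0%nat x)) 0 1).
Proof.
intros Hs; unfold L2norm; f_equal; apply RInt01_RI; [apply cts_N2, chain_cl, Hs|].
intros x Hx; now rewrite Cmod_sq, cl_0.
Qed.

Section MainEstimate.
Context (W : R -> Cx) (sigma theta c cW d Cinv MW S0 : R).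
Context (HWs : smooth01 W) (Hsigma : 0 < sigma) (Ht : 0 < theta < 1) (HcW : 0 <= cW) (Hd : 0 < d <= 1).
Context (Hc1 : 1 <= c) (Hc : forall n, theta ^ n * (INR n + 1) <= c) (HS0 : 0 <= S0).
Context (HWb : forall i x, Cmod (cl W i x) <= cW * (theta / sigma) ^ i * factR i ^ 2).
Context (HMW : 0 < MW) (HWY : gY sigma (cl W) MW) (HCinv : 0 < Cinv).

(* The solution [v] supported in [[d, 1]] need not vanish at [1]; the defect [v 1] is corrected by
   [L_s^{-1} W], whose size is controlled by the bounded inverse. *)
Lemma H2_estimate : exists C, forall s : Cx, Cmod s <= S0 ->
  (forall F M, 0 < M -> gY sigma F M -> exists U, gX sigma U (Cinv * M) /\ solves W s U F) ->
  (forall U M, gX sigma U M -> solves W s U Tzero -> U = Tzero) ->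
  forall f u, inY sigma f -> (forall x, 0 <= x < d -> f x = C0) ->
    inX sigma u -> eq01 (Lop W s u) f -> H2norm u <= C * L2norm f.
Proof.
assert (HcWb : forall x, Cmod (cl W 0%nat x) <= cW).
{ intros x; eapply Rle_trans; [apply HWb|]; simpl; lra. }
destruct (energy_estimate d cW S0) as [C1 [HC1 Hen]]; try lra.
(* Bound for [w], [w'] and [w''], where [w = L_s^{-1} W], through the embedding constants of orders
   0 to 2. *)
set (b := (sobX sigma 0 + sobX sigma 1 + sobX sigma 2) * (Cinv * MW)).
(* For each order up to 2, [|u^(n)|^2 <= 2 |v^(n)|^2 + 2 (1 + b)^2 |v(1)|^2]. The energy estimate
   bounds the first parts by [2 * 2 * C1], and the three corrections give
   [3 * 2 * (1 + b)^2 * C1]. *)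
exists (sqrt (C1 * (4 + 6 * (1 + b) ^ 2))).
intros s Hs Hinv Huniq f u Hf Hf0 Hu Heq.
pose proof (proj1 Hf) as Hfs; pose proof (proj1 Hu) as Hus.
destruct (inY_gY sigma Hsigma f Hf) as [M HF]; pose proof (gauge_chain _ _ _ _ HF) as HFc.
destruct (inX_gX sigma Hsigma u Hu) as [MU HU].
pose proof (chain_cl W HWs) as HWc.
assert (HFv : forall n, vanish d (cl f n)).
{ apply chain_vanish; auto; intros x Hx; rewrite cl_0 by (auto; lra); auto. }
destruct (local_solution (cl W) (cl f) s d HWc HFc Hd HFv) as [V [HV [HVv Hrec]]].
assert (HV0 : forall n, V n 0 = C0) by (intros n; apply HVv; rewrite clamp_id; lra).
destruct (gevrey_gauge (cl W) (cl f) V s d sigma theta cW c M) as [MV HVg]; auto; try lra.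
{ apply HF. }
{ intros n; now apply gY_L2le. }
destruct (Hen (cl W) (cl f) V s HV) as [En1 En2]; auto.
{ apply HFc. }
assert (HVs : solves W s V (cl f)) by now apply (local_solution_solves W (cl f) V s d).
destruct (Hinv (cl W) MW HMW HWY) as [w [Hw Hws]].
assert (HUs : solves W s (cl u) (cl f)).
{ apply solves_cl; auto; intros x Hx; rewrite (Heq x Hx); symmetry; now apply cl_0. }
set (k := V 0%nat 1).
set (psi := Tadd (Tsub (cl u) V) (Tconst k)).
assert (HX : gX sigma psi (MU + MV)).
{ split; [|split].
  - apply chain_add; [apply chain_sub; auto using chain_cl|apply chain_const].
  - unfold psi, Tsub, Tadd, Tscal; rewrite (proj1 (proj2 HU)); fold k; apply Ceq; simpl; ring.
  - replace (shift psi) with (Tsub (shift (cl u)) (shift V)).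
    + apply gauge_sub; auto using omX_cts; [intros; now apply omX_ge1|apply HU].
    + unfold psi, shift; teq. }
assert (Z : Tadd psi (Tscal k w) = Tzero).
{ eapply Huniq; [apply gX_add; [easy|exact HX|apply gX_scal; exact Hw]|].
  intros x Hx; rewrite LL_add, LL_scal, (Hws x Hx), (cl_0 W) by auto.
  unfold psi, Tsub; rewrite !LL_add, LL_scal, (HUs x Hx), (HVs x Hx).
  unfold LL, Tconst, Tzero; apply Ceq; simpl; ring. }
set (I := RI (fun x => N2 (cl f 0%nat x)) 0 1) in *.
assert (HI : 0 <= I) by (apply RI_nonneg; [apply cts_N2, HFc|lra|intros; apply N2_nonneg]).
assert (Hk : N2 k <= C1 * I).
{ pose proof (En1 1 ltac:(lra)); pose proof (N2_nonneg (V 1%nat 1)); unfold k; lra. }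
pose proof (sobX_nonneg sigma 0); pose proof (sobX_nonneg sigma 1); pose proof (sobX_nonneg sigma 2).
assert (HCM : 0 < Cinv * MW) by now apply Rmult_lt_0_compat.
assert (Hb : 0 <= b) by (apply Rmult_le_pos; lra).
assert (Hwb : forall n x, (n <= 2)%nat -> Cmod (w n x) <= b).
{ intros n x Hn; eapply Rle_trans; [apply (gX_sup sigma Hsigma w _ Hw)|].
  apply Rmult_le_compat_r; [lra|].
  destruct n as [|[|[|n]]]; [lra|lra|lra|lia]. }
assert (HUb : forall n x, (n <= 2)%nat ->
  N2 (cl u n x) <= 2 * N2 (V n x) + 2 * (1 + b) ^ 2 * (C1 * I)).
{ intros n x Hn.
  assert (E : cl u n x = Cadd (V n x) (Csub (Copp (Tconst k n x)) (Cmul k (w n x)))).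
  { assert (Zx : Tadd psi (Tscal k w) n x = C0) by now rewrite Z.
    unfold psi, Tsub, Tadd, Tscal in Zx; injection Zx; simpl; intros Z1 Z2.
    apply Ceq; simpl; lra. }
  rewrite E; pose proof (N2_add 1 (V n x) (Csub (Copp (Tconst k n x)) (Cmul k (w n x))) Rlt_0_1) as H3.
  rewrite Rinv_1 in H3.
  assert (H4 : N2 (Csub (Copp (Tconst k n x)) (Cmul k (w n x))) <= (1 + b) ^ 2 * N2 k).
  { rewrite <- !Cmod_sq, <- Rpow_mult_distr; apply pow_incr; split; [apply Cmod_nonneg|].
    eapply Rle_trans; [apply Cmod_sub|]; rewrite Cmod_opp, Cmod_mul.
    specialize (Hwb n x Hn); pose proof (Cmod_nonneg k).
    assert (Cmod (Tconst k n x) <= Cmod k).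
    { destruct n; simpl; [lra|].
      replace (Cmod C0) with 0; [easy|]; change C0 with (RtoC 0); now rewrite Cmod_RtoC, Rabs_R0. }
    nra. }
  assert ((1 + b) ^ 2 * N2 k <= (1 + b) ^ 2 * (C1 * I)) by (apply Rmult_le_compat_l; [apply pow2_ge_0|easy]).
  lra. }
assert (HRI : forall n, (n <= 2)%nat -> RI (fun x => N2 (cl u n x)) 0 1 <=
  2 * RI (fun x => N2 (V n x)) 0 1 + 2 * (1 + b) ^ 2 * (C1 * I)).
{ intros n Hn.
  apply Rle_trans with (RI (fun x => 2 * N2 (V n x) + 2 * (1 + b) ^ 2 * (C1 * I)) 0 1).
  - apply RI_le; try lra; [apply cts_N2, chain_cl, Hus| |intros; now apply HUb].
    apply cts_plus; [apply cts_mult; [apply cts_const|apply cts_N2, HV]|apply cts_const].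
  - rewrite RI_plus, RI_scal, RI_const; auto using cts_const; [lra|apply cts_N2, HV|].
    apply cts_mult; [apply cts_const|apply cts_N2, HV]. }
assert (H01 : RI (fun x => N2 (V 0%nat x)) 0 1 + RI (fun x => N2 (V 1%nat x)) 0 1 <= C1 * I).
{ rewrite <- RI_plus by apply cts_N2, HV.
  replace (C1 * I) with (RI (fun _ => C1 * I) 0 1) by (rewrite RI_const; ring).
  apply RI_le; auto using cts_const; [|lra].
  apply cts_plus; apply cts_N2, HV. }
rewrite H2norm_RI, L2norm_RI by auto; fold I.
rewrite <- sqrt_mult; auto.
- apply sqrt_le_1_alt.
  pose proof (HRI 0%nat ltac:(lia)); pose proof (HRI 1%nat ltac:(lia)); pose proof (HRI 2%nat ltac:(lia)).
  lra.
- apply Rmult_le_pos; [easy|]; pose proof (pow2_ge_0 (1 + b)); lra.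
Qed.

End MainEstimate.

Theorem mainTheorem16 (W : R -> Cx) (sigma_star sigma delta : R) (s0 : Cx) :
  gevrey sigma_star 2 W ->
  0 < sigma -> sigma < sigma_star ->
  Omega sigma s0 ->
  L_invertible sigma W s0 ->
  delta > 0 ->
  exists r, r > 0 /\
  exists C, forall s : Cx, Cmod (Csub s s0) < r ->
    Omega sigma s /\ L_invertible sigma W s /\
    (forall f u, inY sigma f -> (forall x, 0 <= x < delta -> f x = C0) ->
       inD sigma W s u -> eq01 (Lop W s u) f ->
       H2norm u <= C * L2norm f).
Proof.
intros HW Hs Hss HO Hinv Hdelta.
pose proof (proj1 HW) as HWs.
assert (Hss0 : 0 < sigma_star) by lra.
destruct (gevrey_bound W sigma_star HW Hss0) as [cW [HcW HWb]].
set (theta := sigma / sigma_star).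
assert (Ht : 0 < theta < 1).
{ split; [apply Rdiv_lt_0_compat; lra|]; apply Rlt_div_l; lra. }
assert (HWb' : forall i x, Cmod (cl W i x) <= cW * (theta / sigma) ^ i * factR i ^ 2).
{ intros i x; replace (theta / sigma) with (/ sigma_star) by (unfold theta; field; lra); apply HWb. }
destruct (geometric_linear_bound theta Ht) as [c [Hc1 Hc]].
destruct (gevrey_gY sigma theta c cW (cl W)) as [MW [HMW HWY]]; auto using chain_cl.
destruct (bounded_inverse sigma Hs W s0 (invertible_solvable sigma Hs W s0 Hinv)) as [C [HC Hsol]].
pose proof (invertible_injective sigma Hs W s0 Hinv) as Huniq.
destruct (Omega_open sigma s0 Hs HO) as [r1 [Hr1 HO1]].
(* For [delta > 1] only the vanishing on [0,1) is retained, so that [d] lies in the unit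
   interval. *)
set (d := Rmin delta 1).
assert (Hd : 0 < d <= 1) by (split; [apply Rmin_pos; lra|apply Rmin_r]).
assert (HS0 : 0 <= Cmod s0 + 1) by (pose proof (Cmod_nonneg s0); lra).
destruct (H2_estimate W sigma theta c cW d (2 * C) MW (Cmod s0 + 1)) as [C2 HC2]; auto; try lra.
assert (HC' : 0 < / (2 * C)) by (apply Rinv_0_lt_compat; lra).
(* Here [r1] keeps [s] in the domain, 1 keeps [|s|] below [|s0| + 1], and [1 / (2 C)] is the
   smallness that the perturbation argument requires. *)
exists (Rmin r1 (Rmin 1 (/ (2 * C)))); split; [repeat apply Rmin_pos; lra|].
exists C2; intros s Hsr.
pose proof (Rmin_l r1 (Rmin 1 (/ (2 * C)))); pose proof (Rmin_r r1 (Rmin 1 (/ (2 * C)))).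
pose proof (Rmin_l 1 (/ (2 * C))); pose proof (Rmin_r 1 (/ (2 * C))).
assert (Hsmall : Cmod (Csub s s0) * C <= / 2).
{ replace (/ 2) with (/ (2 * C) * C) by (field; lra); apply Rmult_le_compat_r; lra. }
pose proof (perturbed_solve sigma Hs W s0 s C HC Hsol Hsmall) as Hsol'.
pose proof (perturbed_unique sigma Hs W s0 s C HC Hsol Huniq Hsmall) as Huniq'.
split; [apply HO1; lra|split].
- apply invertible_of_gauge; auto.
  intros F M HF; pose proof (proj1 (proj2 HF)).
  (* [M] may be 0, while the solver asks for a positive bound. *)
  destruct (Hsol' F (M + 1)) as [U [HU HUs]]; [lra|apply (gY_mono sigma F M); [exact HF|lra]|].
  now exists U, (2 * C * (M + 1)).
- intros f u Hf Hf0 [Hu _] Heq; apply (HC2 s); auto.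
  + pose proof (Cmod_triangle s0 (Csub s s0)) as T.
    replace (Cadd s0 (Csub s s0)) with s in T by (apply Ceq; simpl; ring); lra.
  + intros x Hx; apply Hf0; pose proof (Rmin_l delta 1); unfold d in Hx; lra.
Qed.
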